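(* Let $\mathbb{F}$ be a real normed division algebra of real dimension $\beta\in\{1,2,4,8\}$, let $p\ge1$, let $\alpha_1,\alpha_2>\frac{(p-1)\beta}{2}$ be real and $\Sigma\in\mathcal{B}_p^\beta$. Let $U\sim KB1_p^\beta(\alpha_1,\alpha_2,\Sigma)$ (Kummer-beta type I distribution). Then for given matrices $\Psi\in\mathcal{C}_p^\beta$, $\Omega\in\mathcal{B}_p^\beta$ with $\Omega-\Psi\in\mathcal{B}_p^\beta$, the random matrix $$X=(\Omega-\Psi)^{\frac12}\,U\,(\Omega-\Psi)^{\frac12}+\Psi$$ has the density function $$C_1(\alpha_1,\alpha_2,\beta,\Theta,\Omega,\Psi)\,\operatorname{etr}(-\Theta X)\,|X-\Psi|^{\alpha_1-\frac{(p-1)\beta}{2}-1}\,|\Omega-X|^{\alpha_2-\frac{(p-1)\beta}{2}-1},\qquad \Psi<X<\Omega,$$ where $\Theta=(\Omega-\Psi)^{-\frac12}\Sigma(\Omega-\Psi)^{-\frac12}$ and $$C_1(\alpha_1,\alpha_2,\beta,\Theta,\Omega,\Psi)=K_1\left(\alpha_1,\alpha_2,\beta,(\Omega-\Psi)^{\frac12}\Theta(\Omega-\Psi)^{\frac12}\right)\operatorname{etr}(\Theta\Psi)\,|\Omega-\Psi|^{-(\alpha_1+\alpha_2)+\frac{(p-1)\beta}{2}+1}.$$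
   Context: The real normed division algebras are the real numbers ($\beta=1$), complex numbers ($\beta=2$), quaternions ($\beta=4$) and octonions ($\beta=8$). For a matrix $A$ over $\mathbb{F}$, $A^*=\bar A^T$ is the conjugate transpose. $\mathcal{C}_p^\beta$ is the real vector space of $p\times p$ matrices $S$ over $\mathbb{F}$ with $S=S^*$, and $\mathcal{B}_p^\beta\subset\mathcal{C}_p^\beta$ is the open cone of positive definite matrices; $A<B$ means $B-A\in\mathcal{B}_p^\beta$. $|A|$ denotes the determinant of a Hermitian matrix, $A^{1/2}$ the positive definite square root of $A\in\mathcal{B}_p^\beta$, and $\operatorname{etr}(A)=\exp(\operatorname{tr}A)$ (with the real part of the trace understood where the trace of a product is not real). Densities on $\mathcal{C}_p^\beta$ are with respect to Lebesgue measure in the diagonal entries and the real components of the strictly upper-triangular entries. A random matrix $U$ has the Kummer-beta type I distribution $KB1_p^\beta(\alpha_1,\alpha_2,\Sigma)$, $\Sigma\in\mathcal{B}_p^\beta$, if its density is $$K_1(\alpha_1,\alpha_2,\beta,\Sigma)\,\operatorname{etr}(-\Sigma U)\,|U|^{\alpha_1-\frac{(p-1)\beta}{2}-1}\,|I_p-U|^{\alpha_2-\frac{(p-1)\beta}{2}-1},\qquad 0<U<I_p,$$ where the normalizing constant is given by $$\{K_1(\alpha_1,\alpha_2,\beta,\Sigma)\}^{-1}=\int_{0<Y<I_p}\operatorname{etr}(-\Sigma Y)\,|Y|^{\alpha_1-\frac{(p-1)\beta}{2}-1}\,|I_p-Y|^{\alpha_2-\frac{(p-1)\beta}{2}-1}\,dY.$$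 The distribution of $X$ in the claim is called the generalized matrix variate Kummer-beta type I distribution, $GKB1_p^\beta(\alpha_1,\alpha_2,\Theta,\Omega,\Psi)$.
   Formalization: For the octonions (β=8) the formal statement assumes p≤3, since for p≥4 the determinant |A| of a Hermitian octonionic matrix and the product (Ω−Ψ)^{1/2}U(Ω−Ψ)^{1/2} have no meaning; for p≤3 that product is read as the Jordan quadratic representation. *)

(* Defs.v *)
From HB Require Import structures.
From mathcomp Require Import all_boot all_order all_algebra all_fingroup.
From mathcomp Require Import all_classical all_reals all_analysis.
From mathcomp Require Import ring.

Set Implicit Arguments.
Unset Strict Implicit.
Unset Printing Implicit Defensive.

Import Order.TTheory GRing.Theory Num.Theory.
Import numFieldNormedType.Exports.

Local Open Scope classical_set_scope.
Local Open Scope ring_scope.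

(** * The real normed division algebras *)

(* Cayley-Dickson doubling: [nda R k] is the algebra of reals, complex numbers,
   quaternions and octonions for k = 0, 1, 2, 3, of real dimension 2 ^ k.
   For larger k the algebra is no longer normed (compare lemma [nnormsqM]). *)
Fixpoint nda (R : realType) (k : nat) : lmodType R :=
  if k is k'.+1 then (nda R k' * nda R k')%type : lmodType R else R^o.

Section nda.
Variable R : realType.

Fixpoint nconj k : nda R k -> nda R k :=
  if k is k'.+1 return nda R k -> nda R k
  then fun x => (nconj x.1, - x.2) else id.

Fixpoint nmul k : nda R k -> nda R k -> nda R k :=
  if k is k'.+1 return nda R k -> nda R k -> nda R k
  then fun x y => (nmul x.1 y.1 - nmul (nconj y.2) x.2,
                   nmul y.2 x.1 + nmul x.2 (nconj y.1))
  else fun x y => (x : R) * (y : R).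

Fixpoint nreal k : R -> nda R k :=
  if k is k'.+1 return R -> nda R k then fun a => (nreal k' a, 0) else id.

Fixpoint nRe k : nda R k -> R :=
  if k is k'.+1 return nda R k -> R then fun x => nRe x.1 else id.

Fixpoint cidx (k : nat) : finType :=
  if k is k'.+1 then (cidx k' + cidx k')%type : finType else unit.

Fixpoint ncomp k : nda R k -> cidx k -> R :=
  if k is k'.+1 return nda R k -> cidx k -> R
  then fun x i => match i with inl j => ncomp x.1 j | inr j => ncomp x.2 j end
  else fun x _ => x.

Fixpoint nofcomp k : (cidx k -> R) -> nda R k :=
  if k is k'.+1 return (cidx k -> R) -> nda R k
  then fun c => (nofcomp (c \o inl), nofcomp (c \o inr))
  else fun c => c tt.

Lemma card_cidx k : #|cidx k| = (2 ^ k)%N.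
Proof.
elim: k => [|k IH] /=; first by rewrite card_unit.
by rewrite card_sum IH addnn expnS mul2n.
Qed.

Lemma ncompK k (x : nda R k) : nofcomp (ncomp x) = x.
Proof.
elim: k x => [//|k IH] [x y] /=.
by congr (_, _); [rewrite -[RHS]IH|rewrite -[RHS]IH].
Qed.

Lemma nofcompK k (c : cidx k -> R) i : ncomp (nofcomp c) i = c i.
Proof. by elim: k c i => [c []//|k IH] c [] i /=; rewrite IH. Qed.

Definition nnormsq k (x : nda R k) : R := \sum_i ncomp x i ^+ 2.

Lemma nnormsqS k (x : nda R k.+1) : nnormsq x = nnormsq x.1 + nnormsq x.2.
Proof. by rewrite /nnormsq big_sumType. Qed.

Lemma nnormsq0 (x : nda R 0) : nnormsq x = (x : R) ^+ 2.
Proof. by rewrite /nnormsq (bigD1 tt) //= big1 ?addr0 // => -[]. Qed.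

Lemma nnormsqM k (x y : nda R k) : (k <= 3)%N ->
  nnormsq (nmul x y) = nnormsq x * nnormsq y.
Proof.
case: k x y => [|[|[|[|//]]]] x y _.
- by rewrite !nnormsq0 /=; ring.
- by rewrite !nnormsqS !nnormsq0 /=; ring.
- by rewrite !nnormsqS !nnormsq0 /=; ring.
- by rewrite !nnormsqS !nnormsq0 /=; ring.
Qed.

Lemma nmulA k (x y z : nda R k) : (k <= 2)%N ->
  nmul x (nmul y z) = nmul (nmul x y) z.
Proof.
case: k x y z => [|[|[|//]]] /= x y z _.
- by rewrite mulrA.
- by congr (_, _) => /=; ring.
- by congr (_, _) => /=; congr (_, _) => /=; ring.
Qed.

Lemma nconjD k (x y : nda R k) : nconj (x + y) = nconj x + nconj y.
Proof.
by elim: k x y => [//|k IH] [x x'] [y y'] /=; rewrite IH opprD; congr (_, _).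
Qed.

Lemma nconjZ k (a : R) (x : nda R k) : nconj (a *: x) = a *: nconj x.
Proof.
by elim: k x => [//|k IH] [x x'] /=; rewrite IH -scalerN; congr (_, _).
Qed.

Lemma nconjK k : involutive (@nconj k).
Proof. by elim: k => [//|k IH] [x x'] /=; rewrite IH opprK. Qed.

Lemma nmulD k (x y z : nda R k) :
  nmul (x + y) z = nmul x z + nmul y z /\ nmul z (x + y) = nmul z x + nmul z y.
Proof.
elim: k x y z => [|k IH] x y z; first by rewrite /= mulrDl mulrDr.
have Dl u v w := (IH u v w).1; have Dr u v w := (IH u v w).2.
by split; apply: injective_projections => /=; rewrite ?nconjD ?Dl ?Dr ?opprD addrACA.
Qed.

Lemma nmulDl k (x y z : nda R k) : nmul (x + y) z = nmul x z + nmul y z.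
Proof. exact: (nmulD x y z).1. Qed.

Lemma nmulDr k (x y z : nda R k) : nmul z (x + y) = nmul z x + nmul z y.
Proof. exact: (nmulD x y z).2. Qed.

Lemma nmulZ k (a : R) (x y : nda R k) :
  nmul (a *: x) y = a *: nmul x y /\ nmul x (a *: y) = a *: nmul x y.
Proof.
elim: k x y => [|k IH] x y.
  by split; rewrite /GRing.scale /=; [rewrite mulrA|rewrite mulrCA].
have Zl u v := (IH u v).1; have Zr u v := (IH u v).2.
by split; apply: injective_projections => /=; rewrite ?nconjZ ?Zl ?Zr -?scalerN -scalerDr.
Qed.

Lemma nmulZl k (a : R) (x y : nda R k) : nmul (a *: x) y = a *: nmul x y.
Proof. exact: (nmulZ a x y).1. Qed.

Lemma nmulZr k (a : R) (x y : nda R k) : nmul x (a *: y) = a *: nmul x y.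
Proof. exact: (nmulZ a x y).2. Qed.

Lemma nmul0l k (x : nda R k) : nmul 0 x = 0.
Proof. by rewrite -[X in nmul X _](scale0r 0) nmulZl scale0r. Qed.

Lemma nmul0r k (x : nda R k) : nmul x 0 = 0.
Proof. by rewrite -[X in nmul _ X](scale0r 0) nmulZr scale0r. Qed.

Lemma nreal0 k : nreal k (0 : R) = 0 :> nda R k.
Proof. by elim: k => [//|k IH] /=; rewrite IH. Qed.

Lemma nconjB k (x y : nda R k) : nconj (x - y) = nconj x - nconj y.
Proof. by rewrite nconjD -(scaleN1r y) nconjZ scaleN1r. Qed.

Lemma nconjN k (x : nda R k) : nconj (- x) = - nconj x.
Proof. by rewrite -scaleN1r nconjZ scaleN1r. Qed.

Lemma nconj_real k (a : R) : nconj (nreal k a) = nreal k a.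
Proof. by elim: k => [//|k IH] /=; rewrite IH oppr0. Qed.

Lemma nconj0 k : nconj (0 : nda R k) = 0.
Proof. by rewrite -nreal0 nconj_real. Qed.

Lemma nmul1 k (x : nda R k) : nmul (nreal k 1) x = x /\ nmul x (nreal k 1) = x.
Proof.
elim: k x => [|k IH] x; first by rewrite /= mul1r mulr1.
have I1 y := (IH y).1; have I2 y := (IH y).2.
split; apply: injective_projections => /=;
  by rewrite ?nconj_real ?nconj0 ?I1 ?I2 ?nmul0l ?nmul0r ?oppr0 ?addr0 ?add0r.
Qed.

Lemma nmul1l k (x : nda R k) : nmul (nreal k 1) x = x.
Proof. exact: (nmul1 x).1. Qed.

Lemma nmul1r k (x : nda R k) : nmul x (nreal k 1) = x.
Proof. exact: (nmul1 x).2. Qed.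

Lemma nmulNl k (x y : nda R k) : nmul (- x) y = - nmul x y.
Proof. by rewrite -scaleN1r nmulZl scaleN1r. Qed.

Lemma nmulNr k (x y : nda R k) : nmul x (- y) = - nmul x y.
Proof. by rewrite -scaleN1r nmulZr scaleN1r. Qed.

Lemma nconjM k (x y : nda R k) : nconj (nmul x y) = nmul (nconj y) (nconj x).
Proof.
elim: k x y => [|k IH] x y; first by rewrite /= mulrC.
apply: injective_projections => /=.
  by rewrite nconjB !IH nconjK nconjN nmulNl nmulNr opprK.
by rewrite nconjK !nmulNl opprD addrC.
Qed.
End nda.

(** * Lebesgue measure on [R^n] *)

Section lebesgue_tuple.
Variable R : realType.
Notation RT := (measurableTypeR R).
Local Open Scope ereal_scope.

Definition tcons n (x : RT * n.-tuple RT) : n.+1.-tuple RT := [tuple of x.1 :: x.2].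

Lemma measurable_tcons n : measurable_fun [set: RT * n.-tuple RT] (@tcons n).
Proof. exact: measurable_cons. Qed.

Section step.
Variables (n : nat) (m : {sigma_finite_measure set (n.-tuple RT) -> \bar R}).

Definition leb_step : set (n.+1.-tuple RT) -> \bar R :=
  pushforward (lebesgue_measure \x m) (@tcons n).

Let measurable_preimage_tcons (A : set (n.+1.-tuple RT)) :
  measurable A -> measurable (@tcons n @^-1` A).
Proof. by move=> mA; rewrite -[X in measurable X]setTI; exact: measurable_tcons. Qed.

Let leb_step0 : leb_step set0 = 0.
Proof. by rewrite /leb_step /pushforward preimage_set0 measure0. Qed.

Let leb_step_ge0 A : 0 <= leb_step A.
Proof. by rewrite /leb_step /pushforward; exact: measure_ge0. Qed.

Let leb_step_additive : semi_sigma_additive leb_step.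
Proof.
move=> F mF tF mUF; rewrite /leb_step /pushforward preimage_bigcup.
apply: measure_semi_sigma_additive.
- by move=> i; exact: measurable_preimage_tcons.
- apply/trivIsetP => /= i j _ _ ij; rewrite -preimage_setI.
  by move/trivIsetP : tF => /(_ _ _ _ _ ij) ->//; rewrite preimage_set0.
- by rewrite -preimage_bigcup; exact: measurable_preimage_tcons.
Qed.

HB.instance Definition _ := isMeasure.Build _ _ _ leb_step
  leb_step0 leb_step_ge0 leb_step_additive.

Let tuncons (t : n.+1.-tuple RT) : RT * n.-tuple RT :=
  (thead t, [tuple of behead t]).

Let leb_step_sigma_finite : sigma_finite setT leb_step.
Proof.
have /sigma_finiteP[F [TF ndF Foo]] := sigma_finiteT (@lebesgue_measure R).
have /sigma_finiteP[G [TG ndG Goo]] := sigma_finiteT m.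
have tconsK : cancel (@tcons n) tuncons.
  by case=> x t; rewrite /tuncons /= theadE; congr (_, _); apply/val_inj.
have mtuncons : measurable_fun [set: n.+1.-tuple RT] tuncons.
  apply/measurable_fun_pairP; split => /=.
    exact: measurable_tnth.
  exact: measurable_behead.
exists (fun i => tuncons @^-1` (F i `*` G i)).
  rewrite -preimage_bigcup (_ : \bigcup_i _ = setT) ?preimage_setT//.
  rewrite -setXTT TF TG predeqE => -[x y]; split.
    by move=> [i _ []/= ? ?]; split; exists i.
  move=> [/= [i _ Fix] [j _ Gjy]]; exists (maxn i j) => //; split.
  - by move: x Fix; exact/subsetPset/ndF/leq_maxl.
  - by move: y Gjy; exact/subsetPset/ndG/leq_maxr.
move=> i; have [? ?] := Foo i; have [? ?] := Goo i; split.
  by rewrite -[X in measurable X]setTI; apply: mtuncons => //; exact: measurableX.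
rewrite /leb_step /pushforward -comp_preimage (_ : _ \o _ = id)/=; last first.
  by apply/funext => x; exact: tconsK.
by rewrite preimage_id product_measure1E// lte_mul_pinfty// ge0_fin_numE.
Qed.

HB.instance Definition _ := Measure_isSigmaFinite.Build _ _ _ leb_step
  leb_step_sigma_finite.
End step.

Fixpoint leb n : {sigma_finite_measure set (n.-tuple RT) -> \bar R} :=
  if n is n'.+1 return {sigma_finite_measure set (n.-tuple RT) -> \bar R}
  then leb_step (leb n') else \d_([tuple] : 0.-tuple RT).

Lemma leb_box n (A : 'I_n -> set RT) : (forall i, measurable (A i)) ->
  leb n [set t | forall i, A i (tnth t i)] = \prod_(i < n) lebesgue_measure (A i).
Proof.
elim: n A => [|n IH] A mA /=.
  by rewrite big_ord0 diracE mem_set// => -[].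
rewrite big_ord_recl -IH// /leb_step /pushforward -product_measure1E//.
  congr (_ \x _); apply/seteqP; split => -[x t] /=.
    by move=> h; split => [|i]; [have := h ord0; rewrite tnth0|
       have := h (lift ord0 i); rewrite tnthS].
  move=> [h0 h] i; case: (unliftP ord0 i) => [j ->|->]; first by rewrite tnthS.
  by rewrite tnth0.
rewrite (_ : mkset _ = \bigcap_(i : 'I_n) ((@tnth n RT)^~ i @^-1` A (lift ord0 i))).
  apply: fin_bigcap_measurable; first exact: finite_finset.
  by move=> i _; rewrite -[X in measurable X]setTI; exact: measurable_tnth.
by apply/seteqP; split => t /= h i; [move=> _; exact: h|exact: h].
Qed.
End lebesgue_tuple.

(** * Hermitian matrices *)

Section hermitian.
Variables (R : realType) (k p : nat).
Notation F := (nda R k).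
Notation M := ('M[F]_p).
Implicit Types A B U : M.

(* the library product [*m] needs an associative ring of coefficients *)
Definition nmulmx m n q (A : 'M[F]_(m, n)) (B : 'M[F]_(n, q)) : 'M[F]_(m, q) :=
  \matrix_(i, j) \sum_l nmul (A i l) (B l j).

Definition nadj m n (A : 'M[F]_(m, n)) : 'M[F]_(n, m) :=
  (map_mx (@nconj R k) A)^T.

Definition nid : M := \matrix_(i, j) nreal k (i == j)%:R.

Definition herm A : Prop := nadj A = A.

Definition jordan A B : M :=
  map_mx (fun x : F => 2^-1 *: x) (nmulmx A B + nmulmx B A).

(* The product A U A of Hermitian matrices.  Over an associative algebra it is
   the ordinary product (lemma [sandwichE] below).  For 3 x 3 octonionic
   matrices (A U) A and A (U A) differ and need not be Hermitian; there A U A is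
   the quadratic representation of the Albert algebra. *)
Definition sandwich A U : M :=
  jordan A (jordan A U) *+ 2 - jordan (jordan A A) U.

(* Positive definiteness: x^* A x > 0 for all x <> 0.  Over the octonions x
   ranges over the vectors whose entries generate an associative subalgebra:
   they span the rank one elements x x^* of the Jordan algebra, and for p <= 3
   this is its cone of positive elements (with arbitrary octonionic vectors
   the cone would be strictly smaller for p = 3).  Over an associative algebra
   there is no restriction on x (lemma [nmulA]). *)
Definition pd A : Prop := herm A /\
  forall x : 'cV[F]_p, x != 0 ->
    (forall i j l, nmul (x i 0) (nmul (x j 0) (x l 0)) =
                   nmul (nmul (x i 0) (x j 0)) (x l 0)) ->
    0 < nRe (nmulmx (nadj x) (nmulmx A x) 0 0).

Definition hlt A B : Prop := pd (B - A).

(* A i (s i) * (A (s i) (s (s i)) * ...), once around the cycle of s at i *)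
Definition cycle_prod A (s : 'S_p) (i : 'I_p) : F :=
  \big[@nmul R k/nreal k 1]_(j <- traject s i #|porbit s i|) A j (s j).

(* Moore determinant of a Hermitian matrix: the sum over permutations of the
   signed products along the cycles, each cycle being started at its smallest
   element.  It is the usual determinant over the reals (lemma [hdet_real]) and
   the complex numbers, and Freudenthal's determinant of octonionic matrices of
   size at most 3.  Since A is Hermitian, a permutation and the one with a
   cycle reversed contribute conjugate factors, so that only the real part of
   each factor matters. *)
Definition hdet A : R :=
  \sum_(s : 'S_p) (-1) ^+ s *
    \prod_(i < p | [forall j in porbit s i, (i <= j)%N]) nRe (cycle_prod A s i).

Definition hsqrt A : M := xget 0 [set B | pd B /\ nmulmx B B = A].

(* Jordan inverse; over an associative algebra this is A^-1 (lemma [is_hinvE]) *)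
Definition is_hinv A B : Prop :=
  [/\ herm B, jordan A B = nid & jordan (jordan A A) B = A].
Definition hinv A : M := xget 0 [set B | is_hinv A B].

Definition etr A : R := expR (nRe (\tr A)).

(** Coordinates: diagonal entries, and real components above the diagonal *)

Definition hidx : finType :=
  ('I_p + {ij : 'I_p * 'I_p | (ij.1 < ij.2)%N} * cidx k)%type.

Notation V := (#|hidx|.-tuple (measurableTypeR R)).

Definition hcoord A : V :=
  [tuple match enum_val r with
         | inl i => nRe (A i i)
         | inr (ij, c) => ncomp (A (val ij).1 (val ij).2) c
         end | r < #|hidx|].

Definition hupper (v : V) (i j : 'I_p) : F :=
  if insub (i, j) is Some ij
  then nofcomp (fun c => tnth v (enum_rank (inr (ij, c)))) else 0.

Definition hmx (v : V) : M := \matrix_(i, j)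
  if i == j then nreal k (tnth v (enum_rank (inl i)))
  else hupper v i j + nconj (hupper v j i).

(* [f] is a density, concentrated on [D], of the Hermitian random matrix [X] *)
Definition has_density d (T : measurableType d) (P : probability T R)
    (X : T -> M) (D : set M) (f : M -> R) : Prop :=
  [/\ (forall w, herm (X w)) /\ measurable_fun [set: T] (hcoord \o X),
      measurable (hmx @^-1` D),
      measurable_fun (hmx @^-1` D) (f \o hmx),
      (forall A, D A -> 0 <= f A) &
      forall B : set V, measurable B ->
        P ((hcoord \o X) @^-1` B) =
        (\int[leb R #|hidx|]_(v in B `&` hmx @^-1` D) (f (hmx v))%:E)%E].

Definition beta : R := (2 ^ k)%:R.

Definition hexp : R := (p%:R - 1) * beta / 2.

Definition K1 (a1 a2 : R) (Sigma : M) : R :=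
  (\int[leb R #|hidx|]_(v in hmx @^-1` [set Y | hlt 0 Y /\ hlt Y nid])
     (etr (- nmulmx Sigma (hmx v)) * hdet (hmx v) `^ (a1 - hexp - 1)
      * hdet (nid - hmx v) `^ (a2 - hexp - 1)))^-1.

Definition KB1 d (T : measurableType d) (P : probability T R) (U : T -> M)
    (a1 a2 : R) (Sigma : M) : Prop :=
  has_density P U [set Y | hlt 0 Y /\ hlt Y nid]
    (fun Y => K1 a1 a2 Sigma * etr (- nmulmx Sigma Y)
      * hdet Y `^ (a1 - hexp - 1) * hdet (nid - Y) `^ (a2 - hexp - 1)).

Definition C1 (a1 a2 : R) (Theta Omega Psi : M) : R :=
  K1 a1 a2 (sandwich (hsqrt (Omega - Psi)) Theta) * etr (nmulmx Theta Psi)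
  * hdet (Omega - Psi) `^ (- (a1 + a2) + hexp + 1).

End hermitian.

Section hermitian_theory.
Variables (R : realType) (k p : nat).
Notation F := (nda R k).
Notation M := ('M[F]_p).
Implicit Types A B U : M.
Notation half := (map_mx (fun x : F => 2^-1 *: x)).

Lemma nmulmxDl A B U : nmulmx (A + B) U = nmulmx A U + nmulmx B U.
Proof.
apply/matrixP => i j; rewrite !mxE -big_split /=; apply: eq_bigr => l _.
by rewrite mxE nmulDl.
Qed.

Lemma nmulmxDr A B U : nmulmx U (A + B) = nmulmx U A + nmulmx U B.
Proof.
apply/matrixP => i j; rewrite !mxE -big_split /=; apply: eq_bigr => l _.
by rewrite mxE nmulDr.
Qed.

Lemma nmulmx_halfl A U : nmulmx (half A) U = half (nmulmx A U).
Proof.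
apply/matrixP => i j; rewrite !mxE scaler_sumr; apply: eq_bigr => l _.
by rewrite mxE nmulZl.
Qed.

Lemma nmulmx_halfr A U : nmulmx U (half A) = half (nmulmx U A).
Proof.
apply/matrixP => i j; rewrite !mxE scaler_sumr; apply: eq_bigr => l _.
by rewrite mxE nmulZr.
Qed.

Lemma halfK A : half A + half A = A.
Proof.
apply/matrixP => i j; rewrite !mxE -scalerDl -{1 2}(mul1r (2^-1 : R)) -splitr.
by rewrite scale1r.
Qed.

Lemma halfD A B : half (A + B) = half A + half B.
Proof. by apply/matrixP => i j; rewrite !mxE scalerDr. Qed.

Lemma nmul_suml n (f : 'I_n -> F) (y : F) :
  nmul (\sum_i f i) y = \sum_i nmul (f i) y.
Proof.
elim/big_rec2: _ => [|i u v _ <-]; by rewrite ?nmul0l ?nmulDl.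
Qed.

Lemma nmul_sumr n (f : 'I_n -> F) (y : F) :
  nmul y (\sum_i f i) = \sum_i nmul y (f i).
Proof. elim/big_rec2: _ => [|i u v _ <-]; by rewrite ?nmul0r ?nmulDr. Qed.

Lemma nmulmxA A B U : (k <= 2)%N ->
  nmulmx A (nmulmx B U) = nmulmx (nmulmx A B) U.
Proof.
move=> k2; apply/matrixP => i j; rewrite !mxE.
under eq_bigr do rewrite mxE nmul_sumr.
rewrite exchange_big /=; apply: eq_bigr => l _; rewrite mxE nmul_suml.
by apply: eq_bigr => l' _; rewrite nmulA.
Qed.

Lemma nmulmx1 A : nmulmx A (nid R k p) = A.
Proof.
apply/matrixP => i j; rewrite mxE (bigD1 j)//= big1 ?addr0.
  by rewrite mxE eqxx nmul1r.
by move=> l /negPf lj; rewrite mxE lj nreal0 nmul0r.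
Qed.

Lemma nmul1mx A : nmulmx (nid R k p) A = A.
Proof.
apply/matrixP => i j; rewrite mxE (bigD1 i)//= big1 ?addr0.
  by rewrite mxE eqxx nmul1l.
by move=> l /negPf li; rewrite mxE eq_sym li nreal0 nmul0l.
Qed.

Lemma nadjM A B : nadj (nmulmx A B) = nmulmx (nadj B) (nadj A).
Proof.
apply/matrixP => i j; rewrite !mxE.
rewrite (big_morph (@nconj R k) (@nconjD R k) (_ : _ = 0)); last first.
  by rewrite -(nreal0 R k) nconj_real.
by apply: eq_bigr => l _; rewrite !mxE nconjM.
Qed.

Lemma sandwichE A U : (k <= 2)%N -> sandwich A U = nmulmx (nmulmx A U) A.
Proof.
move=> k2; rewrite /sandwich /jordan.
rewrite !(nmulmx_halfl, nmulmx_halfr, nmulmxDl, nmulmxDr, halfD).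
rewrite !nmulmxA// mulr2n.
set a := nmulmx (nmulmx A A) U; set b := nmulmx (nmulmx A U) A.
set c := nmulmx (nmulmx U A) A.
set x := half (half a); set y := half (half b); set z := half (half c).
have -> : b = y + y + (y + y) by rewrite /y !halfK.
apply/eqP; rewrite subr_eq; apply/eqP.
by rewrite (ssrAC.AC ((2*2)*(2*2)) ((2*3*(6*7))*(1*5*(4*8)))).
Qed.

Lemma double_inj A B : A + A = B + B -> A = B.
Proof. by move=> /(congr1 half); rewrite !halfD !halfK. Qed.

Lemma is_hinvE A B : (k <= 2)%N -> herm A ->
  is_hinv A B <-> herm B /\ nmulmx A B = nid R k p.
Proof.
move=> k2 hA; split => -[hB].
  have dj (X Y : M) : jordan X Y + jordan X Y = nmulmx X Y + nmulmx Y X.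
    by rewrite /jordan halfK.
  move=> h1 /(congr1 (fun X => X + X)); rewrite dj => h2.
  have := dj A B; rewrite h1 => h3.
  have hl : nmulmx (nmulmx A A) B + nmulmx (nmulmx A B) A = A + A.
    by rewrite -!nmulmxA// -nmulmxDr -h3 nmulmxDr nmulmx1.
  have hr : nmulmx (nmulmx A B) A + nmulmx B (nmulmx A A) = A + A.
    by rewrite nmulmxA// -nmulmxDl -h3 nmulmxDl nmul1mx.
  have jAA : jordan A A = nmulmx A A by rewrite /jordan halfD halfK.
  have hABA : nmulmx (nmulmx A B) A = A.
    apply: double_inj; apply: (@addrI _ (A + A)).
    rewrite -[X in _ = X + _]hl -[X in _ = _ + X]hr -[X in X + _ = _]h2 jAA.
    by rewrite addrACA; congr (_ + _); rewrite addrC.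
  split=> //.
  set e := nmulmx A B in h3 *; set f := nmulmx B A in h3.
  have ee : nmulmx e e = e by rewrite /e nmulmxA// hABA.
  have ff : nmulmx f f = f by rewrite /f -nmulmxA// [X in nmulmx B X]nmulmxA// hABA.
  have efe : nmulmx e f = e.
    by apply: (@addrI _ e); rewrite -{1}ee -nmulmxDr -h3 nmulmxDr nmulmx1.
  have eff : nmulmx e f = f.
    by apply: (@addIr _ f); rewrite -{2}ff -nmulmxDl -h3 nmulmxDl nmul1mx.
  by apply: double_inj; rewrite h3 -[in RHS]eff efe.
move=> AB; have BA : nmulmx B A = nid R k p.
  have := congr1 (@nadj R k p p) AB; rewrite nadjM hA hB => ->.
  apply/matrixP => i j; rewrite !mxE nconj_real eq_sym.
  by [].
have jE (X Y : M) : jordan X Y = half (nmulmx X Y + nmulmx Y X) by [].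
have jAA : jordan A A = nmulmx A A by rewrite jE halfD halfK.
split => //; first by rewrite jE AB BA halfD halfK.
by rewrite jAA jE -nmulmxA// AB nmulmx1 nmulmxA// BA nmul1mx halfD halfK.
Qed.

Lemma nreal_Re (x : F) : nconj x = x -> nreal k (nRe x) = x.
Proof.
elim: k x => [//|k' IH] [x y] /= [/IH -> /eqP].
by rewrite eq_sym -addr_eq0 -mulr2n -scaler_nat scaler_eq0 pnatr_eq0 => /eqP ->.
Qed.

Lemma nReK (a : R) : nRe (nreal k a) = a.
Proof. by elim: k => [//|k' IH] /=. Qed.

Lemma herm_hmx (v : #|hidx k p|.-tuple (measurableTypeR R)) : herm (hmx v : M).
Proof.
apply/matrixP => i j; rewrite !mxE eq_sym.
by case: eqVneq => [->|_]; rewrite ?nconj_real// nconjD nconjK addrC.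
Qed.

Lemma hcoordK (A : M) : herm A -> hmx (hcoord A) = A.
Proof.
move=> hA; have AC i j : nconj (A j i) = A i j.
  by have /matrixP/(_ i j) := hA; rewrite !mxE.
have up i j : hupper (hcoord A) i j = if (i < j)%N then A i j else 0.
  rewrite /hupper; case: insubP => [[[i' j'] h] /= -> [ei ej]|/= /negPf ->//].
  rewrite -ei -ej.
  rewrite -[RHS]ncompK; congr nofcomp; apply/funext => c.
  by rewrite tnth_mktuple enum_rankK.
apply/matrixP => i j; rewrite mxE; case: eqVneq => [->|ij].
  by rewrite tnth_mktuple enum_rankK nreal_Re ?AC.
rewrite !up; case: ltngtP => [_|_|/val_inj/eqP]; last by rewrite (negPf ij).
- by rewrite nconj0 addr0.
- by rewrite add0r AC.
Qed.

Lemma hmxK v : hcoord (hmx v : M) = v.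
Proof.
apply: eq_from_tnth => r; rewrite tnth_mktuple.
rewrite -[r in RHS]enum_valK; case: (enum_val r) => [i|[[[i j] /= ij] c]].
  by rewrite mxE eqxx nReK.
have /negPf inj : i != j by apply/eqP => e; rewrite e ltnn in ij.
rewrite mxE /= inj.
rewrite /hupper (@insubT _ (fun x : 'I_p * 'I_p => x.1 < x.2)%N _ (i, j) ij) insubF/= ?ltnNge ?(ltnW ij)//.
by rewrite nconj0 addr0 nofcompK.
Qed.
End hermitian_theory.

Lemma hdet_real (R : realType) p (A : 'M[R]_p) : @hdet R 0 p A = \det A.
Proof.
apply: eq_bigr => s _; congr (_ * _).
pose m (i : 'I_p) := [arg min_(j < i in porbit s i) (j : nat)]%N.
have mP i : m i \in porbit s i /\ forall j, j \in porbit s i -> (m i <= j)%N.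
  by rewrite /m; case: arg_minnP => [|j ? ?]; first exact: porbit_id.
rewrite [RHS](partition_big m (fun i => [forall j in porbit s i, (i <= j)%N]))/=.
  apply: eq_bigr => i /forall_inP imin.
  rewrite (eq_bigl (fun j => j \in porbit s i)) => [|j].
    rewrite -(eq_bigl _ _ (fun j => esym (porbit_traject s i j))) -big_uniq//=.
    exact: uniq_traject_porbit.
  apply/eqP/idP => [<-|]; first by rewrite porbit_sym; exact: (mP j).1.
  rewrite -eq_porbit_mem => /eqP ji; have [h1 h2] := mP j.
  have mji : (m j <= i)%N by apply: h2; rewrite ji porbit_id.
  have imj : (i <= m j)%N by apply: imin; rewrite -ji.
  by apply/val_inj/eqP; rewrite eqn_leq mji imj.
move=> i _; have [h1 h2] := mP i; apply/forall_inP => j.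
by move: h1; rewrite -eq_porbit_mem => /eqP ->; exact: h2.
Qed.

(* Main.v *)
Require Import Defs.
From HB Require Import structures.
From mathcomp Require Import all_boot all_order all_algebra all_fingroup.
From mathcomp Require Import all_classical all_reals all_analysis.
From mathcomp Require Import measurable_realfun.
From mathcomp Require Import ring lra zify.

Set Implicit Arguments.
Unset Strict Implicit.
Unset Printing Implicit Defensive.

Import Order.TTheory GRing.Theory Num.Theory.
Import numFieldNormedType.Exports.

Local Open Scope classical_set_scope.
Local Open Scope ring_scope.

(* Everything reduces to the behaviour of Y |-> S Y S for positive definite S,
   uniformly over the four algebras.  In the octonionic case matrices do not
   associate, so one cannot work with S Y S as a product.  Instead one uses
   linear automorphisms f of the Jordan algebra of Hermitian matrices that
   preserve the trace and the determinant.  They act compatibly on everything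
   in sight (positivity, square roots, Jordan inverses, S Y S), and they preserve
   Lebesgue measure because they preserve the form Re tr (X Y).  By the spectral
   theorem some f maps S to a real diagonal matrix diag(d), for which
   (S Y S)_ij = d_i d_j Y_ij: positivity is preserved, the determinant is
   multiplied by |S|^2 = (prod d)^2, and the Jacobian is
   (prod d)^(2 + (p - 1) beta) = |S^2|^((p - 1) beta / 2 + 1).

   The spectral theorem is proved by a compactness form of the Jacobi method.
   The automorphisms form a compact set in the product topology, so one of them
   maximises the sum of the squared diagonal entries; a nonzero off-diagonal
   entry could be made real by a diagonal unitary and then rotated away by a
   real plane rotation, which increases this sum.  Plane rotations preserve the
   determinant because they are products of transvections. *)

(** * Cayley-Dickson algebras of dimension at most 8 *)

(** Over the octonions neither conjugation by unitary matrices nor a multiplicative determinant is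
    at hand: for [p = 3] the automorphism group is exceptional and is not a group of octonionic
    matrices. Automorphisms are therefore kept as bare functions, and two explicit families,
    diagonal unitaries and plane rotations, suffice to move away from a maximum. The bound [p <= 3]
    acts twice. Cycle words have length at most three, where the real part of a product ignores
    bracketing and rotation; and three distinct indices exhaust the matrix, so that the Moufang
    identities cover every case. Positivity becomes intrinsic because the matrices x x^* are the
    Hermitian E with E^2 = (tr E) E and positive trace. The Jacobian is found without a change of
    variables formula in several dimensions: an additive measurable bijection scales Lebesgue
    measure by a constant, which one test set reveals. The normalising integral is never evaluated:
    once S Theta S = Sigma is known, the same number [K1] stands in both densities. *)

Section nda_theory.
Variable R : realType.
Implicit Types k : nat.

Lemma nreD k (x y : nda R k) : nRe (x + y) = nRe x + nRe y.
Proof. by elim: k x y => [//|k IH] [x x'] [y y'] /=. Qed.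

Lemma nreZ k a (x : nda R k) : nRe (a *: x) = a * nRe x.
Proof. by elim: k x => [//|k IH] [x x'] /=. Qed.

Lemma nreN k (x : nda R k) : nRe (- x) = - nRe x.
Proof. by rewrite -scaleN1r nreZ mulN1r. Qed.

Lemma nreB k (x y : nda R k) : nRe (x - y) = nRe x - nRe y.
Proof. by rewrite nreD nreN. Qed.

Lemma nre0 k : nRe (0 : nda R k) = 0.
Proof. by rewrite -(scale0r (0 : nda R k)) nreZ mul0r. Qed.

Lemma nre_sum k I (r : seq I) (P : pred I) (f : I -> nda R k) :
  nRe (\sum_(i <- r | P i) f i) = \sum_(i <- r | P i) nRe (f i).
Proof. exact: (big_morph _ (@nreD k) (nre0 k)). Qed.

Lemma nre_conj k (x : nda R k) : nRe (nconj x) = nRe x.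
Proof. by elim: k x => [//|k IH] [x x'] /=. Qed.

Lemma nmulBl k (x y z : nda R k) : nmul (x - y) z = nmul x z - nmul y z.
Proof. by rewrite nmulDl nmulNl. Qed.

Lemma nmulBr k (x y z : nda R k) : nmul z (x - y) = nmul z x - nmul z y.
Proof. by rewrite nmulDr nmulNr. Qed.

Lemma nre_mulC k (x y : nda R k) : nRe (nmul x y) = nRe (nmul y x).
Proof.
elim: k x y => [|k IH]; first by move=> x y /=; rewrite mulrC.
move=> [a b] [c d] /=; rewrite !nreB IH; congr (_ - _).
by rewrite -nre_conj nconjM nconjK.
Qed.

(** Survives every doubling: each side expands into four terms, which match up to cyclic rotation,
    and cyclicity of the real part one level down is the induction hypothesis together with
    [nre_mulC]. *)
Lemma nre_mulA k (x y z : nda R k) :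
  nRe (nmul x (nmul y z)) = nRe (nmul (nmul x y) z).
Proof.
elim: k x y z => [|k IH] /=; first by move=> *; rewrite mulrA.
move=> [a b] [c d] [e f] /=.
have cyc (x y z : nda R k) : nRe (nmul (nmul x y) z) = nRe (nmul (nmul y z) x).
  by rewrite -IH nre_mulC.
rewrite nconjD !nconjM nconjK !(nmulBl, nmulBr, nmulDl, nmulDr, nreB, nreD).
rewrite !IH (cyc a (nconj f)) (cyc e) (cyc (nconj c)).
by ring.
Qed.

Lemma nrealD k (a b : R) : nreal k (a + b) = nreal k a + nreal k b.
Proof.
by elim: k => [//|k IH] /=; rewrite IH; apply: injective_projections => /=; rewrite ?addr0.
Qed.

Lemma nnormsqE k (x : nda R k) :
  nmul (nconj x) x = nreal k (nnormsq x) /\ nmul x (nconj x) = nreal k (nnormsq x).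
Proof.
elim: k x => [|k IH]; first by move=> x /=; rewrite nnormsq0 expr2.
move=> [a b]; rewrite nnormsqS /=.
rewrite !nmulNr !nmulNl nconjN nmulNl !opprK nconjK (IH a).1 (IH a).2 (IH b).1.
by rewrite addrN addNr nrealD.
Qed.

Lemma nrealE k (a : R) : nreal k a = a *: nreal k 1.
Proof.
elim: k a => [|k IH] a /=; first by rewrite /GRing.scale /= mulr1.
by rewrite IH; congr (_, _); rewrite scaler0.
Qed.

Lemma nmul_reall k a (x : nda R k) : nmul (nreal k a) x = a *: x.
Proof. by rewrite nrealE nmulZl nmul1l. Qed.

Lemma nmul_realr k a (x : nda R k) : nmul x (nreal k a) = a *: x.
Proof. by rewrite nrealE nmulZr nmul1r. Qed.

(** The two components of a doubled element lie in an algebra with [k <= 2], which is associative,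
    so the cross terms cancel and norms remain. All the alternative and Moufang laws below come from
    this identity. *)
Lemma nmulV k (x y : nda R k) : (k <= 3)%N ->
  nmul (nconj x) (nmul x y) = nnormsq x *: y.
Proof.
case: k x y => [|k] x y k3.
  by rewrite nnormsq0 /= mulrA expr2.
case: x y => [a b] [c d]; rewrite nnormsqS /=.
apply: injective_projections => /=.
  rewrite nconjD !nconjM nconjK !(nmulBr, nmulDl, nmulNr, opprK) !nmulA //.
  rewrite (nnormsqE a).1 -(nmulA c) // (nnormsqE b).1 nmul_reall nmul_realr.
  by rewrite scalerDl opprB opprK addrA addrAC subrK addrC.
rewrite nconjB !nconjM !(nmulBr, nmulDl, nmulNl, opprB, nconjK) -!nmulA //.
rewrite (nmulA b (nconj b)) // (nnormsqE a).2 (nnormsqE b).2 nmul_realr nmul_reall.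
by rewrite opprK scalerDl addrA addrK.
Qed.

Lemma nconjE k (x : nda R k) : nconj x = (2 * nRe x) *: nreal k 1 - x.
Proof.
elim: k x => [|k IH]; first by move=> x /=; rewrite /GRing.scale /=; ring.
move=> [a b] /=; rewrite IH; apply: injective_projections => //=.
by rewrite scaler0 add0r.
Qed.

Lemma nnormsq_conj k (x : nda R k) : nnormsq (nconj x) = nnormsq x.
Proof.
have := (nnormsqE (nconj x)).1; rewrite nconjK (nnormsqE x).2 => /(congr1 (@nRe R k)).
by rewrite !nReK.
Qed.

Lemma nmulVr k (x y : nda R k) : (k <= 3)%N ->
  nmul (nmul y x) (nconj x) = nnormsq x *: y.
Proof.
move=> k3; have := congr1 (@nconj R k) (nmulV (nconj x) (nconj y) k3).
by rewrite !nconjM !nconjK nconjZ nconjK nnormsq_conj.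
Qed.

(** [nconj x] is a real multiple of one minus [x]; substituting this in [nmulV] leaves the
    alternative law. *)
Lemma nmul_altl k (x y : nda R k) : (k <= 3)%N ->
  nmul x (nmul x y) = nmul (nmul x x) y.
Proof.
move=> k3; have := nmulV x y k3; rewrite -nmul_reall -(nnormsqE x).1 nconjE.
rewrite !nmulBl !nmulZl !nmul1l => /addrI /oppr_inj; exact.
Qed.

Lemma nmul_altr k (x y : nda R k) : (k <= 3)%N ->
  nmul (nmul y x) x = nmul y (nmul x x).
Proof.
move=> k3; have := congr1 (@nconj R k) (nmul_altl (nconj x) (nconj y) k3).
by rewrite !nconjM !nconjK.
Qed.

(** Polarisation of the alternative law in its repeated argument. *)
Lemma nmul_linr k (x a y : nda R k) : (k <= 3)%N ->
  nmul (nmul x a) y + nmul (nmul x y) a = nmul x (nmul a y) + nmul x (nmul y a).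
Proof.
move=> k3; have := nmul_altr (a + y) x k3; rewrite !(nmulDl, nmulDr).
rewrite !(nmul_altr _ _ k3) -!addrA => /addrI; rewrite !addrA => /addIr.
by rewrite addrC => ->; rewrite addrC.
Qed.

Lemma nmul_linl k (x a y : nda R k) : (k <= 3)%N ->
  nmul (nmul x a) y + nmul (nmul a x) y = nmul x (nmul a y) + nmul a (nmul x y).
Proof.
move=> k3; have := nmul_altl (a + x) y k3; rewrite !(nmulDl, nmulDr).
rewrite !(nmul_altl _ _ k3) -!addrA => /addrI; rewrite !addrA => /addIr.
by rewrite addrC => ->; rewrite addrC.
Qed.

Lemma nmul_flex k (x y : nda R k) : (k <= 3)%N ->
  nmul x (nmul y x) = nmul (nmul x y) x.
Proof. by move=> k3; have := nmul_linl x y x k3; rewrite nmul_altr// => /addIr. Qed.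

(** Left Moufang identity, obtained from the linearised alternative laws by letting products such as
    [nmul u x] be their arguments. *)
Lemma nmul_moufang_left k (u x y : nda R k) : (k <= 3)%N ->
  nmul (nmul (nmul u x) u) y = nmul u (nmul x (nmul u y)).
Proof.
move=> k3; have := nmul_linl u (nmul u x) y k3.
have := nmul_linr u x (nmul u y) k3; rewrite !nmul_altl// => e1 e2.
apply: (addrI (nmul (nmul (nmul u u) x) y)); rewrite e2.
apply: (addIr (nmul (nmul (nmul u u) y) x)); rewrite -addrA e1.
rewrite addrCA [X in _ = X + _]addrC -[RHS]addrA; congr (_ + _).
by rewrite -nmulDr nmul_linr// nmulDr !nmul_altl// -nmul_linr.
Qed.

Lemma nmul_moufang_mid k (u x y : nda R k) : (k <= 3)%N ->
  nmul (nmul u x) (nmul y u) = nmul (nmul u (nmul x y)) u.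
Proof.
move=> k3; apply: (addIr (nmul (nmul u (nmul y u)) x)).
rewrite nmul_linr// [in RHS]nmul_flex// nmul_moufang_left// -!nmulDr -nmul_flex//.
rewrite -nmulDr; congr nmul.
apply: (addIr (nmul (nmul y x) u)); rewrite [in RHS]addrAC nmul_linl//.
by rewrite -!addrA; congr (_ + _); rewrite nmul_linr// addrC.
Qed.

(** Makes x x^* a multiple of an idempotent when the entries of x associate. The triple (a b, b, c)
    associates as well, and b satisfies b^2 = 2 Re(b) b - |b|^2; the conjugates are then removed
    with [nconjE]. *)
Lemma nmul_assoc_cancel k (a b c : nda R k) : (k <= 3)%N ->
  nmul a (nmul b c) = nmul (nmul a b) c ->
  nmul (nmul a (nconj b)) (nmul b (nconj c)) = nnormsq b *: nmul a (nconj c).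
Proof.
move=> k3 abc.
have e : nmul (nmul (nmul a b) b) c = nmul (nmul a b) (nmul b c).
  have := nmul_linl b (nmul a b) c k3; rewrite nmul_flex// nmul_moufang_left// abc.
  exact: addrI.
have bb : nmul b b = (2 * nRe b) *: b - nreal k (nnormsq b).
  rewrite -(nnormsqE b).1 nconjE nmulBl nmulZl nmul1l opprB addrC subrK //.
have e2 : nmul (nmul a (nconj b)) (nmul b c) = nnormsq b *: nmul a c.
  rewrite (nconjE b) nmulBr nmulBl nmulZr nmul1r nmulZl -e nmul_altr// bb.
  rewrite nmulBr nmulBl nmulZr nmul_realr !nmulZl abc opprB addrC subrK //.
have e3 : nmul (nmul a (nconj b)) b = nnormsq b *: a.
  by rewrite -{2}(nconjK b) nmulVr// nnormsq_conj.
rewrite (nconjE c) nmulBr nmulBr e2 nmulZr nmul1r nmulZr e3.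
rewrite nmulBr nmulZr nmul1r scalerBr; congr (_ - _).
by rewrite !scalerA mulrC.
Qed.
End nda_theory.

(** * Words of algebra elements: rotation, reversal and averaging *)

Section word.
Variables (R : realType) (k : nat).
Hypothesis k3 : (k <= 3)%N.
Notation F := (nda R k).
Implicit Types (u v : seq F) (x y : F).

Definition lprod u : F := foldr (@nmul R k) (nreal k 1) u.

(** For the word of a cycle of a Hermitian matrix this is the word of the reversed cycle (see
    [word_inv]). *)
Definition crev u : seq F := rev (map (@nconj R k) u).

(* Words of length at most [n] have a product whose real part is independent of
   the bracketing and invariant under rotation and (up to conjugation) reversal. *)
Definition wassoc n := (k <= 2)%N || (n <= 3)%N.

Lemma lprod_cat u v : (k <= 2)%N -> lprod (u ++ v) = nmul (lprod u) (lprod v).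
Proof. by move=> k2; elim: u => [|x u IH] /=; rewrite ?nmul1l// IH nmulA. Qed.

Lemma lprod_crev u : (k <= 2)%N -> lprod (crev u) = nconj (lprod u).
Proof.
move=> k2; elim: u => [|x u IH]; first by rewrite nconj_real.
by rewrite /crev map_cons rev_cons -cats1 lprod_cat// IH /= nmul1r nconjM.
Qed.

Lemma nre_lprod_rcons x u : wassoc (size u).+1 ->
  nRe (lprod (rcons u x)) = nRe (lprod (x :: u)).
Proof.
case/orP => [k2|]; first by rewrite -cats1 lprod_cat// nre_mulC /= nmul1r.
case: u => [//|y [|z [|//]]] _ /=; rewrite !nmul1r; first by rewrite nre_mulC.
by rewrite nre_mulA nre_mulC.
Qed.

Lemma nre_lprod_crev u : wassoc (size u) -> nRe (lprod (crev u)) = nRe (lprod u).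
Proof.
case/orP => [k2|]; first by rewrite lprod_crev// nre_conj.
case: u => [//|x [|y [|z [|//]]]] _; rewrite /crev /rev /= !nmul1r ?nre_conj//.
  by rewrite -nconjM nre_conj.
by rewrite -!nconjM nre_conj nre_mulA.
Qed.

Lemma nre_mul_conj_avg x y :
  nRe (nmul x y) + nRe (nmul (nconj x) y) = 2 * nRe x * nRe y.
Proof. by rewrite -nreD -nmulDl nconjE addrC subrK nmulZl nmul1l nreZ. Qed.

(* [v] is a cycle product and [crev v] that of the reversed cycle, which is its
   conjugate; the two average to the real number [nRe (lprod v)]. *)
Lemma nre_lprod_avg u v :
  (k <= 2)%N || [&& size u + size v <= 3, u != [::] & v != [::]]%N ->
  ((2 < k)%N -> (size v <= 2)%N -> crev v = v) ->
  nRe (lprod (v ++ u)) + nRe (lprod (crev v ++ u)) = 2 * nRe (lprod v) * nRe (lprod u).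
Proof.
have [k2 _ _|k2 /= /and3P[suv u0 v0] /(_ isT)] := leqP k 2.
  by rewrite !lprod_cat// lprod_crev// nre_mul_conj_avg.
case: v suv v0 => [//|x [|y v]] suv _ hv.
  have := hv isT; rewrite /crev /rev /= => -[xx].
  by rewrite !nmul1r xx -(nreal_Re xx) !nmul_reall !nreZ nReK; ring.
case: u suv u0 => [//|z [|z' u]] /= suv _; last by move: suv; rewrite !addSn !addnS.
case: v suv hv => [|//] _ /(_ isT); rewrite /crev /rev /= => -[xy _].
rewrite !nmul1r -xy nconjK xy -xy.
by rewrite nmulV// (nnormsqE y).1 nreZ nReK; ring.
Qed.
End word.

(** * The Moore determinant *)

Section perm_orbits.
Variable p : nat.
Implicit Types (s t : 'S_p) (i j a b : 'I_p).

Lemma porbit_perm s i : porbit s (s i) = porbit s i.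
Proof. by apply/eqP; rewrite eq_porbit_mem; exact: (mem_porbit s 1 i). Qed.

Lemma mem_porbit_perm s i j : (s j \in porbit s i) = (j \in porbit s i).
Proof. by rewrite -!eq_porbit_mem porbit_perm. Qed.

Lemma traject_inv s i n : rev (traject s (s i) n) = traject (s^-1)%g (iter n s i) n.
Proof.
elim: n i => [//|n IH] i; rewrite trajectSr rev_rcons IH -iterSr /=.
by congr (_ :: traject _ _ _); rewrite permK.
Qed.

Lemma porbit_cycle s i (q : seq 'I_p) : fpath s i q -> s (last i q) = i ->
  uniq (i :: q) -> traject s i #|porbit s i| = i :: q.
Proof.
move=> /fpathP[n ->] cl uq.
have it : iter n.+1 s i = i by rewrite iterS -[iter n s i]last_traject.
suff <- : #|traject s i n.+1| = #|porbit s i|.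
  by rewrite trajectS (card_uniqP _) // /= size_traject.
apply: eq_card => j; apply/idP/idP => [/trajectP[m _ ->]|/porbitP[m ->]].
  by rewrite -permX mem_porbit.
rewrite permX; apply/loopingP; rewrite /looping -/(traject s i n.+1) it.
by rewrite /= mem_head.
Qed.

Lemma traject_porbit s i : exists m, #|porbit s i| = m.+1 /\
  traject s i #|porbit s i| = i :: traject s (s i) m /\
  s (last i (traject s (s i) m)) = i.
Proof.
have : (0 < #|porbit s i|)%N by rewrite card_gt0; apply/set0Pn; exists i; rewrite porbit_id.
case E : #|porbit s i| => [//|m] _; exists m; split => //; split => //.
by rewrite last_traject -iterS -E iter_porbit.
Qed.

(** The same condition as in the product of [hdet], so that [hdetE] holds by conversion. *)
Definition porbit_rep s i := [forall j in porbit s i, (i <= j)%N].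

Lemma porbit_rep_pick s a : {m | m \in porbit s a &
  (fun i => porbit_rep s i && (i \in porbit s a)) =1 pred1 m}.
Proof.
have [m ma mmin] := @arg_minnP _ a (fun j => j \in porbit s a) (@nat_of_ord p) (porbit_id s a).
exists m => // i /=; apply/andP/eqP => [[/forall_inP h ia]|->].
  apply/val_inj/eqP; rewrite eqn_leq mmin// andbT; apply: h.
  by move: ia ma; rewrite -!eq_porbit_mem => /eqP -> .
split=> //; apply/forall_inP => j jm; apply: mmin.
by move: jm ma; rewrite -!eq_porbit_mem => /eqP ->.
Qed.

Lemma porbit_agree s t i : {in porbit s i, t =1 s} ->
  porbit t i = porbit s i /\ forall n, traject t i n = traject s i n.
Proof.
move=> st; have it n : iter n t i = iter n s i.
  by elim: n => [//|n IH]; rewrite !iterS IH st// -permX mem_porbit.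
split.
  by apply/setP => j; apply/porbitP/porbitP => -[n ->]; exists n; rewrite !permX it.
by elim=> [//|n IH]; rewrite !trajectSr IH it.
Qed.

Lemma porbit_rep_agree s t i : {in porbit s i, t =1 s} -> porbit_rep t i = porbit_rep s i.
Proof. by move=> /porbit_agree[e _]; rewrite /porbit_rep e. Qed.

Section flip.
Variables (s : 'S_p) (b : 'I_p).

Definition flip_fun i := if i \in porbit s b then (s^-1)%g i else s i.

Lemma flip_inj : injective flip_fun.
Proof.
have mV i : ((s^-1)%g i \in porbit s b) = (i \in porbit s b).
  by rewrite -[LHS]mem_porbit_perm permKV.
move=> i j; rewrite /flip_fun; case: ifP => hi; case: ifP => hj; try exact: perm_inj.
  by move=> e; move: (mV i); rewrite e mem_porbit_perm hi hj.
by move=> e; move: (mV j); rewrite -e mem_porbit_perm hi hj.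
Qed.

Definition flip : 'S_p := perm flip_inj.

Lemma flip_in i : i \in porbit s b -> flip i = (s^-1)%g i.
Proof. by move=> h; rewrite permE /flip_fun h. Qed.

Lemma flip_out i : i \notin porbit s b -> flip i = s i.
Proof. by move=> /negPf h; rewrite permE /flip_fun h. Qed.

Lemma flip_out_agree i : i \notin porbit s b -> {in porbit s i, flip =1 s}.
Proof.
move=> ib j; rewrite -eq_porbit_mem => /eqP ji; apply: flip_out.
by rewrite porbit_sym ji porbit_sym.
Qed.

Lemma flip_in_agree i : i \in porbit s b -> {in porbit (s^-1)%g i, flip =1 (s^-1)%g}.
Proof.
rewrite -eq_porbit_mem => /eqP e j; rewrite porbitV e => jb; exact: flip_in.
Qed.

Lemma porbit_flip i : porbit flip i = porbit s i.
Proof.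
have [ib|ib] := boolP (i \in porbit s b); last exact: (porbit_agree (flip_out_agree ib)).1.
by rewrite (porbit_agree (flip_in_agree ib)).1 porbitV.
Qed.

(** Parity is read off the number of orbits, and the orbits are unchanged. *)
Lemma odd_flip : flip = s :> bool.
Proof.
rewrite /odd_perm; congr (_ (+) odd #|pred_of_set _|).
by apply: eq_imset => i; exact: porbit_flip.
Qed.

Lemma porbit_rep_flip i : porbit_rep flip i = porbit_rep s i.
Proof. by rewrite /porbit_rep porbit_flip. Qed.

End flip.

Lemma flipK b : involutive (flip^~ b).
Proof.
move=> s; apply/permP => i; have [ib|ib] := boolP (i \in porbit s b).
  have fb : i \in porbit (flip s b) b by rewrite porbit_flip.
  rewrite flip_in//; apply: (perm_inj (s:=flip s b)).
  by rewrite permKV flip_in ?mem_porbit_perm// permK.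
by rewrite flip_out ?porbit_flip// flip_out.
Qed.

(** A transposition changes the number of cycles by one, upwards or downwards according to whether
    [a] and [b] share a cycle. Multiplying by it twice returns to [s], so the two changes have
    opposite directions. *)
Lemma mem_porbit_merge s a b : a != b ->
  (b \in porbit (tperm a b * s)%g a) = (b \notin porbit s a).
Proof.
move=> ab; have h1 := porbits_mul_tperm s a b.
have := porbits_mul_tperm (tperm a b * s)%g a b.
rewrite /= mulgA tperm2 mul1g in h1 *; move: h1; rewrite ab !(porbit_sym _ a b).
move: #|porbits s| #|porbits _| => m n.
case: (b \in porbit s a); case: (b \in porbit _ a) => //=; lia.
Qed.

(** The merged cycle leaves [a] along the old cycle of [b] and leaves [b] along the old cycle of
    [a]. When the rows [a] and [b] agree, its word is thus the word of [b] followed by that of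
    [a]. *)
Lemma traject_merge s a b m l : a != b -> b \notin porbit s a ->
  traject s a #|porbit s a| = a :: traject s (s a) m ->
  traject s b #|porbit s b| = b :: traject s (s b) l ->
  traject (tperm a b * s)%g a #|porbit (tperm a b * s)%g a| =
    a :: traject s (s b) l ++ b :: traject s (s a) m /\
  {in traject s (s b) l ++ traject s (s a) m, (tperm a b * s)%g =1 s}.
Proof.
move=> ab bna ea eb; set t := (tperm a b * s)%g.
have anb : a \notin porbit s b by rewrite porbit_sym.
have ta : t a = s b by rewrite permM tpermL.
have tb : t b = s a by rewrite permM tpermR.
have tE i : i != a -> i != b -> t i = s i.
  by move=> ia ib; rewrite permM tpermD // eq_sym.
have ua := uniq_traject_porbit s a; have ub := uniq_traject_porbit s b.
have oa i : (i \in a :: traject s (s a) m) = (i \in porbit s a).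
  by rewrite -ea porbit_traject.
have ob i : (i \in b :: traject s (s b) l) = (i \in porbit s b).
  by rewrite -eb porbit_traject.
rewrite ea in ua; rewrite eb in ub.
have agl i : i \in traject s (s b) l -> t i = s i.
  move=> hi; apply: tE; apply/eqP => e; subst i.
    by move: anb; rewrite -ob inE hi orbT.
  by move: ub; rewrite /= hi.
have agm i : i \in traject s (s a) m -> t i = s i.
  move=> hi; apply: tE; apply/eqP => e; subst i.
    by move: ua; rewrite /= hi.
  by move: bna; rewrite -oa inE hi orbT.
have pt (n : nat) x y : t x = y -> (forall i, i \in traject s y n -> t i = s i) ->
    fpath t x (traject s y n) /\ t (last x (traject s y n)) = iter n s y.
  elim: n x y => [//|n IH] x y xy h; rewrite iterSr /= xy eqxx /=; apply: IH.
    by apply: h; rewrite mem_head.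
  by move=> i hi; apply: h; rewrite inE hi orbT.
have lst x n : traject s x #|porbit s x| = x :: traject s (s x) n -> iter n s (s x) = x.
  move=> e; have := congr1 size e; rewrite /= !size_traject => en.
  by rewrite -iterSr -en iter_porbit.
have [pb lb] := pt l a (s b) ta agl; have [pa la] := pt m b (s a) tb agm.
rewrite (lst _ _ eb) in lb; rewrite (lst _ _ ea) in la.
split; last by move=> i; rewrite mem_cat => /orP[/agl|/agm].
apply: porbit_cycle.
- by rewrite cat_path pb /= lb eqxx.
- by rewrite last_cat.
rewrite -cat_cons uniq_catC cat_cons -cat1s -[a :: _]cat1s catA.
have bm : b \notin a :: traject s (s a) m by rewrite oa.
have al : a \notin b :: traject s (s b) l by rewrite ob.
move: ua ub bm al; rewrite /= !cat_uniq /= !inE mem_cat !inE !negb_or.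
move=> /andP[am um] /andP[bl ul] /andP[ba bm] /andP[_ al].
rewrite bm ba bl um am al ul /= andbT; apply/hasPn => i il; apply/negP => im.
have ia : i \in porbit s a by rewrite -oa inE im orbT.
have ib : i \in porbit s b by rewrite -ob inE il orbT.
by move: bna; rewrite -eq_porbit_mem -(eqP (etrans (eq_porbit_mem _ _ _) ib)) eq_porbit_mem ia.
Qed.

End perm_orbits.

(** * The determinant: linearity in a row, equal rows, transvections *)

Section determinant.
Variables (R : realType) (k p : nat).
Hypothesis k3 : (k <= 3)%N.
Hypothesis kp : wassoc k p.
Notation F := (nda R k).
Notation M := ('M[F]_p).
Implicit Types (A B C : M) (s t : 'S_p) (i j a b : 'I_p).

Definition word A s (r : seq 'I_p) : seq F := [seq A j (s j) | j <- r].

Definition recyc A s i : R := nRe (cycle_prod A s i).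

Lemma cycle_prodE A s i : cycle_prod A s i = lprod (word A s (traject s i #|porbit s i|)).
Proof. by rewrite /cycle_prod /lprod foldrE big_map. Qed.

Lemma card_porbit_le s i : (#|porbit s i| <= p)%N.
Proof. by rewrite -[X in (_ <= X)%N]card_ord max_card. Qed.

Lemma wassoc_le m : (m <= p)%N -> wassoc k m.
Proof.
move=> mp; case/orP : kp => [k2|p3]; rewrite /wassoc ?k2//.
by rewrite (leq_trans mp p3) orbT.
Qed.

(** A later starting point rotates the word, which its real part does not see. Hence any element may
    represent its cycle, and a chosen index can be put at the head of the word. *)
Lemma recyc_perm A s i : recyc A s (s i) = recyc A s i.
Proof.
rewrite /recyc !cycle_prodE porbit_perm; have [m [pm [e _]]] := traject_porbit s i.
rewrite e pm trajectSr -iterSr -pm iter_porbit /word map_rcons nre_lprod_rcons//.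
by rewrite size_map size_traject -pm; apply: wassoc_le; exact: card_porbit_le.
Qed.

Lemma recyc_porbit A s i j : j \in porbit s i -> recyc A s j = recyc A s i.
Proof.
by move=> /porbitP[n ->]; rewrite permX; elim: n => [//|n IH]; rewrite iterS recyc_perm.
Qed.

Lemma recyc_agree A B s t i : {in porbit s i, t =1 s} ->
  {in porbit s i, forall j, B j (s j) = A j (s j)} -> recyc B t i = recyc A s i.
Proof.
move=> st AB; rewrite /recyc !cycle_prodE; have [-> ->] := porbit_agree st.
congr (nRe (lprod _)); apply/eq_in_map => j; rewrite -porbit_traject => ji.
by rewrite st// AB.
Qed.

Definition cyclew A s : R := \prod_(i < p | porbit_rep s i) recyc A s i.

Lemma hdetE A : hdet A = \sum_(s : 'S_p) (-1) ^+ s * cyclew A s.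
Proof. by []. Qed.

Lemma cyclew_split A s a : cyclew A s =
  recyc A s a * \prod_(i < p | porbit_rep s i && (i \notin porbit s a)) recyc A s i.
Proof.
rewrite /cyclew (bigID (mem (porbit s a))) /=; congr (_ * _).
have [m ma h] := porbit_rep_pick s a.
by rewrite (eq_bigl _ _ h) big_pred1_eq (recyc_porbit _ ma).
Qed.

Lemma cyclew_split2 A s a b : b \notin porbit s a -> cyclew A s =
  recyc A s a * recyc A s b *
  \prod_(i < p | [&& porbit_rep s i, i \notin porbit s a & i \notin porbit s b]) recyc A s i.
Proof.
move=> bna; rewrite (cyclew_split A s a) -mulrA; congr (_ * _).
rewrite (bigID (mem (porbit s b))) /=; congr (_ * _); last first.
  by apply: eq_bigl => i; rewrite andbA.
have [m mb h] := porbit_rep_pick s b.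
rewrite (eq_bigl (pred1 m)) ?big_pred1_eq ?(recyc_porbit _ mb)// => i.
rewrite -h andbAC; case: (boolP (_ && (_ \in _))) => //= /andP[_ ib].
move: bna; rewrite -!eq_porbit_mem; move: ib; rewrite -eq_porbit_mem => /eqP ->.
by rewrite eq_sym.
Qed.

(** Each permutation uses row [a] exactly once, as the head of the cycle word started at [a]. *)
Lemma hdet_row_lin A B C a (c : R) :
  (forall i j, i != a -> B i j = A i j) -> (forall i j, i != a -> C i j = A i j) ->
  (forall j, A a j = B a j + c *: C a j) -> hdet A = hdet B + c * hdet C.
Proof.
move=> BA CA ABC; rewrite !hdetE mulr_sumr -big_split /=; apply: eq_bigr => s _.
rewrite !(cyclew_split _ s a).
have rest (D : M) : (forall i j, i != a -> D i j = A i j) ->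
  \prod_(i < p | porbit_rep s i && (i \notin porbit s a)) recyc D s i =
  \prod_(i < p | porbit_rep s i && (i \notin porbit s a)) recyc A s i.
  move=> DA; apply: eq_bigr => i /andP[_ ia]; apply: recyc_agree => // j ji.
  by apply: DA; apply: contraNneq ia => <-; rewrite porbit_sym.
rewrite !rest//; set w := \prod_(_ < _ | _) _.
suff -> : recyc A s a = recyc B s a + c * recyc C s a.
  by move: w (recyc B s a) (recyc C s a) (_ ^+ _) => w x y e; ring.
rewrite /recyc !cycle_prodE; have [m [_ [e _]]] := traject_porbit s a.
have := uniq_traject_porbit s a; rewrite !e /= => /andP[am _].
have wr (D : M) : (forall i j, i != a -> D i j = A i j) ->
    word D s (traject s (s a) m) = word A s (traject s (s a) m).
  move=> DA; apply/eq_in_map => j hj; apply: DA; by apply: contraTneq hj => ->.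
by rewrite !wr// ABC nmulDl nmulZl nreD nreZ.
Qed.

Lemma word_inv A s i : word (nadj A) (s^-1)%g (traject (s^-1)%g i #|porbit s i|) =
  crev (word A s (traject s i #|porbit s i|)).
Proof.
rewrite /crev -{1}(iter_porbit s i) -traject_inv /word -map_comp map_rev; congr rev.
have -> n x : traject s (s x) n = map s (traject s x n).
  by elim: n x => //= n IH x; rewrite IH.
by rewrite -map_comp; apply/eq_map => j /=; rewrite !mxE permK.
Qed.

(** Inverting the permutation reverses each cycle while the adjoint conjugates the entries, so every
    word becomes its [crev]. This turns statements on rows into statements on columns. *)
Lemma hdet_adj A : hdet (nadj A) = hdet A.
Proof.
rewrite !hdetE (reindex_inj invg_inj) /=; apply: eq_bigr => s _.
rewrite odd_permV; congr (_ * _); apply: eq_big => [i|i _].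
  by rewrite /porbit_rep porbitV.
rewrite /recyc !cycle_prodE porbitV word_inv nre_lprod_crev// size_map size_traject.
by apply: wassoc_le; exact: card_porbit_le.
Qed.

Section rowdup.
Variables (A : M) (a b : 'I_p).
Hypotheses (hA : herm A) (ab : a != b).

Definition rowdup : M := \matrix_(i, j) if i == a then A b j else A i j.

(** [rowdup] is in general not Hermitian, but the cycle of [b] avoids row [a] and there its entries
    are those of [A]; reversing that cycle only conjugates its word. *)
Lemma recyc_flip s : b \notin porbit s a ->
  cyclew rowdup (flip s b) = cyclew rowdup s /\
  word rowdup (flip s b) (traject (flip s b) b #|porbit s b|) =
  crev (word rowdup s (traject s b #|porbit s b|)).
Proof.
move=> bna; have anb : a \notin porbit s b by rewrite porbit_sym.
have e : word rowdup (flip s b) (traject (flip s b) b #|porbit s b|) =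
    crev (word rowdup s (traject s b #|porbit s b|)).
  have AE t : {in porbit s b, forall j, rowdup j (t j) = A j (t j)}.
    by move=> j jb; rewrite mxE; case: eqP jb anb => // -> ->.
  have -> : word rowdup s (traject s b #|porbit s b|) =
      word A s (traject s b #|porbit s b|).
    by apply/eq_in_map => j; rewrite -porbit_traject => /AE.
  rewrite -word_inv hA.
  have bb : b \in porbit s b by exact: porbit_id.
  have [_ ->] := porbit_agree (flip_in_agree bb).
  apply/eq_in_map => j; rewrite -[#|_|](congr1 (fun X : {set _} => #|X|) (porbitV s b)).
  rewrite -porbit_traject porbitV => jb; rewrite AE// flip_in//.
split=> //; apply: eq_big => [i|i _]; first exact: porbit_rep_flip.
have [ib|ib] := boolP (i \in porbit s b); last first.
  by apply: recyc_agree => //; exact: flip_out_agree.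
have ib' : i \in porbit (flip s b) b by rewrite porbit_flip.
rewrite (recyc_porbit _ ib) (recyc_porbit _ ib') /recyc !cycle_prodE porbit_flip e.
rewrite nre_lprod_crev// size_map size_traject.
by apply: wassoc_le; exact: card_porbit_le.
Qed.

(* When the rows [a] and [b] coincide, left multiplication by [tperm a b] merges the
   cycles of [a] and [b] without changing the word.  The merged word is not the
   product of the real parts of the two cycles, but becomes so after averaging
   over the two orientations of the cycle of [b]. *)
Lemma hdet_rowdup_pair s : b \notin porbit s a ->
  cyclew rowdup s - cyclew rowdup (tperm a b * s)%g +
  (cyclew rowdup (flip s b) - cyclew rowdup (tperm a b * flip s b)%g) = 0.
Proof.
move=> bna.
pose P (s : 'S_p) :=
  \prod_(i < p | [&& porbit_rep s i, i \notin porbit s a & i \notin porbit s b])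
    recyc rowdup s i.
have key (s' : 'S_p) : b \notin porbit s' a ->
   cyclew rowdup (tperm a b * s')%g =
   nRe (lprod (word rowdup s' (traject s' b #|porbit s' b|)
     ++ word rowdup s' (traject s' a #|porbit s' a|))) * P s'.
  move=> bna'; set t := (tperm a b * s')%g.
  have [m [pm [em _]]] := traject_porbit s' a.
  have [l [pl [el _]]] := traject_porbit s' b.
  have [tr ts] := traject_merge ab bna' em el.
  rewrite (cyclew_split _ t a); congr (_ * _).
    rewrite /recyc cycle_prodE tr em el /= /word map_cat /= !mxE eqxx.
    rewrite !permM tpermL tpermR eq_sym (negPf ab).
    congr (nRe (nmul _ (lprod (_ ++ _ :: _)))); apply/eq_in_map => j hj.
      by rewrite /t ts // mem_cat hj.
    by rewrite /t ts // mem_cat hj orbT.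
  have ta i : (i \in porbit t a) = (i \in porbit s' a) || (i \in porbit s' b).
    rewrite /t !porbit_traject tr em el !inE mem_cat inE.
    by case: (i == a); case: (i == b); rewrite ?orbT//= orbC.
  apply: eq_big => [i|i]; rewrite ta negb_or.
    apply: andb_id2r => /andP[ia ib]; apply: porbit_rep_agree => j.
    rewrite -eq_porbit_mem => /eqP ji; rewrite permM tpermD//.
      by apply: contraNneq ia => ->; rewrite porbit_sym -ji porbit_id.
    by apply: contraNneq ib => ->; rewrite porbit_sym -ji porbit_id.
  move=> /and3P[_ ia ib]; apply: recyc_agree => // j.
  rewrite -eq_porbit_mem => /eqP ji; rewrite permM tpermD//.
    by apply: contraNneq ia => ->; rewrite porbit_sym -ji porbit_id.
  by apply: contraNneq ib => ->; rewrite porbit_sym -ji porbit_id.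
have bna' : b \notin porbit (flip s b) a by rewrite porbit_flip.
have anb : a \notin porbit s b by rewrite porbit_sym.
have [-> wf] := recyc_flip bna.
rewrite !key// porbit_flip wf porbit_flip.
have -> : word rowdup (flip s b) (traject (flip s b) a #|porbit s a|) =
    word rowdup s (traject s a #|porbit s a|).
  have [_ ->] := porbit_agree (flip_out_agree anb).
  apply/eq_in_map => j; rewrite -porbit_traject => ja.
  by rewrite (flip_out_agree anb).
have -> : P (flip s b) = P s.
  apply: eq_big => [i|i /and3P[_ _ ib]]; first by rewrite porbit_rep_flip !porbit_flip.
  by apply: recyc_agree => //; apply: flip_out_agree; move: ib; rewrite porbit_flip.
rewrite (cyclew_split2 _ bna) /recyc !cycle_prodE -/(P s).
set u := word _ _ (traject _ a _); set v := word _ _ (traject _ b _).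
have := @nre_lprod_avg R k k3 u v; rewrite !size_map !size_traject.
have [m [pm [em _]]] := traject_porbit s a.
have [l [pl [el lst]]] := traject_porbit s b.
move=> /(_ _ _)/wrap[].
- case/orP: kp => [->//|p3]; apply/orP; right; apply/and3P; split.
  + apply: leq_trans p3; rewrite -[X in (_ <= X)%N](card_ord p).
    have dis : porbit s a :&: porbit s b = finset.set0.
      apply/setP => i; rewrite !inE; apply/andP => -[].
      by rewrite -!eq_porbit_mem => /eqP ->; rewrite eq_porbit_mem (negPf anb).
    by rewrite -(cardsUI (porbit s a)) dis cards0 addn0 max_card.
  + by rewrite /u em.
  + by rewrite /v el.
(* Short words of the cycle of [b] are their own [crev]: a fixed point gives a real diagonal entry,
   a 2-cycle an entry followed by its conjugate. *)
- move=> _; rewrite /v el pl; case: l pl el lst => [|[|//]] pl el /= lst _.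
    rewrite /crev /rev /= mxE eq_sym (negPf ab) lst.
    by have /matrixP/(_ b b) := hA; rewrite !mxE => ->.
  have sba : s b != a by apply: contraNneq anb => <-; rewrite mem_porbit_perm porbit_id.
  have hC i j : nconj (A j i) = A i j by have /matrixP/(_ i j) := hA; rewrite !mxE.
  by rewrite lst /crev /rev /= !mxE (eq_sym b a) (negPf ab) (negPf sba) !hC.
move: (nRe (lprod u)) (nRe (lprod v)) (nRe _) (nRe _) (P s) => x y e1 e2 w h.
by have -> : e1 = 2 * y * x - e2; [rewrite -h|]; ring.
Qed.

(** Left multiplication by [tperm a b] is a sign-reversing bijection between the permutations that
    separate [a] from [b] and those that join them, which makes the determinant a sum of
    differences. Adding this sum to its reindexing by [flip] gives twice the determinant, term by
    term zero. *)
Lemma hdet_rowdup : hdet rowdup = 0.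
Proof.
pose f (s : 'S_p) := (-1) ^+ s * (cyclew rowdup s - cyclew rowdup (tperm a b * s)%g).
have e : hdet rowdup = \sum_(s : 'S_p | b \notin porbit s a) f s.
  rewrite hdetE (bigID (fun s : 'S_p => b \notin porbit s a)) /=.
  rewrite addrC (reindex_inj (mulgI (tperm a b))) /=.
  rewrite [X in X + _](eq_bigl (fun s : 'S_p => b \notin porbit s a)); last first.
    by move=> s; rewrite negbK mem_porbit_merge.
  rewrite addrC -big_split /=; apply: eq_bigr => s _; rewrite /f odd_permM odd_tperm ab.
  by rewrite signr_addb mulrBr mulN1r mulNr addrC.
suff : hdet rowdup + hdet rowdup = 0.
  by move=> /eqP; rewrite -mulr2n mulrn_eq0 => /eqP.
rewrite {1}e e [X in X + _](reindex_inj (inv_inj (flipK b))) /=.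
rewrite [X in X + _](eq_bigl (fun s : 'S_p => b \notin porbit s a)); last first.
  by move=> s; rewrite porbit_flip.
rewrite -big_split /= big1// => s sab; rewrite /f odd_flip -mulrDr addrC.
by rewrite hdet_rowdup_pair// mulr0.
Qed.

End rowdup.

Lemma hdet_transvection A a b (c : R) : herm A -> a != b ->
  let B := \matrix_(i, j) (if i == a then A a j + c *: A b j else A i j) in
  hdet (\matrix_(i, j) (if j == a then B i a + c *: B i b else B i j)) = hdet A.
Proof.
move=> hA ab B; have ba : b == a = false by rewrite eq_sym (negPf ab).
have hC i j : nconj (A j i) = A i j by have /matrixP/(_ i j) := hA; rewrite !mxE.
have hB : hdet B = hdet A.
  rewrite (@hdet_row_lin B A (rowdup A a b) a c) ?hdet_rowdup ?mulr0 ?addr0//.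
  - by move=> i j /negPf ia; rewrite mxE ia.
  - by move=> i j /negPf ia; rewrite !mxE ia.
  - by move=> j; rewrite !mxE eqxx.
set D := \matrix_(i, j) _; rewrite -(hdet_adj D).
rewrite (@hdet_row_lin (nadj D) (nadj B) (rowdup (nadj B) a b) a c); first last.
- by move=> j; rewrite !mxE eqxx nconjD nconjZ.
- by move=> i j /negPf ia; rewrite !mxE ia.
- by move=> i j /negPf ia; rewrite !mxE ia.
rewrite hdet_adj hB -[hdet (rowdup _ _ _)]hdet_adj.
(* [hdet_rowdup] asks for a Hermitian matrix, and [nadj B] need not be one. A second expansion in
   [c] splits the error term into the row duplication of [A] and [C2], which is Hermitian with equal
   rows [a] and [b]. *)
pose C2 := \matrix_(i, j) (A (if i == a then b else i) (if j == a then b else j)) : M.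
rewrite (@hdet_row_lin (nadj (rowdup (nadj B) a b)) (nadj (rowdup A a b)) C2 a c); first last.
- by move=> j; rewrite !mxE eqxx; case: (j == a); rewrite ?nconjK ?nconjD ?nconjZ ?hC.
- by move=> i j /negPf ia; rewrite !mxE ia; case: (j == a); rewrite ?nconjK ?hC.
- by move=> i j /negPf ia; rewrite !mxE ia; case: (j == a); rewrite ?nconjK ?hC.
have hC2 : herm C2 by apply/matrixP => i j; rewrite !mxE -hC nconjK.
have -> : C2 = rowdup C2 a b.
  by apply/matrixP => i j; rewrite !mxE; case: (i == a) => //; rewrite ba.
by rewrite hdet_adj !hdet_rowdup// mulr0 !addr0 mulr0 addr0.
Qed.
End determinant.

(** * Automorphisms of the Jordan algebra of Hermitian matrices *)

Section hermitian_space.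
Variables (R : realType) (k p : nat).
Notation F := (nda R k).
Notation M := ('M[F]_p).
Implicit Types (X Y Z A B : M).

Lemma nnormsq_ge0 (x : F) : 0 <= nnormsq x.
Proof. by apply: sumr_ge0 => i _; exact: sqr_ge0. Qed.

Lemma nnormsq_eq0 (x : F) : (nnormsq x == 0) = (x == 0).
Proof.
apply/idP/eqP => [|->].
  rewrite psumr_eq0; last by move=> i _; exact: sqr_ge0.
  move=> /allP h; rewrite -(ncompK x) -(ncompK 0); congr nofcomp; apply/funext => i.
  have := h i (mem_index_enum _); rewrite sqrf_eq0 => /eqP ->.
  by elim: (k) i {x h} => [//|k' IH] [] i /=.
have := (nnormsqE (0 : F)).1; rewrite nmul0r => /(congr1 (@nRe R k)).
by rewrite nReK nre0 => <-.
Qed.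

Definition hscale (a : R) A : M := map_mx ( *:%R a) A.

Lemma nmulmxZl a A B : nmulmx (hscale a A) B = hscale a (nmulmx A B).
Proof.
apply/matrixP => i j; rewrite !mxE scaler_sumr; apply: eq_bigr => l _.
by rewrite mxE nmulZl.
Qed.

Lemma nmulmxZr a A B : nmulmx A (hscale a B) = hscale a (nmulmx A B).
Proof.
apply/matrixP => i j; rewrite !mxE scaler_sumr; apply: eq_bigr => l _.
by rewrite mxE nmulZr.
Qed.

Lemma hscaleN1 A : hscale (-1) A = - A.
Proof. by apply/matrixP => i j; rewrite !mxE scaleN1r. Qed.

Lemma hscaleA a b A : hscale a (hscale b A) = hscale (a * b) A.
Proof. by apply/matrixP => i j; rewrite !mxE scalerA. Qed.

Lemma hscaleDr a A B : hscale a (A + B) = hscale a A + hscale a B.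
Proof. by apply/matrixP => i j; rewrite !mxE scalerDr. Qed.

Lemma hermE A : herm A <-> forall i j, nconj (A j i) = A i j.
Proof.
split => [/matrixP h i j|h]; first by have := h i j; rewrite !mxE.
by apply/matrixP => i j; rewrite !mxE.
Qed.

Lemma hermD A B : herm A -> herm B -> herm (A + B).
Proof. by move=> /hermE hA /hermE hB; apply/hermE => i j; rewrite !mxE nconjD hA hB. Qed.

Lemma hermZ a A : herm A -> herm (hscale a A).
Proof. by move=> /hermE hA; apply/hermE => i j; rewrite !mxE nconjZ hA. Qed.

Lemma hermN A : herm A -> herm (- A).
Proof. by rewrite -hscaleN1; exact: hermZ. Qed.

Lemma hermB A B : herm A -> herm B -> herm (A - B).
Proof. by move=> hA hB; apply: hermD => //; exact: hermN. Qed.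

Lemma herm_nid : herm (nid R k p).
Proof. by apply/hermE => i j; rewrite !mxE nconj_real eq_sym. Qed.

Lemma nadjD A B : nadj (A + B) = nadj A + nadj B.
Proof. by apply/matrixP => i j; rewrite !mxE nconjD. Qed.

Lemma herm_mulC A B : herm A -> herm B -> herm (nmulmx A B + nmulmx B A).
Proof. by move=> hA hB; rewrite /herm nadjD !nadjM hA hB addrC. Qed.

Lemma herm_sq A : herm A -> herm (nmulmx A A).
Proof. by move=> hA; rewrite /herm nadjM hA. Qed.

Lemma herm_jordan A B : herm A -> herm B -> herm (jordan A B).
Proof. by move=> hA hB; apply: hermZ; exact: herm_mulC. Qed.

Lemma herm_sandwich A B : herm A -> herm B -> herm (sandwich A B).
Proof.
move=> hA hB; rewrite /sandwich mulr2n.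
by apply: hermB; [apply: hermD|]; do ?apply: herm_jordan.
Qed.

Lemma jordanC A B : jordan A B = jordan B A.
Proof. by rewrite /jordan addrC. Qed.

Lemma jordan_sq A : jordan A A = nmulmx A A.
Proof. by rewrite /jordan Defs.halfD Defs.halfK. Qed.

Lemma jordanDr A B C : jordan A (B + C) = jordan A B + jordan A C.
Proof. by rewrite /jordan -Defs.halfD nmulmxDr nmulmxDl addrACA. Qed.

Lemma jordanZr a A B : jordan A (hscale a B) = hscale a (jordan A B).
Proof.
rewrite /jordan nmulmxZl nmulmxZr -hscaleDr -/(hscale 2^-1 _) -/(hscale 2^-1 _).
by rewrite !hscaleA mulrC.
Qed.

Lemma jordan1 A : jordan (nid R k p) A = A.
Proof. by rewrite /jordan nmulmx1 nmul1mx Defs.halfD Defs.halfK. Qed.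

Lemma sandwichDr A B C : sandwich A (B + C) = sandwich A B + sandwich A C.
Proof.
rewrite /sandwich !jordanDr mulrnDl opprD addrACA //.
Qed.

Lemma sandwichZr a A B : sandwich A (hscale a B) = hscale a (sandwich A B).
Proof.
rewrite /sandwich !jordanZr; apply/matrixP => i j.
by rewrite !mulr2n !mxE -!scalerDr -scalerBr.
Qed.

Lemma sandwichNr A B : sandwich A (- B) = - sandwich A B.
Proof. by rewrite -!hscaleN1 sandwichZr. Qed.

Lemma sandwichBr A B C : sandwich A (B - C) = sandwich A B - sandwich A C.
Proof. by rewrite sandwichDr sandwichNr. Qed.

Lemma sandwich1 A : sandwich A (nid R k p) = nmulmx A A.
Proof.
rewrite /sandwich [jordan A (nid _ _ _)]jordanC jordan1 [jordan _ (nid _ _ _)]jordanC.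
by rewrite jordan1 !jordan_sq mulr2n addrK.
Qed.

Definition tform A B : R := nRe (\tr (nmulmx A B)).

Lemma tformE A B : tform A B = \sum_i \sum_j nRe (nmul (A i j) (B j i)).
Proof. by rewrite /tform nre_sum; apply: eq_bigr => i _; rewrite mxE nre_sum. Qed.

Lemma tformC A B : tform A B = tform B A.
Proof.
rewrite !tformE exchange_big; apply: eq_bigr => i _; apply: eq_bigr => j _.
by rewrite nre_mulC.
Qed.

Lemma nretrD A B : nRe (\tr (A + B)) = nRe (\tr A) + nRe (\tr B).
Proof. by rewrite !nre_sum -big_split; apply: eq_bigr => i _; rewrite mxE nreD. Qed.

Lemma nretrZ a A : nRe (\tr (hscale a A)) = a * nRe (\tr A).
Proof. by rewrite !nre_sum mulr_sumr; apply: eq_bigr => i _; rewrite mxE nreZ. Qed.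

Lemma tformDl A B C : tform (A + B) C = tform A C + tform B C.
Proof. by rewrite /tform nmulmxDl nretrD. Qed.

Lemma tformDr A B C : tform C (A + B) = tform C A + tform C B.
Proof. by rewrite tformC tformDl !(tformC C). Qed.

Lemma tformZl a A B : tform (hscale a A) B = a * tform A B.
Proof. by rewrite /tform nmulmxZl nretrZ. Qed.

Lemma tformZr a A B : tform B (hscale a A) = a * tform B A.
Proof. by rewrite tformC tformZl tformC. Qed.

Lemma tformBl A B C : tform (A - B) C = tform A C - tform B C.
Proof. by rewrite -hscaleN1 tformDl tformZl mulN1r. Qed.

Lemma tform_sq A : herm A -> tform A A = \sum_i \sum_j nnormsq (A i j).
Proof.
move=> /hermE hA; rewrite tformE; apply: eq_bigr => i _; apply: eq_bigr => j _.
by rewrite -(hA j i) (nnormsqE _).2 nReK.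
Qed.

Lemma tform_eq0 A : herm A -> tform A A = 0 -> A = 0.
Proof.
move=> hA /eqP; rewrite tform_sq// psumr_eq0; last first.
  by move=> i _; apply: sumr_ge0 => j _; exact: nnormsq_ge0.
move=> /allP h; apply/matrixP => i j; rewrite mxE; apply/eqP; rewrite -nnormsq_eq0.
have := h i (mem_index_enum _); rewrite /= psumr_eq0; last by move=> l _; exact: nnormsq_ge0.
by move=> /allP/(_ j (mem_index_enum _)).
Qed.

Lemma nnormsq_le_tform A i j : herm A -> nnormsq (A i j) <= tform A A.
Proof.
move=> hA; rewrite tform_sq// (bigD1 i)//= (bigD1 j)//= -addrA lerDl.
apply: addr_ge0; first by apply: sumr_ge0 => l _; exact: nnormsq_ge0.
by apply: sumr_ge0 => l _; apply: sumr_ge0 => m _; exact: nnormsq_ge0.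
Qed.

(** Squares determine the Jordan product by polarisation ([haut_mulC]). For fixed arguments every
    condition other than [hhom_herm] is a polynomial equation in values of [f], hence closed under
    pointwise limits. *)
Record hhom (f : M -> M) : Prop := HHom {
  hhom_herm : forall X, herm X -> herm (f X);
  hhomD : forall X Y, herm X -> herm Y -> f (X + Y) = f X + f Y;
  hhomZ : forall a X, herm X -> f (hscale a X) = hscale a (f X);
  hhom_sq : forall X, herm X -> nmulmx (f X) (f X) = f (nmulmx X X);
  hhom_tr : forall X, herm X -> nRe (\tr (f X)) = nRe (\tr X);
  hhom_det : forall X, herm X -> hdet (f X) = hdet X
}.

(* Carrying the adjoint along makes invertibility a closed condition, as needed for
   the compactness of the set of automorphisms. *)
Record haut (f g : M -> M) : Prop := HAut {
  haut_l : hhom f;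
  haut_r : hhom g;
  haut_adj : forall X Y, herm X -> herm Y -> tform (f X) Y = tform X (g Y)
}.

Lemma haut_sym f g : haut f g -> haut g f.
Proof. by case=> hf hg a; split=> // X Y hX hY; rewrite tformC -a// tformC. Qed.

Lemma hhom_id : hhom id. Proof. by split. Qed.

Lemma haut_id : haut id id. Proof. by split => //; exact: hhom_id. Qed.

Lemma hhom_comp f g : hhom f -> hhom g -> hhom (f \o g).
Proof.
move=> hf hg; split => [X hX|X Y hX hY|a X hX|X hX|X hX|X hX] /=.
- by apply: (hhom_herm hf); exact: (hhom_herm hg).
- by rewrite (hhomD hg)// (hhomD hf)//; exact: (hhom_herm hg).
- by rewrite (hhomZ hg)// (hhomZ hf)//; exact: (hhom_herm hg).
- by rewrite (hhom_sq hf) ?(hhom_sq hg)//; exact: (hhom_herm hg).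
- by rewrite (hhom_tr hf) ?(hhom_tr hg)//; exact: (hhom_herm hg).
- by rewrite (hhom_det hf) ?(hhom_det hg)//; exact: (hhom_herm hg).
Qed.

Lemma haut_comp f g f' g' : haut f g -> haut f' g' -> haut (f \o f') (g' \o g).
Proof.
case=> hf hg a [hf' hg' a']; split; [exact: hhom_comp|exact: hhom_comp|].
move=> X Y hX hY /=; rewrite a ?a'//; [exact: (hhom_herm hg)|exact: (hhom_herm hf')].
Qed.

Section haut_theory.
Variables (f g : M -> M).
Hypothesis fg : haut f g.
Let hf := haut_l fg.
Let hg := haut_r fg.

Lemma hautB X Y : herm X -> herm Y -> f (X - Y) = f X - f Y.
Proof.
by move=> hX hY; rewrite -!hscaleN1 (hhomD hf)// ?(hhomZ hf)//; exact: hermZ.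
Qed.

Lemma haut_mulC X Y : herm X -> herm Y ->
  nmulmx (f X) (f Y) + nmulmx (f Y) (f X) = f (nmulmx X Y + nmulmx Y X).
Proof.
move=> hX hY; have := hhom_sq hf (hermD hX hY).
rewrite (hhomD hf)// !(nmulmxDl, nmulmxDr) (hhom_sq hf hX) (hhom_sq hf hY).
rewrite -(addrA (nmulmx X X)) (addrA (nmulmx X Y)).
rewrite (hhomD hf (herm_sq hX) (hermD (herm_mulC hX hY) (herm_sq hY))).
rewrite (hhomD hf (herm_mulC hX hY) (herm_sq hY)).
by rewrite -addrA => /addrI; rewrite addrA => /addIr.
Qed.

Lemma haut_jordan X Y : herm X -> herm Y -> jordan (f X) (f Y) = f (jordan X Y).
Proof.
move=> hX hY; rewrite /jordan haut_mulC// -[LHS]/(hscale _ _) -(hhomZ hf)//.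
exact: herm_mulC.
Qed.

Lemma haut_sandwich X Y : herm X -> herm Y -> sandwich (f X) (f Y) = f (sandwich X Y).
Proof.
move=> hX hY; rewrite /sandwich !haut_jordan ?mulr2n; try by do ?apply: herm_jordan.
rewrite -(hhomD hf) -?hautB//; do ?[apply: hermD]; do ?apply: herm_jordan; done.
Qed.

Lemma haut_tform X Y : herm X -> herm Y -> tform (f X) (f Y) = tform X Y.
Proof.
move=> hX hY; have hfX := hhom_herm hf hX; have hfY := hhom_herm hf hY.
have := congr1 (fun A => nRe (\tr A)) (haut_mulC hX hY).
rewrite (hhom_tr hf); last exact: herm_mulC.
rewrite !nretrD -!/(tform _ _) (tformC (f Y)) (tformC Y) -!mulr2n.
by move=> /eqP; rewrite eqrMn2r//= => /eqP.
Qed.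

(** [f] is an isometry of the positive definite form [tform], so its adjoint is a left inverse. *)
Lemma hautK X : herm X -> g (f X) = X.
Proof.
move=> hX; have hgf : herm (g (f X)) by apply: (hhom_herm hg); exact: (hhom_herm hf).
set Z := g (f X) - X; have hZ : herm Z by exact: hermB.
suff : Z = 0 by move/eqP; rewrite subr_eq0 => /eqP.
apply: tform_eq0 => //; rewrite {1}/Z tformBl tformC -(haut_adj fg)//.
  by rewrite haut_tform// tformC subrr.
exact: (hhom_herm hf).
Qed.
End haut_theory.

Lemma haut_nid f g : haut f g -> f (nid R k p) = nid R k p.
Proof.
move=> fg; have gf := haut_sym fg; have h1 := herm_nid.
have hg1 : herm (g (nid R k p)) by apply: (hhom_herm (haut_r fg)).
have := haut_jordan fg hg1 h1; rewrite jordanC; rewrite [jordan (g _) _]jordanC.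
by rewrite !jordan1 (hautK gf)// jordanC jordan1.
Qed.
End hermitian_space.

(** * Conjugation by real matrices and plane rotations *)

Section real_conjugation.
Variables (R : realType) (k p : nat).
Hypothesis k3 : (k <= 3)%N.
Hypothesis kp : wassoc k p.
Notation F := (nda R k).
Notation M := ('M[F]_p).
Notation G := ('M[R]_p).
Implicit Types (X Y A B : M) (g h : G).

(** Real scalars commute and associate with everything, so actions of real matrices obey the usual
    matrix rules even over the octonions. *)
Definition lact g A : M := \matrix_(i, j) \sum_l g i l *: A l j.
Definition ract A g : M := \matrix_(i, j) \sum_l g l j *: A i l.
Definition rconj g A : M := ract (lact g A) g^T.

Lemma lact_nmulmx g A B : nmulmx (lact g A) B = lact g (nmulmx A B).
Proof.
apply/matrixP => i j; rewrite !mxE.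
under eq_bigr do rewrite mxE nmul_suml.
rewrite exchange_big; apply: eq_bigr => l _; rewrite mxE scaler_sumr.
by apply: eq_bigr => m _; rewrite nmulZl.
Qed.

Lemma ract_nmulmx g A B : nmulmx A (ract B g) = ract (nmulmx A B) g.
Proof.
apply/matrixP => i j; rewrite !mxE.
under eq_bigr do rewrite mxE nmul_sumr.
rewrite exchange_big; apply: eq_bigr => l _; rewrite mxE scaler_sumr.
by apply: eq_bigr => m _; rewrite nmulZr.
Qed.

Lemma ract_lact_nmulmx g A B : nmulmx (ract A g) B = nmulmx A (lact g B).
Proof.
apply/matrixP => i j; rewrite !mxE.
under eq_bigr do rewrite mxE nmul_suml.
rewrite exchange_big; apply: eq_bigr => l _; rewrite mxE nmul_sumr.
by apply: eq_bigr => m _; rewrite nmulZl nmulZr.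
Qed.

Lemma lactM g h A : lact (g *m h) A = lact g (lact h A).
Proof.
apply/matrixP => i j; rewrite !mxE.
under eq_bigr do rewrite mxE scaler_suml.
rewrite exchange_big; apply: eq_bigr => l _; rewrite mxE scaler_sumr.
by apply: eq_bigr => m _; rewrite scalerA.
Qed.

Lemma ractM g h A : ract A (g *m h) = ract (ract A g) h.
Proof.
apply/matrixP => i j; rewrite !mxE.
under eq_bigr do rewrite mxE scaler_suml.
rewrite exchange_big; apply: eq_bigr => l _; rewrite mxE scaler_sumr.
by apply: eq_bigr => m _; rewrite scalerA mulrC.
Qed.

Lemma lact1 A : lact 1%:M A = A.
Proof.
apply/matrixP => i j; rewrite mxE (bigD1 i)//= mxE eqxx scale1r big1 ?addr0// => l.
by rewrite mxE eq_sym => /negPf ->; rewrite scale0r.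
Qed.

Lemma lact_ract g h A : lact g (ract A h) = ract (lact g A) h.
Proof.
apply/matrixP => i j; rewrite !mxE.
under eq_bigr do rewrite mxE scaler_sumr.
rewrite exchange_big; apply: eq_bigr => l _; rewrite mxE scaler_sumr.
by apply: eq_bigr => m _; rewrite !scalerA mulrC.
Qed.

Lemma nadj_lact g A : nadj (lact g A) = ract (nadj A) g^T.
Proof.
apply/matrixP => i j; rewrite !mxE.
rewrite (big_morph (@nconj R k) (@nconjD R k) (@nconj0 R k)).
by apply: eq_bigr => l _; rewrite !mxE nconjZ.
Qed.

Lemma nadj_ract g A : nadj (ract A g) = lact g^T (nadj A).
Proof.
apply/matrixP => i j; rewrite !mxE.
rewrite (big_morph (@nconj R k) (@nconjD R k) (@nconj0 R k)).
by apply: eq_bigr => l _; rewrite !mxE nconjZ.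
Qed.

Lemma lactD g A B : lact g (A + B) = lact g A + lact g B.
Proof.
apply/matrixP => i j; rewrite !mxE -big_split; apply: eq_bigr => l _.
by rewrite mxE scalerDr.
Qed.

Lemma ractD g A B : ract (A + B) g = ract A g + ract B g.
Proof.
apply/matrixP => i j; rewrite !mxE -big_split; apply: eq_bigr => l _.
by rewrite mxE scalerDr.
Qed.

Lemma lactZ g a A : lact g (hscale a A) = hscale a (lact g A).
Proof.
apply/matrixP => i j; rewrite !mxE scaler_sumr; apply: eq_bigr => l _.
by rewrite mxE !scalerA mulrC.
Qed.

Lemma ractZ g a A : ract (hscale a A) g = hscale a (ract A g).
Proof.
apply/matrixP => i j; rewrite !mxE scaler_sumr; apply: eq_bigr => l _.
by rewrite mxE !scalerA mulrC.
Qed.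

Lemma nretr_ract g A : nRe (\tr (ract A g)) = nRe (\tr (lact g A)).
Proof.
rewrite !nre_sum; under eq_bigr do rewrite mxE nre_sum.
under [RHS]eq_bigr do rewrite mxE nre_sum.
by rewrite exchange_big.
Qed.

Lemma rconjM g h A : rconj (g *m h) A = rconj g (rconj h A).
Proof. by rewrite /rconj trmx_mul ractM lactM !lact_ract. Qed.

Lemma herm_rconj g A : herm A -> herm (rconj g A).
Proof. by move=> hA; rewrite /herm /rconj nadj_ract trmxK nadj_lact hA lact_ract. Qed.

Lemma tform_rconj g A B : tform (rconj g A) B = tform A (rconj g^T B).
Proof.
rewrite /tform /rconj ract_lact_nmulmx lact_nmulmx -nretr_ract -ract_nmulmx.
by rewrite trmxK.
Qed.

Definition rtransv (a b : 'I_p) (c : R) : G := 1%:M + c *: delta_mx a b.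

Lemma hdet_rtransv a b c A : herm A -> a != b -> hdet (rconj (rtransv a b c) A) = hdet A.
Proof.
move=> hA ab; rewrite -(hdet_transvection k3 kp c hA ab); congr hdet.
have sumE (v : 'I_p -> F) i : \sum_l rtransv a b c i l *: v l =
    if i == a then v a + c *: v b else v i.
  rewrite (eq_bigr (fun l => (i == l)%:R *: v l + (c * ((i == a) && (l == b))%:R) *: v l)).
    rewrite big_split /= (bigD1 i)//= eqxx scale1r big1 ?addr0 => [|l]; last first.
      by rewrite eq_sym => /negPf ->; rewrite scale0r.
    rewrite (bigD1 b)//= eqxx andbT big1 => [|l /negPf ->]; last first.
      by rewrite andbF mulr0 scale0r.
    by rewrite addr0; case: eqP => [->|_]; rewrite ?mulr1// mulr0 scale0r addr0.
  by move=> l _; rewrite !mxE scalerDl.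
apply/matrixP => i j; rewrite !mxE.
under eq_bigr do rewrite mxE [X in _ *: X]mxE.
rewrite sumE.
rewrite (sumE (fun l => A l a)) (sumE (fun l => A l b)) (sumE (fun l => A l j)).
by case: (j == a); case: (i == a).
Qed.

Lemma haut_rconj g : g *m g^T = 1%:M -> (forall A, herm A -> hdet (rconj g A) = hdet A) ->
  (forall A, herm A -> hdet (rconj g^T A) = hdet A) -> haut (rconj g) (rconj g^T).
Proof.
move=> gg dg dg'; have gg' : g^T *m g = 1%:M by exact: mulmx1C.
have hh h : h *m h^T = 1%:M -> (forall A, herm A -> hdet (rconj h A) = hdet A) ->
    hhom (rconj h).
  move=> hh dh; have hh' := mulmx1C hh; split => // [X|X Y|a X|X|X] *.
  - exact: herm_rconj.
  - by rewrite /rconj lactD ractD.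
  - by rewrite /rconj lactZ ractZ.
  - rewrite {1}/rconj ract_lact_nmulmx {1}/rconj lact_ract -lactM hh' lact1.
    by rewrite ract_nmulmx lact_nmulmx.
  - by rewrite /rconj nretr_ract -lactM hh' lact1.
split; [exact: hh|by apply: hh; rewrite ?trmxK|].
by move=> X Y _ _; exact: tform_rconj.
Qed.

Definition rgivens (a b : 'I_p) (c s : R) : G := \matrix_(i, j)
  if i == a then c * (j == a)%:R + s * (j == b)%:R
  else if i == b then c * (j == b)%:R - s * (j == a)%:R else (i == j)%:R.

Lemma rtransv_mulmx a b c g i j :
  (rtransv a b c *m g) i j = if i == a then g a j + c * g b j else g i j.
Proof.
rewrite /rtransv mulmxDl mul1mx -scalemxAl mxE [X in _ + X]mxE mxE.
rewrite (bigD1 b)//= mxE eqxx andbT big1 => [|l /negPf lb]; last first.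
  by rewrite mxE lb andbF mul0r.
by rewrite addr0; case: eqP => [->|_]; rewrite ?mul1r// mul0r mulr0 addr0.
Qed.

(** A rotation is a product of three shears; (1 - c) / s is the tangent of half the angle. *)
Lemma rgivensE a b c s : a != b -> s != 0 -> c ^+ 2 + s ^+ 2 = 1 ->
  rgivens a b c s =
  rtransv a b ((1 - c) / s) *m (rtransv b a (- s) *m rtransv a b ((1 - c) / s)).
Proof.
move=> ab s0 cs; have ba : b == a = false by rewrite eq_sym (negPf ab).
apply/matrixP => i j; rewrite !rtransv_mulmx /rtransv !mxE eqxx ba (negPf ab) eqxx /=.
set x := (1 - c) / s; have xs : x * s = 1 - c by rewrite divfK.
have xc : x * (1 + c) = s.
  rewrite mulrAC (_ : (1 - c) * (1 + c) = s * s) ?mulfK//.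
  by rewrite -expr2 -(addKr (c ^+ 2) (s ^+ 2)) cs; ring.
rewrite !(eq_sym j); case: (i =P a) => [_|_].
  have [jb|jb] := eqVneq b j.
    rewrite -jb (negPf ab) -[in LHS]xc; have -> : c = 1 - x * s by rewrite xs; ring.
    by rewrite /= ?mulr0n ?mulr1n; ring.
  by rewrite /= ?mulr0n ?mulr1n; have -> : c = 1 - x * s; [rewrite xs|]; ring.
case: (i =P b) => [_|_]; last by rewrite mulr0 addr0.
have [jb|jb] := eqVneq b j; last by rewrite /= ?mulr0n ?mulr1n; ring.
rewrite -jb (negPf ab) /= ?mulr0n ?mulr1n.
by have -> : c = 1 - x * s; [rewrite xs|]; ring.
Qed.

Lemma rgivens_tr a b c s : a != b -> (rgivens a b c s)^T = rgivens a b c (- s).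
Proof.
move=> ab; have ba : b == a = false by rewrite eq_sym (negPf ab).
apply/matrixP => i j; rewrite !mxE.
have [ia|ia] := eqVneq i a; have [ib|ib] := eqVneq i b;
  have [ja|ja] := eqVneq j a; have [jb|jb] := eqVneq j b;
  rewrite /= ?(eq_sym j i) ?ia ?ib ?ja ?jb ?(negPf ia) ?(negPf ja) ?(negPf ib) ?(negPf jb) //=;
  rewrite ?(eq_sym a j) ?(eq_sym b j) ?(negPf ja) ?(negPf jb) ?mulr0n ?mulr1n; try ring;
  by case/eqP: ab; first [rewrite -ia -ib|rewrite -ja -jb].
Qed.

Lemma rgivensK a b c s : a != b -> c ^+ 2 + s ^+ 2 = 1 ->
  rgivens a b c s *m (rgivens a b c s)^T = 1%:M.
Proof.
move=> ab cs; have ba : b == a = false by rewrite eq_sym (negPf ab).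
rewrite rgivens_tr//; apply/matrixP => i j; rewrite !mxE.
have rowE (v : 'I_p -> R) l : \sum_m rgivens a b c s l m * v m =
    if l == a then c * v a + s * v b else if l == b then c * v b - s * v a else v l.
  under eq_bigr do rewrite mxE.
  have d1 (x : R) m : \sum_l (x * (l == m)%:R) * v l = x * v m.
    by rewrite (bigD1 m)//= eqxx mulr1 big1 ?addr0// => l' /negPf ->; rewrite mulr0 mul0r.
  case: eqP => _; first by under eq_bigr do rewrite mulrDl; rewrite big_split /= !d1.
  case: eqP => _; last first.
    rewrite (bigD1 l)//= eqxx mul1r big1 ?addr0// => m; rewrite eq_sym => /negPf ->.
    by rewrite mul0r.
  under eq_bigr do rewrite -mulNr mulrDl; rewrite big_split /= !d1 mulNr.
  by [].
rewrite (rowE (fun m => rgivens a b c (- s) m j)) !mxE eqxx ba eqxx.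
have [ia|ia] := eqVneq i a; have [ib|ib] := eqVneq i b;
  have [ja|ja] := eqVneq j a; have [jb|jb] := eqVneq j b;
  rewrite /= ?ia ?ib ?ja ?jb ?(negPf ia) ?(negPf ja) ?(negPf ib) ?(negPf jb) ?eqxx;
  rewrite ?ba ?(negPf ab) //=;
  rewrite ?(eq_sym a j) ?(eq_sym b j) ?(negPf ja) ?(negPf jb) ?mulr0n ?mulr1n; try ring;
  try (by rewrite -[RHS]cs; ring);
  by case/eqP: ab; first [rewrite -ia -ib|rewrite -ja -jb].
Qed.

Lemma haut_rgivens a b c s : a != b -> s != 0 -> c ^+ 2 + s ^+ 2 = 1 ->
  haut (rconj (rgivens a b c s)) (rconj (rgivens a b c s)^T).
Proof.
move=> ab s0 cs.
have hd t A : t != 0 -> c ^+ 2 + t ^+ 2 = 1 -> herm A ->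
    hdet (rconj (rgivens a b c t) A) = hdet A.
  move=> t0 ct hA; have ba : b != a by rewrite eq_sym.
  by rewrite rgivensE// !rconjM !hdet_rtransv//; do ?apply: herm_rconj.
apply: haut_rconj; first exact: rgivensK.
  by move=> A; exact: hd.
by move=> A; rewrite rgivens_tr//; apply: hd; rewrite ?oppr_eq0 ?sqrrN.
Qed.

Lemma rgivens_diag a b c s A : herm A -> a != b -> forall i,
  nRe (rconj (rgivens a b c s) A i i) =
  if i == a then c ^+ 2 * nRe (A a a) + s ^+ 2 * nRe (A b b) + 2 * c * s * nRe (A a b)
  else if i == b then c ^+ 2 * nRe (A b b) + s ^+ 2 * nRe (A a a) - 2 * c * s * nRe (A a b)
  else nRe (A i i).
Proof.
move=> /hermE hA ab i; have ba : b == a = false by rewrite eq_sym (negPf ab).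
have rowE (v : 'I_p -> F) l : \sum_m rgivens a b c s l m *: v m =
    if l == a then c *: v a + s *: v b else if l == b then c *: v b - s *: v a else v l.
  under eq_bigr do rewrite mxE.
  have d1 (x : R) m : \sum_l (x * (l == m)%:R) *: v l = x *: v m.
    by rewrite (bigD1 m)//= eqxx mulr1 big1 ?addr0// => l' /negPf ->; rewrite mulr0 scale0r.
  case: eqP => _; first by under eq_bigr do rewrite scalerDl; rewrite big_split /= !d1.
  case: eqP => _; last first.
    rewrite (bigD1 l)//= eqxx scale1r big1 ?addr0// => m; rewrite eq_sym => /negPf ->.
    by rewrite scale0r.
  under eq_bigr do rewrite -mulNr scalerDl; rewrite big_split /= !d1 scaleNr.
  by [].
rewrite !mxE; under eq_bigr do rewrite mxE [lact _ _ _ _]mxE.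
rewrite (rowE (fun l => \sum_m rgivens a b c s i m *: A m l)).
rewrite !(rowE (fun m => A m _)).
have rba : nRe (A b a) = nRe (A a b) by rewrite -(hA a b) nre_conj.
case: eqP => _; first by rewrite !(nreD, nreZ) rba; ring.
by case: eqP => _ //; rewrite !(nreD, nreZ, nreN) rba; ring.
Qed.
End real_conjugation.

(** * Conjugation by diagonal unitaries and the Moufang identities *)

Section unit_conjugation.
Variables (R : realType) (k p : nat).
Hypothesis k3 : (k <= 3)%N.
Hypothesis kp : wassoc k p.
Notation F := (nda R k).
Notation M := ('M[F]_p).
Implicit Types (A B : M) (x y u : F).

Lemma nnormsqZ (a : R) x : nnormsq (a *: x) = a ^+ 2 * nnormsq x.
Proof.
have := (nnormsqE (a *: x)).1; rewrite nconjZ nmulZl nmulZr (nnormsqE x).1.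
move=> /(congr1 (@nRe R k)); rewrite !nreZ !nReK => <-; ring.
Qed.

Lemma nnormsq_real (a : R) : nnormsq (nreal k a) = a ^+ 2.
Proof.
by have := (nnormsqE (nreal k a)).1 => /(congr1 (@nRe R k));
  rewrite nconj_real nmul_reall nreZ !nReK expr2 => <-.
Qed.

Section unit.
Variable u : F.
Hypothesis u1 : nnormsq u = 1.

Let uc1 : nnormsq (nconj u) = 1. Proof. by rewrite nnormsq_conj. Qed.

Lemma nmul_unitVl y : nmul (nconj u) (nmul u y) = y.
Proof. by rewrite nmulV// u1 scale1r. Qed.

Lemma nmul_unitlV y : nmul u (nmul (nconj u) y) = y.
Proof. by rewrite -{1}(nconjK u) nmulV// uc1 scale1r. Qed.

Lemma moufang_unit1 x y : nmul (nmul (nmul u x) u) (nmul (nconj u) y) = nmul u (nmul x y).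
Proof. by rewrite nmul_moufang_left// nmul_unitlV. Qed.

Lemma moufang_unit2 x y :
  nmul (nmul x (nconj u)) (nmul (nmul u y) u) = nmul (nmul x y) u.
Proof.
have := congr1 (@nconj R k)
  (nmul_moufang_left (nconj u) (nconj y) (nmul u (nconj x)) k3).
by rewrite nmul_unitVl !nconjM !nconjK nmul_flex.
Qed.
End unit.

Lemma nmul_flexC x y : nmul (nmul x y) (nconj x) = nmul x (nmul y (nconj x)).
Proof. by rewrite nconjE !nmulBr !nmulZr !nmul1r nmul_flex. Qed.

Variables (u : F) (a b : 'I_p).
Hypotheses (u1 : nnormsq u = 1) (ab : a != b).

(* Conjugation by diag(.., u, .., 1, .., nconj u, ..).  For 3 x 3 octonionic matrices the
   choice of the third entry matters: by the Moufang identities it makes the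
   conjugation compatible with matrix squares. *)
Definition dvec i : F := if i == a then u else if i == b then nreal k 1 else nconj u.

Lemma nnormsq_dvec i : nnormsq (dvec i) = 1.
Proof.
rewrite /dvec; case: ifP => // _; case: ifP => _; rewrite ?nnormsq_conj//.
by rewrite nnormsq_real expr1n.
Qed.

Lemma dvec_flex i j y :
  nmul (nmul (dvec i) y) (nconj (dvec j)) = nmul (dvec i) (nmul y (nconj (dvec j))).
Proof.
rewrite /dvec; case: ifP => _; last case: ifP => _.
- case: ifP => _; last case: ifP => _; rewrite ?nconj_real ?nmul1r// ?nconjK ?nmul_flexC//.
  by rewrite nmul_flex.
- by rewrite !nmul1l.
case: ifP => _; last case: ifP => _; rewrite ?nconj_real ?nmul1r// ?nmul_flex//.
by rewrite nmul_flexC.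
Qed.

Lemma ord_no4 (w x y z : 'I_p) : (p <= 3)%N -> uniq [:: w; x; y; z] -> False.
Proof.
move=> p3 /card_uniqP /= e; have := max_card [in [:: w; x; y; z]].
by rewrite e card_ord leqNgt ltnS p3.
Qed.

(** Without associativity, three distinct indices are all the indices, so the diagonal entries at
    [i], [l], [j] are u, 1, nconj u in one of six orders. Each order is a Moufang identity for u or
    for its conjugate. *)
Lemma dvec_triple i l j x y : (k <= 2)%N || uniq [:: i; l; j] ->
  nmul (nmul (nmul (dvec i) x) (nconj (dvec l))) (nmul (nmul (dvec l) y) (nconj (dvec j)))
  = nmul (nmul (dvec i) (nmul x y)) (nconj (dvec j)).
Proof.
have [k2 _|k2 /= uq] := leqP k 2.
  rewrite !nmulA// -(nmulA (nmul (dvec i) x)) // (nnormsqE (dvec l)).1 nnormsq_dvec.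
  by rewrite nmul1r.
have p3 : (p <= 3)%N by case/orP : kp => // /(leq_ltn_trans) h; move: (h _ k2); rewrite ltnn.
have aijl : a \in [:: i; l; j].
  by apply/negPn/negP => na; apply: (@ord_no4 a i l j p3); rewrite cons_uniq na.
have bijl : b \in [:: i; l; j].
  by apply/negPn/negP => na; apply: (@ord_no4 b i l j p3); rewrite cons_uniq na.
have uc1 : nnormsq (nconj u) = 1 by rewrite nnormsq_conj.
have da : dvec a = u by rewrite /dvec eqxx.
have db : dvec b = nreal k 1 by rewrite /dvec eq_sym (negPf ab) eqxx.
have dc c : c != a -> c != b -> dvec c = nconj u.
  by move=> /negPf ca /negPf cb; rewrite /dvec ca cb.
move: uq aijl bijl; rewrite /= !inE !negb_or andbT => /andP[/andP[il ij] lj].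
have [li ji jl] : [/\ l != i, j != i & j != l] by split; rewrite eq_sym.
case/or3P => /eqP ea; case/or3P => /eqP eb; try by case/eqP: ab; rewrite ea eb.
- rewrite (dc j) -?ea -?eb ?ea ?eb// -?ea -?eb da db nconj_real nmul1r nmul1l nconjK.
  exact: nmul_moufang_mid.
- rewrite (dc l) -?ea -?eb ?ea ?eb// -?ea -?eb da db nconj_real !nmul1r nconjK.
  exact: moufang_unit1.
- rewrite (dc j) -?ea -?eb ?ea ?eb// -?ea -?eb da db !nmul1l nconjK.
  exact: moufang_unit2.
- rewrite (dc i) -?ea -?eb ?ea ?eb// -?ea -?eb da db nconj_real !nmul1r.
  by have := moufang_unit1 uc1 x y; rewrite nconjK.
- rewrite (dc l) -?ea -?eb ?ea ?eb// -?ea -?eb da db !nmul1l nconjK.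
  by have := moufang_unit2 uc1 x y; rewrite nconjK.
- rewrite (dc i) -?ea -?eb ?ea ?eb// -?ea -?eb da db nconj_real !nmul1r !nmul1l.
  exact: nmul_moufang_mid.
Qed.

Definition dconj A : M := \matrix_(i, j) nmul (nmul (dvec i) (A i j)) (nconj (dvec j)).

Lemma dconj_diag A i : herm A -> dconj A i i = A i i.
Proof.
move=> /hermE hA; rewrite mxE -(nreal_Re (hA i i)) nmul_realr nmulZl (nnormsqE _).2.
by rewrite nnormsq_dvec -nrealE.
Qed.

Lemma herm_dconj A : herm A -> herm (dconj A).
Proof.
move=> /hermE hA; apply/hermE => i j; rewrite !mxE !nconjM nconjK hA.
by rewrite dvec_flex.
Qed.

Lemma nnormsq_dconj A i j : nnormsq (dconj A i j) = nnormsq (A i j).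
Proof. by rewrite mxE !nnormsqM// nnormsq_conj !nnormsq_dvec mul1r mulr1. Qed.

(** If two of the three indices of a summand coincide, a real diagonal entry or a norm appears and
    conjugation is harmless; distinct indices are the case of [dvec_triple]. *)
Lemma dconj_sq A : herm A -> nmulmx (dconj A) (dconj A) = dconj (nmulmx A A).
Proof.
move=> hA; have /hermE cA := hA; have /hermE cD := herm_dconj hA.
apply/matrixP => i j; rewrite !mxE nmul_sumr nmul_suml; apply: eq_bigr => l _.
have [k2|k2] := boolP (k <= 2)%N; first by rewrite !mxE dvec_triple ?k2.
have [il|il] := eqVneq i l.
  rewrite -il dconj_diag// mxE -{1 2}(nreal_Re (cA i i)) !nmul_reall nmulZr nmulZl //.
have [lj|lj] := eqVneq l j.
  rewrite -lj dconj_diag// mxE -{1 2}(nreal_Re (cA l l)) !nmul_realr nmulZr nmulZl //.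
have [ij|ij] := eqVneq i j.
  rewrite -ij -(cD l i) (nnormsqE _).2 nnormsq_dconj -(cA l i) (nnormsqE _).2.
  by rewrite nmul_realr nmulZl (nnormsqE _).2 nnormsq_dvec -nrealE.
by rewrite !mxE dvec_triple //= !inE negb_or il ij lj orbT.
Qed.

Lemma lprod_dconj_path A (s : 'S_p) i n : (k <= 2)%N ->
  lprod (word (dconj A) s (traject s i n)) =
  nmul (nmul (dvec i) (lprod (word A s (traject s i n)))) (nconj (dvec (iter n s i))).
Proof.
move=> k2; elim: n i => [|n IH] i /=.
  by rewrite nmul1r (nnormsqE _).2 nnormsq_dvec.
by rewrite IH mxE dvec_triple ?k2// -iterSr.
Qed.

(** In the associative case the diagonal factors telescope along a cycle. Otherwise a cycle has
    length at most three and contributes a diagonal entry, a norm, or a triple product covered by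
    [dvec_triple]. *)
Lemma hdet_dconj A : herm A -> hdet (dconj A) = hdet A.
Proof.
move=> hA; have /hermE cA := hA; have /hermE cD := herm_dconj hA.
apply: eq_bigr => s _; congr (_ * _); apply: eq_bigr => i _.
rewrite !cycle_prodE; have [k2|k2] := boolP (k <= 2)%N.
  rewrite lprod_dconj_path// iter_porbit nre_mulC.
  by rewrite nmulV// nnormsq_dvec scale1r.
have p3 : (p <= 3)%N by move: kp; rewrite /wassoc (negPf k2).
have [m [pm [e lst]]] := traject_porbit s i.
have := uniq_traject_porbit s i; rewrite e.
have m3 : (m < 3)%N by rewrite -pm (leq_trans (card_porbit_le _ _)).
case: m m3 {pm e} lst => [|[|[|//]]] _ /= lst uq; rewrite !nmul1r.
- by rewrite lst dconj_diag.
- rewrite lst -(cD (s i)) -(cA (s i)) !(nnormsqE _).2.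
  by rewrite -nnormsq_conj cD nnormsq_dconj -nnormsq_conj cA.
set l := s i in uq lst *; set j := s l in uq lst *.
have uq2 : uniq [:: l; j; i].
  move: uq; rewrite /= !inE !negb_or andbT => /andP[/andP[il ij] lj].
  by rewrite lj !(eq_sym _ i) il ij.
rewrite lst !mxE dvec_triple ?uq2 ?orbT//.
set w := nmul (A l j) (A j i); rewrite nre_mulA nre_mulC nre_mulA dvec_flex.
rewrite nmulV// nnormsq_dvec scale1r -nre_mulA; congr nRe.
by rewrite nmulV// nnormsq_dvec scale1r.
Qed.

Lemma dconjD A B : dconj (A + B) = dconj A + dconj B.
Proof. by apply/matrixP => i j; rewrite !mxE nmulDr nmulDl. Qed.

Lemma dconjZ (c : R) A : dconj (hscale c A) = hscale c (dconj A).
Proof. by apply/matrixP => i j; rewrite !mxE nmulZr nmulZl. Qed.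

Lemma hhom_dconj : hhom dconj.
Proof.
split => [X|X Y _ _|c X _|X|X hX|X].
- exact: herm_dconj.
- exact: dconjD.
- exact: dconjZ.
- exact: dconj_sq.
- by rewrite /mxtrace; congr nRe; apply: eq_bigr => i _; rewrite dconj_diag.
- exact: hdet_dconj.
Qed.

End unit_conjugation.

Section unit_normalisation.
Variables (R : realType) (k p : nat).
Hypothesis k3 : (k <= 3)%N.
Hypothesis kp : wassoc k p.
Notation F := (nda R k).
Notation M := ('M[F]_p).
Implicit Types (A B : M).

(** The adjoint is conjugation by the inverse diagonal matrix: [nre_mulA] and [nre_mulC] carry the
    factors across the form. *)
Lemma haut_dconj (u : F) (a b : 'I_p) : nnormsq u = 1 -> a != b ->
  haut (dconj u a b) (dconj (nconj u) a b).
Proof.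
move=> u1 ab; split; [exact: hhom_dconj|apply: hhom_dconj => //|].
  by rewrite nnormsq_conj.
move=> X Y _ _; rewrite !tformE; apply: eq_bigr => i _; apply: eq_bigr => j _.
have dC l : dvec (nconj u) a b l = nconj (dvec u a b l).
  by rewrite /dvec; case: ifP => // _; case: ifP => // _; rewrite nconj_real.
rewrite !mxE !dC nconjK -nre_mulA -nre_mulA nre_mulC -nre_mulA.
by [].
Qed.

Lemma entry_normalise A (a b : 'I_p) : herm A -> a != b -> A a b != 0 ->
  exists f g r, [/\ haut f g, r != 0, f A a b = nreal k r & forall i, f A i i = A i i].
Proof.
move=> hA ab Aab; set x := A a b in Aab *.
have n0 : nnormsq x != 0 by rewrite nnormsq_eq0.
have ngt0 : 0 < nnormsq x by rewrite lt_def n0 nnormsq_ge0.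
have s0 : Num.sqrt (nnormsq x) != 0 by rewrite gt_eqF// sqrtr_gt0.
(* The phase that turns [x] into its modulus: u x = |x|, and the entry of [dvec] at [b] is one. *)
pose u := (Num.sqrt (nnormsq x))^-1 *: nconj x.
have u1 : nnormsq u = 1.
  by rewrite nnormsqZ nnormsq_conj exprVn sqr_sqrtr ?ltW// mulVf.
exists (dconj u a b), (dconj (nconj u) a b), (Num.sqrt (nnormsq x)); split => //.
- exact: haut_dconj.
- rewrite mxE /dvec eqxx eq_sym (negPf ab) eqxx nconj_real nmul1r.
  rewrite nmulZl (nnormsqE x).1 nrealE scalerA -nrealE.
  by rewrite -{2}(sqr_sqrtr (ltW ngt0)) expr2 mulKf.
- by move=> i; exact: dconj_diag.
Qed.
End unit_normalisation.

(** * The spectral theorem *)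

Section jacobi_step.
Variables (R : realType) (k p : nat).
Hypothesis k3 : (k <= 3)%N.
Hypothesis kp : wassoc k p.
Notation F := (nda R k).
Notation M := ('M[F]_p).
Implicit Types (A B : M).

Definition diag_energy A : R := \sum_i nRe (A i i) ^+ 2.

(* The witness annihilates the off-diagonal entry of [[x, r], [r, y]]: it rotates by
   half the argument of (x - y, 2 r). *)
Lemma jacobi_angle (x y r : R) : r != 0 -> exists c s : R,
  [/\ s != 0, c ^+ 2 + s ^+ 2 = 1 &
   x ^+ 2 + y ^+ 2 < (c ^+ 2 * x + s ^+ 2 * y + 2 * c * s * r) ^+ 2
                   + (c ^+ 2 * y + s ^+ 2 * x - 2 * c * s * r) ^+ 2].
Proof.
move=> r0; set q := (x - y) ^+ 2 + 4 * r ^+ 2.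
have r2 : 0 < r ^+ 2 by rewrite exprn_even_gt0.
have q0 : 0 < q by rewrite /q; apply: ltr_wpDl; [exact: sqr_ge0|lra].
set t := Num.sqrt q; have t0 : 0 < t by rewrite sqrtr_gt0.
have tq : t ^+ 2 = q by rewrite sqr_sqrtr// ltW.
(* As [r] is nonzero, |x - y| < t strictly; this keeps the cosine [c] away from zero, so that the
   sine can be defined by division. *)
have C0 : 0 < 1 + (x - y) / t.
  rewrite -[X in X + _](divff (lt0r_neq0 t0)) -mulrDl divr_gt0//.
  rewrite -ltrBlDr sub0r; apply: (@le_lt_trans _ _ `|x - y|); first by rewrite -normrN ler_norm.
  by rewrite -sqrtr_sqr /t ltr_sqrt// /q; lra.
(* [C] is the cosine of the doubled angle; the half-angle formulas give c^2 = (1 + C) / 2 and s^2 =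
   (1 - C) / 2. *)
set C := (x - y) / t in C0 *; have Ct : C * t = x - y by rewrite divfK ?gt_eqF.
set c := Num.sqrt ((1 + C) / 2).
have c2 : c ^+ 2 = (1 + C) / 2 by rewrite sqr_sqrtr//; lra.
have c0 : c != 0 by rewrite gt_eqF// sqrtr_gt0; lra.
exists c, (r / (t * c)).
have cs : c * (r / (t * c)) = r / t by field; rewrite c0 gt_eqF.
have s2 : (r / (t * c)) ^+ 2 = (1 - C) / 2.
  apply: (mulfI (lt0r_neq0 C0)).
  have e : 1 + C = 2 * c ^+ 2 by rewrite c2; field.
  rewrite {1}e -mulrA -exprMn cs expr_div_n tq.
  have -> : (1 + C) * ((1 - C) / 2) = (1 - C ^+ 2) / 2 by field.
  have -> : C ^+ 2 = (x - y) ^+ 2 / q by rewrite /C expr_div_n tq.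
  rewrite /q; field; by rewrite -/q gt_eqF.
split.
- by rewrite mulf_neq0// invr_neq0// mulf_neq0// gt_eqF.
- by rewrite c2 s2; field.
rewrite -!(mulrA 2) cs c2 s2; set w := r / t.
have wt : w * t = r by rewrite divfK ?gt_eqF.
have e1 : C * (x - y) + 4 * (w * r) = t.
  apply: (mulIf (lt0r_neq0 t0)).
  have -> : (C * (x - y) + 4 * (w * r)) * t = (C * t) * (x - y) + 4 * (w * t) * r by ring.
  by rewrite Ct wt -(expr2 t) tq /q; ring.
set X := (X in _ < X).
(* The rotated diagonal entries still have sum x + y, and their difference becomes t; the gain in
   energy is 2 r^2. *)
have -> : X = ((x + y) ^+ 2 + (C * (x - y) + 4 * (w * r)) ^+ 2) / 2.
  by rewrite /X; field.
rewrite e1 tq /q; lra.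
Qed.

Lemma jacobi_step A (a b : 'I_p) : herm A -> a != b -> A a b != 0 ->
  exists f g, haut f g /\ diag_energy A < diag_energy (f A).
Proof.
move=> hA ab Aab; have [f [g [r [fg r0 fab fd]]]] := entry_normalise k3 kp hA ab Aab.
have hf : herm (f A) by exact: (hhom_herm (haut_l fg)).
have [c [s [s0 cs lt]]] := jacobi_angle (nRe (A a a)) (nRe (A b b)) r0.
exists (rconj (rgivens a b c s) \o f), (g \o rconj (rgivens a b c s)^T).
split; first by apply: haut_comp => //; exact: haut_rgivens.
have ba : b != a by rewrite eq_sym.
have dE B : diag_energy B = nRe (B a a) ^+ 2 + nRe (B b b) ^+ 2 +
    \sum_(i | (i != a) && (i != b)) nRe (B i i) ^+ 2.
  by rewrite /diag_energy (bigD1 a)//= (bigD1 b)//= addrA.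
rewrite !dE /=.
rewrite (rgivens_diag c s hf ab a) (rgivens_diag c s hf ab b) eqxx (negPf ba) eqxx.
rewrite fab !fd nReK; apply: ltr_leD => //; rewrite le_eqVlt; apply/orP; left.
apply/eqP; apply: eq_bigr => i /andP[ia ib].
by rewrite (rgivens_diag c s hf ab i) (negPf ia) (negPf ib) fd.
Qed.
End jacobi_step.

(* [Q] will be instantiated with continuity and with measurability. *)
Section polynomial_closure.
Variables (R : realType) (T : Type) (Q : (T -> R) -> Prop).
Hypothesis Qc : forall c, Q (fun=> c).
Hypothesis QD : forall f g, Q f -> Q g -> Q (fun t => f t + g t).
Hypothesis QM : forall f g, Q f -> Q g -> Q (fun t => f t * g t).

Lemma ncompD k (x y : nda R k) c : ncomp (x + y) c = ncomp x c + ncomp y c.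
Proof. by elim: k x y c => [//|k IH] [x x'] [y y'] [] c /=; exact: IH. Qed.

Lemma ncompZ k a (x : nda R k) c : ncomp (a *: x) c = a * ncomp x c.
Proof. by elim: k x c => [//|k IH] [x x'] [] c /=; exact: IH. Qed.

Lemma poly_sum I (r : seq I) (P : pred I) (f : I -> T -> R) :
  (forall i, Q (f i)) -> Q (fun t => \sum_(i <- r | P i) f i t).
Proof.
move=> h; elim: r => [|i r IH]; first by under eq_fun do rewrite big_nil.
under eq_fun do rewrite big_cons; case: (P i) => //; exact: QD.
Qed.

Lemma poly_prod I (r : seq I) (P : pred I) (f : I -> T -> R) :
  (forall i, Q (f i)) -> Q (fun t => \prod_(i <- r | P i) f i t).
Proof.
move=> h; elim: r => [|i r IH]; first by under eq_fun do rewrite big_nil.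
under eq_fun do rewrite big_cons; case: (P i) => //; exact: QM.
Qed.

Definition npoly k (h : T -> nda R k) := forall c, Q (fun t => ncomp (h t) c).

Lemma npoly_const k (x : nda R k) : npoly (fun=> x).
Proof. by move=> c; exact: Qc. Qed.

Lemma npolyD k (h h' : T -> nda R k) : npoly h -> npoly h' -> npoly (fun t => h t + h' t).
Proof. by move=> H H' c; under eq_fun do rewrite ncompD; exact: QD. Qed.

Lemma npolyZ k f (h : T -> nda R k) : Q f -> npoly h -> npoly (fun t => f t *: h t).
Proof. by move=> H H' c; under eq_fun do rewrite ncompZ; exact: QM. Qed.

Lemma npolyN k (h : T -> nda R k) : npoly h -> npoly (fun t => - h t).
Proof. by move=> H; under eq_fun do rewrite -scaleN1r; exact: npolyZ. Qed.

Lemma npoly_pair k (h : T -> nda R k.+1) :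
  npoly h <-> npoly (fun t => (h t).1) /\ npoly (fun t => (h t).2).
Proof.
split=> [H|[H1 H2] [c|c]]; [split=> c|exact: H1|exact: H2].
  exact: (H (inl c)).
exact: (H (inr c)).
Qed.

Lemma npoly_conj k (h : T -> nda R k) : npoly h -> npoly (fun t => nconj (h t)).
Proof.
elim: k h => [//|k IH] h /npoly_pair[h1 h2]; apply/npoly_pair; split => /=.
  exact: IH.
exact: npolyN.
Qed.

Lemma npoly_mul k (h h' : T -> nda R k) :
  npoly h -> npoly h' -> npoly (fun t => nmul (h t) (h' t)).
Proof.
elim: k h h' => [|k IH] h h'; first by move=> H H' []; exact: (QM (H tt) (H' tt)).
move=> /npoly_pair[h1 h2] /npoly_pair[g1 g2]; apply/npoly_pair; split => /=.
  by apply: npolyD; [exact: IH|apply: npolyN; apply: IH => //; exact: npoly_conj].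
by apply: npolyD; apply: IH => //; exact: npoly_conj.
Qed.

Lemma poly_re k (h : T -> nda R k) : npoly h -> Q (fun t => nRe (h t)).
Proof.
elim: k h => [|k IH] h; first by move=> /(_ tt).
by move=> /npoly_pair[h1 _]; exact: IH.
Qed.

Lemma npoly_sum k I (r : seq I) (P : pred I) (f : I -> T -> nda R k) :
  (forall i, npoly (f i)) -> npoly (fun t => \sum_(i <- r | P i) f i t).
Proof.
move=> h; elim: r => [|i r IH].
  by under eq_fun do rewrite big_nil; exact: npoly_const.
under eq_fun do rewrite big_cons; case: (P i) => //; exact: npolyD.
Qed.

Lemma npoly_real k f : Q f -> npoly (fun t => nreal k (f t)).
Proof. by move=> H; under eq_fun do rewrite nrealE; apply: npolyZ => //; exact: npoly_const. Qed.

Variables k p : nat.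
Notation M := 'M[nda R k]_p.

Definition mpoly (h : T -> M) := forall i j, npoly (fun t => h t i j).

Lemma mpolyD (h h' : T -> M) : mpoly h -> mpoly h' -> mpoly (fun t => h t + h' t).
Proof. by move=> H H' i j; under eq_fun do rewrite mxE; exact: npolyD. Qed.

Lemma mpolyZ f (h : T -> M) : Q f -> mpoly h -> mpoly (fun t => hscale (f t) (h t)).
Proof. by move=> H H' i j; under eq_fun do rewrite mxE; exact: npolyZ. Qed.

Lemma mpoly_mul (h h' : T -> M) : mpoly h -> mpoly h' -> mpoly (fun t => nmulmx (h t) (h' t)).
Proof.
move=> H H' i j; under eq_fun do rewrite mxE.
by apply: npoly_sum => l; exact: npoly_mul.
Qed.

Lemma poly_retr (h : T -> M) : mpoly h -> Q (fun t => nRe (\tr (h t))).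
Proof. by move=> H; apply: poly_re; apply: npoly_sum. Qed.

Lemma poly_hdet (h : T -> M) : mpoly h -> Q (fun t => hdet (h t)).
Proof.
move=> H; apply: poly_sum => s; apply: QM => //; apply: poly_prod => i.
apply: poly_re; rewrite /cycle_prod; elim: (traject _ _ _) => [|j r IH].
  by under eq_fun do rewrite big_nil; exact: npoly_const.
by under eq_fun do rewrite big_cons; exact: npoly_mul.
Qed.

Lemma mpoly_hmx (h : T -> #|hidx k p|.-tuple (measurableTypeR R)) :
  (forall r, Q (fun t => tnth (h t) r)) -> mpoly (fun t => hmx (h t)).
Proof.
move=> H i j; under eq_fun do rewrite mxE.
have up a b : npoly (fun t => hupper (h t) a b : nda R k).
  rewrite /hupper; case: insub => [ij|]; last exact: npoly_const.
  by move=> c; under eq_fun do rewrite nofcompK.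
case: eqP => _; first exact: npoly_real.
by apply: npolyD => //; exact: npoly_conj.
Qed.

End polynomial_closure.

(** * Compactness of the set of automorphisms and diagonalisation *)

Section spectral.
Variables (R : realType) (k p : nat).
Hypothesis k3 : (k <= 3)%N.
Hypothesis kp : wassoc k p.
Notation F := (nda R k).
Notation M := ('M[F]_p).
Notation N := #|hidx k p|.
Notation V := (N.-tuple (measurableTypeR R)).
Implicit Types (A B X Y : M).

Lemma cont_cst (T : topologicalType) (c : R) : continuous (fun _ : T => c).
Proof. by move=> t; exact: cvg_cst. Qed.

Lemma contD (T : topologicalType) (F G : T -> R) :
  continuous F -> continuous G -> continuous (fun t => F t + G t).
Proof. by move=> cF cG t; apply: cvgD; [exact: cF|exact: cG]. Qed.

Lemma contM (T : topologicalType) (F G : T -> R) :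
  continuous F -> continuous G -> continuous (fun t => F t * G t).
Proof. by move=> cF cG t; apply: cvgM; [exact: cF|exact: cG]. Qed.

Lemma closure_eq0 (T : topologicalType) (C : set T) (F : T -> R) w :
  continuous F -> (forall t, C t -> F t = 0) -> closure C w -> F w = 0.
Proof.
move=> cF C0 clw.
have cl : closed (F @^-1` [set x | x = 0]).
  by move/continuous_closedP: cF; apply; exact: closed_eq.
exact/cl/(closureS _ clw).
Qed.

Lemma tnth_hcoord_le A r : herm A -> tnth (hcoord A) r ^+ 2 <= tform A A.
Proof.
move=> hA; have le i j c : ncomp (A i j) c ^+ 2 <= tform A A.
  apply: le_trans (nnormsq_le_tform i j hA); rewrite /nnormsq (bigD1 c)//= lerDl.
  by apply: sumr_ge0 => c' _; exact: sqr_ge0.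
have reE k' (x : nda R k') : exists c, nRe x = ncomp x c.
  elim: k' x => [|k' IH] x; first by exists tt.
  by have [c e] := IH x.1; exists (inl c).
rewrite tnth_mktuple; case: (enum_val r) => [i|[ij c]]; last exact: le.
by have [c ->] := reE _ (A i i); exact: le.
Qed.

Let I : eqType := (bool * (N.-tuple R) * 'I_N)%type.
Let K : topologicalType := prod_topology (fun _ : I => R : topologicalType).

(* A pair of maps is encoded by the real coordinates [w (b, x, r)] of the values at
   [hmx x] of the first ([b = true]) and the second map. *)
Definition autf (w : I -> R) (b : bool) X : M :=
  hmx ([tuple w (b, hcoord X : N.-tuple R, r) | r < N] : V).

Definition autw (f g : M -> M) : I -> R :=
  fun x => tnth (hcoord ((if x.1.1 then f else g) (hmx (x.1.2 : V)))) x.2.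

Lemma autwE f g : haut f g -> forall X, herm X ->
  autf (autw f g) true X = f X /\ autf (autw f g) false X = g X.
Proof.
move=> fg X hX; have h b : autf (autw f g) b X = hmx (hcoord ((if b then f else g) X)).
  rewrite /autf; congr hmx; apply: eq_from_tnth => r.
  by rewrite tnth_mktuple /autw /= hcoordK.
by rewrite !h !hcoordK//; [exact: (hhom_herm (haut_r fg))|exact: (hhom_herm (haut_l fg))].
Qed.

Lemma herm_autf w b X : herm (autf w b X). Proof. exact: herm_hmx. Qed.

Lemma haut_autw f g : haut f g -> haut (autf (autw f g) true) (autf (autw f g) false).
Proof.
move=> fg; have E := autwE fg.
have hh h b : hhom h -> (forall X, herm X -> autf (autw f g) b X = h X) ->
    hhom (autf (autw f g) b).
  move=> hh e; split => [X _|X Y hX hY|a X hX|X hX|X hX|X hX].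
  - exact: herm_autf.
  - by rewrite !e ?(hhomD hh)//; exact: hermD.
  - by rewrite !e ?(hhomZ hh)//; exact: hermZ.
  - by rewrite !e ?(hhom_sq hh)//; exact: herm_sq.
  - by rewrite e ?(hhom_tr hh).
  - by rewrite e ?(hhom_det hh).
split.
- by apply: (hh f); [exact: haut_l fg|move=> X /E[]].
- by apply: (hh g); [exact: haut_r fg|move=> X /E[]].
- by move=> X Y hX hY; rewrite (E X hX).1 (E Y hY).2 (haut_adj fg).
Qed.

Definition autset : set K := [set w | haut (autf w true) (autf w false)].

Let Q (F : K -> R) := continuous F.
Let Qc : forall c, Q (fun=> c). Proof. exact: cont_cst. Qed.
Let QD : forall F G : K -> R, Q F -> Q G -> Q (fun t => F t + G t).
Proof. exact: contD. Qed.
Let QM : forall F G : K -> R, Q F -> Q G -> Q (fun t => F t * G t).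
Proof. exact: contM. Qed.

Lemma mpoly_autf b X : mpoly Q (fun w => autf w b X).
Proof.
apply: mpoly_hmx => // r.
rewrite (_ : (fun t => _) = (fun t : K => t (b, hcoord X : N.-tuple R, r))); last first.
  by apply/funext => t; exact: tnth_mktuple.
exact: (@proj_continuous I (fun=> R : topologicalType)).
Qed.

(** Each equation in [haut] compares polynomials in finitely many coordinates of [w], which are
    continuous for the product topology, and so passes to the closure. *)
Lemma closed_autset : closed autset.
Proof.
move=> w clw.
have eqR (F G : K -> R) : Q F -> Q G -> (forall t, autset t -> F t = G t) -> F w = G w.
  move=> cF cG FG; apply/eqP; rewrite -subr_eq0; apply/eqP.
  apply: (@closure_eq0 K autset (fun t => F t - G t)) => //; last first.
    by move=> t /FG ->; rewrite subrr.
  by apply: QD => //; under eq_fun do rewrite -mulN1r; apply: QM => //; exact: Qc.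
have eqM (F G : K -> M) : mpoly Q F -> mpoly Q G ->
    (forall t, autset t -> F t = G t) -> F w = G w.
  move=> cF cG FG; apply/matrixP => i j; rewrite -[LHS]ncompK -[RHS]ncompK.
  congr nofcomp; apply/funext => c.
  apply: (eqR (fun t => ncomp (F t i j) c) (fun t => ncomp (G t i j) c)).
  - exact: cF.
  - exact: cG.
  - by move=> t /FG ->.
have mA := mpoly_autf; have aut t b : autset t -> hhom (autf t b).
  by case: b => -[].
have hh b : hhom (autf w b).
  split => [X _|X Y hX hY|a X hX|X hX|X hX|X hX].
  - exact: herm_autf.
  - apply: (eqM (fun t => autf t b (X + Y)) (fun t => autf t b X + autf t b Y)) => //.
      exact: mpolyD.
    by move=> t /(aut _ b) h; exact: hhomD.
  - apply: (eqM (fun t => autf t b (hscale a X)) (fun t => hscale a (autf t b X))) => //.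
      exact: (@mpolyZ _ _ Q QM _ _ (fun=> a)).
    by move=> t /(aut _ b) h; exact: hhomZ.
  - apply: (eqM (fun t => nmulmx (autf t b X) (autf t b X))
                (fun t => autf t b (nmulmx X X))) => //.
      exact: mpoly_mul.
    by move=> t /(aut _ b) h; exact: hhom_sq.
  - apply: (eqR (fun t => nRe (\tr (autf t b X))) (fun=> nRe (\tr X))) => //.
      exact: poly_retr.
    by move=> t /(aut _ b) h; exact: hhom_tr.
  - apply: (eqR (fun t => hdet (autf t b X)) (fun=> hdet X)) => //.
      exact: poly_hdet.
    by move=> t /(aut _ b) h; exact: hhom_det.
split=> // X Y hX hY.
apply: (eqR (fun t => tform (autf t true X) Y) (fun t => tform X (autf t false Y))).
- by apply: poly_retr => //; apply: mpoly_mul => // i j; exact: npoly_const.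
- by apply: poly_retr => //; apply: mpoly_mul => // i j; exact: npoly_const.
- by move=> t [_ _]; apply.
Qed.

(** Automorphisms preserve [tform], so every coordinate of the value at a vector is bounded by the
    norm of that vector: the set is closed in a product of segments. *)
Lemma compact_autset : compact autset.
Proof.
pose bd (x : I) : set R := `[(- Num.sqrt (tform (hmx (x.1.2 : V) : M) (hmx (x.1.2 : V)))),
   (Num.sqrt (tform (hmx (x.1.2 : V) : M) (hmx (x.1.2 : V))))]%classic.
apply: (@subclosed_compact K autset [set f | forall x, bd x (f x)] closed_autset).
  by apply: (@tychonoff I (fun=> R : topologicalType)) => x; exact: segment_compact.
move=> w aw [[b v] r] /=; rewrite /bd /= in_itv /=.
rewrite -ler_norml -sqrtr_sqr ler_wsqrtr//.
have -> : w (b, v, r) = tnth (hcoord (autf w b (hmx (v : V)))) r.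
  by rewrite /autf !hmxK tnth_mktuple.
apply: le_trans (tnth_hcoord_le r (herm_autf _ _ _)) _.
have [g hg] : exists g, haut (autf w b) g.
  by case: b; [exists (autf w false)|exists (autf w true); exact: haut_sym].
by rewrite (haut_tform hg)//; exact: herm_hmx.
Qed.

Theorem spectral A : herm A -> exists f g, haut f g /\
  forall i j, i != j -> f A i j = 0.
Proof.
move=> hA.
have cE : continuous (fun w : K => diag_energy (autf w true A)).
  apply: (@poly_sum R K Q Qc QD) => i; under eq_fun do rewrite expr2.
  by apply: QM; apply: poly_re => //; exact: mpoly_autf.
have a0 : autset !=set0 by exists (autw id id); apply: haut_autw; exact: haut_id.
have [w /set_mem aw wmax] := compact_EVT_max a0 compact_autset (continuous_subspaceT cE).
exists (autf w true), (autf w false); split => // i j ij; apply/eqP/negPn/negP => nz.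
have [f [g [fg lt]]] := jacobi_step k3 kp (herm_autf w true A) ij nz.
have cc := haut_comp fg aw.
have := wmax (autw (f \o autf w true) (autf w false \o g)) (mem_set (haut_autw cc)).
by rewrite (autwE cc hA).1 /= leNgt lt.
Qed.
End spectral.

(** * Positive definite matrices *)

Section positive_definite.
Variables (R : realType) (k p : nat).
Hypothesis k3 : (k <= 3)%N.
Hypothesis kp : wassoc k p.
Notation F := (nda R k).
Notation M := ('M[F]_p).
Notation W := ('cV[F]_p).
Implicit Types (A B X Y E : M) (x : W).

Definition vassoc x := forall i j l, nmul (x i 0) (nmul (x j 0) (x l 0)) =
  nmul (nmul (x i 0) (x j 0)) (x l 0).

Definition outer x : M := \matrix_(i, j) nmul (x i 0) (nconj (x j 0)).

(** Only real parts are compared, so [nre_mulA] allows the rebracketing for arbitrary entries. *)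
Lemma quad_outer A x : nRe (nmulmx (nadj x) (nmulmx A x) 0 0) = tform A (outer x).
Proof.
rewrite mxE nre_sum tformE; apply: eq_bigr => i _.
rewrite !mxE nmul_sumr nre_sum; apply: eq_bigr => j _.
by rewrite mxE nre_mulC -nre_mulA.
Qed.

Lemma herm_outer x : herm (outer x).
Proof. by apply/hermE => i j; rewrite !mxE nconjM nconjK. Qed.

Lemma nretr_outer x : nRe (\tr (outer x)) = \sum_i nnormsq (x i 0).
Proof. by rewrite nre_sum; apply: eq_bigr => i _; rewrite mxE (nnormsqE _).2 nReK. Qed.

(* This characterises the matrices [outer x] by the Jordan algebra structure, so that
   positive definiteness is invariant under automorphisms. *)
Definition rank1 E := [/\ herm E, nmulmx E E = hscale (nRe (\tr E)) E & 0 < nRe (\tr E)].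

Lemma rank1_outer x : vassoc x -> x != 0 -> rank1 (outer x).
Proof.
move=> ax x0; split; first exact: herm_outer.
  apply/matrixP => i j; rewrite !mxE nretr_outer scaler_suml; apply: eq_bigr => l _.
  by rewrite !mxE nmul_assoc_cancel.
rewrite nretr_outer lt_def sumr_ge0 ?andbT => [|i _]; last exact: nnormsq_ge0.
apply: contra x0; rewrite psumr_eq0 => [|i _]; last exact: nnormsq_ge0.
move=> /allP h; apply/eqP/matrixP => i j; rewrite ord1 mxE; apply/eqP.
by rewrite -nnormsq_eq0; apply: h; rewrite mem_index_enum.
Qed.

Lemma big_ord3 (T : nmodType) (f : 'I_p -> T) i j l : (p <= 3)%N -> uniq [:: i; j; l] ->
  \sum_m f m = f i + (f j + f l).
Proof.
move=> p3 uq; move: (uq); rewrite /= !inE negb_or andbT => /andP[/andP[ij il] jl].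
rewrite (bigD1 i)//= (bigD1 j) /=; last by rewrite eq_sym.
rewrite (bigD1 l) /=; last by rewrite !(eq_sym l) il jl.
rewrite big1 ?addr0// => m /andP[/andP[mi mj] ml].
case: (@ord_no4 p m i j l p3); rewrite cons_uniq uq andbT !inE !negb_or.
by rewrite mi mj ml.
Qed.

Lemma big_ord2 (T : nmodType) (f : 'I_p -> T) i j : i != j ->
  (forall m, m != i -> m != j -> False) -> \sum_m f m = f i + f j.
Proof.
move=> ij h; rewrite (bigD1 i)//= (bigD1 j) /=; last by rewrite eq_sym.
by rewrite big1 ?addr0// => m /andP[mi mj]; case: (h m).
Qed.

Section rank1.
Variable E : M.
Hypothesis rE : rank1 E.
Let t := nRe (\tr E).
Let hE : herm E. Proof. by case: rE. Qed.
Let cE i j : nconj (E j i) = E i j. Proof. by have /hermE := hE. Qed.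
Let sqE i j : \sum_m nmul (E i m) (E m j) = t *: E i j.
Proof. by case: rE => _ /matrixP/(_ i j); rewrite !mxE. Qed.
Let dE i : E i i = nreal k (nRe (E i i)). Proof. by rewrite nreal_Re ?cE. Qed.
Let tE : t = \sum_i nRe (E i i). Proof. exact: nre_sum. Qed.

(* The difference [G] of the two sides, as a matrix in [j] and [l], is Hermitian with
   [G ^ 2] proportional to [G] and [tr G = 0], hence vanishes. *)
Lemma rank1_minor_assoc i j l : (k <= 2)%N ->
  nmul (E j i) (E i l) = nRe (E i i) *: E j l.
Proof.
move=> k2; set e := nRe (E i i).
pose P : M := \matrix_(j, l) nmul (E j i) (E i l).
pose G := hscale e E - P.
have hP : herm P by apply/hermE => a b; rewrite !mxE nconjM !cE.
have hG : herm G by apply: hermB => //; exact: hermZ.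
have EP : nmulmx E P = hscale t P.
  apply/matrixP => a b; rewrite !mxE -nmulZl -sqE nmul_suml; apply: eq_bigr => m _.
  by rewrite mxE nmulA.
have PE : nmulmx P E = hscale t P.
  apply/matrixP => a b; rewrite !mxE -nmulZr -sqE nmul_sumr; apply: eq_bigr => m _.
  by rewrite mxE nmulA.
have PP : nmulmx P P = hscale (t * e) P.
  apply/matrixP => a b; rewrite !mxE -nmul_realr.
  have -> : nmul (nmul (E a i) (E i b)) (nreal k (t * e)) =
      nmul (nmul (E a i) (t *: E i i)) (E i b).
    by rewrite [E i i]dE -/e nmul_realr nmulZr nmul_realr nmulZl nmulZl scalerA.
  rewrite -sqE nmul_sumr nmul_suml; apply: eq_bigr => m _.
  by rewrite !mxE !nmulA.
have EE : nmulmx E E = hscale t E by case: rE.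
have GG : nmulmx G G = hscale (t * e) G.
  rewrite /G -!hscaleN1 !(nmulmxDl, nmulmxDr, nmulmxZl, nmulmxZr) EE EP PE PP.
  rewrite !(hscaleA, hscaleDr); apply/matrixP => a b; rewrite !mxE.
  by rewrite -!addrA -!scalerDl; congr (_ *: _ + _ *: _); ring.
have trG : nRe (\tr G) = 0.
  rewrite /G -hscaleN1 nretrD !nretrZ -/t mulN1r; apply/eqP; rewrite subr_eq0; apply/eqP.
  have := congr1 (@nRe R k) (sqE i i); rewrite nre_sum nreZ -/e mulrC => <-.
  by rewrite nre_sum; apply: eq_bigr => m _; rewrite mxE nre_mulC.
have G0 : G = 0 by apply: tform_eq0 => //; rewrite /tform GG nretrZ trG mulr0.
by move/matrixP/(_ j l): G0; rewrite !mxE => /eqP; rewrite subr_eq0 => /eqP.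
Qed.

(* For [p <= 3] the off-diagonal equation is the ([j], [l]) entry of [E ^ 2 = t E]; the
   diagonal ones follow from the diagonal entries of [E ^ 2 = t E] by linear algebra. *)
Lemma rank1_minor3 i j l : (p <= 3)%N ->
  nmul (E j i) (E i l) = nRe (E i i) *: E j l.
Proof.
move=> p3; set e := nRe (E i i).
have [->|ji] := eqVneq j i; first by rewrite [E i i]dE nmul_reall.
have [->|li] := eqVneq l i; first by rewrite [E i i]dE nmul_realr.
have [<-{l li}|jl] := eqVneq j l; last first.
  have uq : uniq [:: i; j; l] by rewrite /= !inE negb_or jl !(eq_sym i) ji li.
  have := sqE j l; rewrite tE !(big_ord3 _ p3 uq) [E j j]dE [E l l]dE nmul_reall nmul_realr.
  rewrite !nReK !scalerDl => /addIr; exact.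
pose n a b := nnormsq (E a b); have nC a b : n a b = n b a by rewrite /n -cE nnormsq_conj.
have nE a b : nmul (E a b) (E b a) = nreal k (n a b) by rewrite -(cE b a) (nnormsqE _).2.
have nd a : n a a = nRe (E a a) ^+ 2 by rewrite /n dE nnormsq_real nReK.
have row a : \sum_m n a m = t * nRe (E a a).
  have := congr1 (@nRe R k) (sqE a a); rewrite nreZ nre_sum => <-.
  by apply: eq_bigr => m _; rewrite nE nReK.
suff -> : nmul (E j i) (E i j) = nreal k (e * nRe (E j j)).
  rewrite [E j j]dE nReK -nmul_reall [in RHS]nmul_reall.
  by rewrite [nreal k (_ * _)]nrealE -scalerA -nrealE.
rewrite nE; congr nreal.
have [m /andP[mi mj]|nom] := pickP (fun m => (m != i) && (m != j)).
  have uq : uniq [:: i; j; m] by rewrite /= !inE negb_or (eq_sym i j) ji !(eq_sym _ m) mi mj.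
  have := row i; have := row j; have := row m; rewrite tE !(big_ord3 _ p3 uq) !nd.
  rewrite (nC m i) (nC m j) (nC i j) -/e; move: (n j i) (n i m) (n j m) (nRe _) (nRe _).
  (* The three row equations fix the pairwise sums of the three off-diagonal norms, hence each
     norm. *)
  move=> x y z u v h1 h2 h3; lra.
have ij : i != j by rewrite eq_sym.
have := row i; rewrite tE !(big_ord2 _ ij) ?nd; last first.
- by move=> m mi mj; have := nom m; rewrite mi mj.
- by move=> m mi mj; have := nom m; rewrite mi mj.
rewrite (nC i j) -/e; lra.
Qed.

Lemma rank1_minor i j l : nmul (E j i) (E i l) = nRe (E i i) *: E j l.
Proof. by case/orP: kp => h; [exact: rank1_minor_assoc|exact: rank1_minor3]. Qed.

(** The trace is positive, hence so is some diagonal entry e; the vector is the column through it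
    divided by sqrt e, and [rank1_minor] recovers [E]. Its entry at that index is real and at most
    two others remain over the octonions, so associativity follows from the alternative laws. *)
Lemma rank1_is_outer : exists x, [/\ vassoc x, x != 0 & E = outer x].
Proof.
have t0 : 0 < t by case: rE.
have [i ei] : exists i, 0 < nRe (E i i).
  apply/not_existsP => h; move: t0; rewrite tE ltNge => /negP; apply.
  by apply: sumr_le0 => i _; rewrite leNgt; apply/negP.
set e := nRe (E i i) in ei; set c := (Num.sqrt e)^-1.
have c2 : c * c = e^-1 by rewrite -expr2 exprVn sqr_sqrtr// ltW.
pose x : W := \col_j (c *: E j i).
have Eo : E = outer x.
  apply/matrixP => j l; rewrite !mxE nconjZ cE nmulZl nmulZr scalerA c2 rank1_minor.
  by rewrite scalerA mulVf ?scale1r// gt_eqF.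
exists x; split => //; last first.
  apply/eqP => x0; move: t0; rewrite /t {1}Eo nretr_outer big1 ?ltxx// => j _.
  by rewrite x0 mxE; apply/eqP; rewrite nnormsq_eq0.
move=> j l m; have [k2|k2] := boolP (k <= 2)%N; first by rewrite nmulA.
have p3 : (p <= 3)%N by move: kp; rewrite /wassoc (negPf k2).
have xi : x i 0 = nreal k (c * e) by rewrite mxE dE -/e nrealE scalerA -nrealE.
have [->|ji] := eqVneq j i; first by rewrite xi !nmul_reall nmulZl.
have [->|li] := eqVneq l i; first by rewrite xi nmul_reall nmul_realr nmulZl nmulZr.
have [->|mi] := eqVneq m i; first by rewrite xi !nmul_realr nmulZr.
have [->|jl] := eqVneq j l; first by rewrite nmul_altl.
have [->|lm] := eqVneq l m; first by rewrite nmul_altr.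
have [->|jm] := eqVneq j m; first by rewrite nmul_flex.
case: (@ord_no4 p i j l m p3); rewrite /= !inE !negb_or jl lm jm !(eq_sym i).
by rewrite ji li mi.
Qed.
End rank1.

Lemma pdE A : pd A <-> herm A /\ forall E, rank1 E -> 0 < tform A E.
Proof.
split=> -[hA h]; split=> //.
  by move=> E /rank1_is_outer[x [ax x0 ->]]; rewrite -quad_outer; exact: h.
by move=> x x0 ax; rewrite quad_outer; apply: h; exact: rank1_outer.
Qed.

Lemma pd_haut f g A : haut f g -> pd A -> pd (f A).
Proof.
move=> fg /pdE[hA h]; apply/pdE; split; first exact: (hhom_herm (haut_l fg)).
move=> E [hE E2 tE]; rewrite (haut_adj fg)//; apply: h; split.
- exact: (hhom_herm (haut_r fg)).
- by rewrite (hhom_sq (haut_r fg))// (hhom_tr (haut_r fg))// E2 (hhomZ (haut_r fg)).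
- by rewrite (hhom_tr (haut_r fg)).
Qed.

End positive_definite.

(** * Diagonal matrices, and the map Y to S Y S for positive definite S *)

Section diagonal.
Variables (R : realType) (k p : nat).
Hypothesis k3 : (k <= 3)%N.
Hypothesis kp : wassoc k p.
Notation F := (nda R k).
Notation M := ('M[F]_p).
Implicit Types (A B X Y E S : M) (d : 'I_p -> R).

Definition dg d : M := \matrix_(i, j) if i == j then nreal k (d i) else 0.

Lemma dg_nmulmx d Y i j : nmulmx (dg d) Y i j = d i *: Y i j.
Proof.
rewrite mxE (bigD1 i)//= mxE eqxx nmul_reall big1 ?addr0// => l.
by rewrite mxE eq_sym => /negPf ->; rewrite nmul0l.
Qed.

Lemma nmulmx_dg d Y i j : nmulmx Y (dg d) i j = d j *: Y i j.
Proof.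
rewrite mxE (bigD1 j)//= mxE eqxx nmul_realr big1 ?addr0// => l.
by rewrite mxE => /negPf ->; rewrite nmul0r.
Qed.

Lemma dg_sq d : nmulmx (dg d) (dg d) = dg (fun i => d i ^+ 2).
Proof.
apply/matrixP => i j; rewrite dg_nmulmx !mxE; case: eqP => _; last by rewrite scaler0.
by rewrite nrealE scalerA -expr2 -nrealE.
Qed.

Lemma jordan_dg d Y i j : jordan (dg d) Y i j = ((d i + d j) / 2) *: Y i j.
Proof.
by rewrite mxE [(nmulmx _ _ + _) _ _]mxE dg_nmulmx nmulmx_dg -scalerDl scalerA mulrC.
Qed.

(** Jordan multiplication by a diagonal matrix scales entries by means, and 2 ((x + y) / 2)^2 - (x^2
    + y^2) / 2 = x y. *)
Lemma sandwich_dg d Y i j : sandwich (dg d) Y i j = (d i * d j) *: Y i j.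
Proof.
rewrite /sandwich mulr2n jordan_sq dg_sq mxE [X in X + _]mxE [X in _ + X]mxE !jordan_dg.
by rewrite !scalerA -scalerDl -scalerBl; congr (_ *: _); field.
Qed.

Lemma herm_dg d : herm (dg d).
Proof.
apply/hermE => i j; rewrite !mxE eq_sym; case: eqP => [->|_]; rewrite ?nconj0//.
by rewrite nconj_real.
Qed.

Lemma prod_porbit (s : 'S_p) (f : 'I_p -> R) :
  \prod_(i | porbit_rep s i) \prod_(j in porbit s i) f j = \prod_j f j.
Proof.
pose m j := let: exist2 m _ _ := porbit_rep_pick s j in m.
have mP j : m j \in porbit s j /\
    forall i, porbit_rep s i && (i \in porbit s j) = (i == m j).
  by rewrite /m; case: porbit_rep_pick.
rewrite [RHS](partition_big m (porbit_rep s))/= => [|j _]; last first.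
  by have [_ /(_ (m j))] := mP j; rewrite eqxx => /andP[].
apply: eq_bigr => i ri; apply: eq_bigl => j.
by have [_ /(_ i)] := mP j; rewrite ri /= porbit_sym eq_sym => ->.
Qed.

Lemma lprod_scale d (c : 'I_p -> R) A B (s : 'S_p) (r : seq 'I_p) :
  (forall j, B j (s j) = c j *: A j (s j)) ->
  lprod (word B s r) = (\prod_(j <- r) c j) *: lprod (word A s r).
Proof.
move=> h; elim: r => [|j r IH] /=; first by rewrite big_nil scale1r.
by rewrite big_cons h IH nmulZl nmulZr scalerA.
Qed.

(** In the term of a permutation every index occurs once as a row and once as a column. *)
Lemma hdet_scale d A : hdet (\matrix_(i, j) ((d i * d j) *: A i j) : M) =
  (\prod_i d i) ^+ 2 * hdet A.
Proof.
rewrite !hdetE mulr_sumr; apply: eq_bigr => s _; rewrite mulrCA; congr (_ * _).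
set B := \matrix_(i, j) _.
have -> : cyclew B s = \prod_(i | porbit_rep s i)
    ((\prod_(j in porbit s i) (d j * d (s j))) * recyc A s i).
  apply: eq_bigr => i _; rewrite /recyc !cycle_prodE.
  rewrite (@lprod_scale d (fun j => d j * d (s j)) A B s) ?nreZ => [|j]; last by rewrite mxE.
  congr (_ * _); rewrite -(eq_bigl _ _ (fun j => esym (porbit_traject s i j))) -big_uniq//.
  exact: uniq_traject_porbit.
rewrite big_split /= prod_porbit big_split /= expr2; congr (_ * _ * _).
by rewrite [RHS](reindex_inj (@perm_inj _ s)).
Qed.

Lemma hdet_dg d : hdet (dg d) = \prod_i d i.
Proof.
have p1 i : porbit (1%g : 'S_p) i = [set i]%SET.
  apply/setP => j; rewrite inE; apply/porbitP/eqP => [[n ->]|->].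
    by rewrite expg1n perm1.
  by exists 0%N; rewrite expg0 perm1.
rewrite hdetE (bigD1 (1%g : 'S_p)) //= odd_perm1 expr0 mul1r big1 ?addr0.
  rewrite /cyclew; apply: eq_big => [i|i _].
    by apply/forall_inP => j; rewrite p1 inE => /eqP ->.
  by rewrite /recyc cycle_prodE p1 cards1 /= perm1 mxE eqxx nmul1r nReK.
move=> s s1; have [i si] : exists i, s i != i.
  apply/existsP; apply: contraR s1; rewrite negb_exists => /forallP h.
  by apply/eqP/permP => i; rewrite perm1; apply/eqP; have := h i; rewrite negbK.
rewrite (cyclew_split kp _ s i) /recyc cycle_prodE.
have [m [_ [-> _]]] := traject_porbit s i.
by rewrite /= mxE eq_sym (negPf si) nmul0l nre0 mul0r mulr0.
Qed.

Lemma tform_dg d Y : tform (dg d) Y = \sum_i d i * nRe (Y i i).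
Proof. by rewrite /tform nre_sum; apply: eq_bigr => i _; rewrite dg_nmulmx nreZ. Qed.

Lemma pd_dg d : pd (dg d) <-> forall i, 0 < d i.
Proof.
rewrite pdE//; split=> [[_ h] i|d0].
  pose x : 'cV[F]_p := \col_j nreal k (j == i)%:R.
  have ax : vassoc x.
    by move=> a b c; rewrite !mxE [in RHS]nmul_reall nmulZl !nmul_reall.
  have x0 : x != 0.
    apply/eqP => /matrixP/(_ i 0)/(congr1 (@nRe R k)); rewrite !mxE eqxx nReK nre0.
    by move/eqP; rewrite oner_eq0.
  have := h _ (rank1_outer k3 ax x0); rewrite tform_dg (bigD1 i)//= big1 => [|j /negPf ji].
    by rewrite !mxE eqxx nconj_real nmul_reall nreZ nReK !mulr1 addr0.
  by rewrite !mxE ji nreal0 nmul0l nre0 mulr0.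
split; first exact: herm_dg.
move=> E /(rank1_is_outer k3 kp)[x [_ x0 ->]]; rewrite tform_dg.
have ge i : 0 <= d i * nRe (outer x i i).
  by rewrite mxE (nnormsqE _).2 nReK mulr_ge0 ?nnormsq_ge0// ltW.
rewrite lt_def sumr_ge0 ?andbT//; apply: contra x0; rewrite psumr_eq0// => /allP h.
apply/eqP/matrixP => i j; rewrite ord1 [RHS]mxE; apply/eqP; rewrite -nnormsq_eq0.
have := h i (mem_index_enum _).
by rewrite /= mxE (nnormsqE _).2 nReK mulf_eq0 (gt_eqF (d0 i)).
Qed.

Lemma tform_sandwich_dg d X Y :
  tform (sandwich (dg d) X) Y = tform X (sandwich (dg d) Y).
Proof.
rewrite !tformE; apply: eq_bigr => i _; apply: eq_bigr => j _.
by rewrite !sandwich_dg nmulZl nmulZr mulrC.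
Qed.

(** The map is self-adjoint for [tform] and sends x x^* to z z^* with z_i = d_i x_i; real factors
    keep the entries associating. *)
Lemma pd_sandwich_dg d Y : (forall i, 0 < d i) -> pd Y -> pd (sandwich (dg d) Y).
Proof.
move=> d0; rewrite !pdE// => -[hY h]; split.
  by apply: herm_sandwich => //; exact: herm_dg.
move=> E /(rank1_is_outer k3 kp)[x [ax x0 ->]]; rewrite tform_sandwich_dg.
pose z : 'cV[F]_p := \col_i (d i *: x i 0).
have -> : sandwich (dg d) (outer x) = outer z.
  by apply/matrixP => i j; rewrite sandwich_dg !mxE nconjZ nmulZl nmulZr scalerA.
apply: h; apply: rank1_outer => //.
  by move=> a b c; rewrite !mxE !(nmulZl, nmulZr) ax !scalerA; congr (_ *: _); ring.
apply: contra x0 => /eqP z0; apply/eqP/matrixP => i j; rewrite ord1 [RHS]mxE.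
move/matrixP/(_ i 0): z0; rewrite !mxE => /eqP; rewrite scaler_eq0 gt_eqF//=.
by move=> /eqP.
Qed.

(** Jordan multiplication by [dg d] scales each entry by a mean of two positive numbers, so it is
    injective; this pins down the value chosen by [hinv]. *)
Lemma hinv_dg d B : (forall i, 0 < d i) -> is_hinv (dg d) B <-> B = dg (fun i => (d i)^-1).
Proof.
move=> d0; have dn0 i : d i != 0 by rewrite gt_eqF.
have dd i : (d i + d i) / 2 = d i by field.
split=> [[_ /matrixP h _]|->].
  apply/matrixP => i j; have := h i j; rewrite jordan_dg !mxE; case: eqVneq => [<-|ij].
    move=> /(congr1 (fun x => (d i)^-1 *: x)).
    by rewrite dd scalerA mulVf// scale1r -nrealE.
  move=> /(congr1 (fun x => ((d i + d j) / 2)^-1 *: x)); rewrite scalerA mulVf.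
    by rewrite scale1r nreal0 scaler0.
  by rewrite gt_eqF// divr_gt0// addr_gt0.
split; first exact: herm_dg.
  apply/matrixP => i j; rewrite jordan_dg !mxE; case: eqVneq => [<-|ij].
    by rewrite dd nrealE scalerA mulfV// -nrealE.
  by rewrite scaler0 nreal0.
rewrite jordan_sq dg_sq; apply/matrixP => i j; rewrite jordan_dg !mxE.
case: eqVneq => [<-|ij]; last by rewrite scaler0.
rewrite nrealE scalerA -nrealE; congr nreal; field; exact: dn0.
Qed.

Lemma diagonalise A : herm A -> exists f g d, haut f g /\ f A = dg d.
Proof.
move=> hA; have [f [g [fg h]]] := spectral k3 kp hA.
exists f, g, (fun i => nRe (f A i i)); split => //; apply/matrixP => i j; rewrite mxE.
case: eqVneq => [<-|ij]; last exact: h.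
by rewrite nreal_Re//; have /hermE := hhom_herm (haut_l fg) hA.
Qed.

(** A root is built in diagonal form and carried back, which excludes the default value of
    [xget]. *)
Lemma hsqrtP A : pd A -> pd (hsqrt A) /\ nmulmx (hsqrt A) (hsqrt A) = A.
Proof.
move=> pA; have hA := pA.1; rewrite /hsqrt; case: xgetP => [B _ []//|no]; exfalso.
have [f [g [d [fg fA]]]] := diagonalise hA; have gf := haut_sym fg.
have d0 : forall i, 0 < d i by apply/pd_dg; rewrite -fA; exact: pd_haut fg pA.
apply: (no (g (dg (fun i => Num.sqrt (d i))))); split.
  by apply: (pd_haut k3 kp gf); apply/pd_dg => i; rewrite sqrtr_gt0.
rewrite (hhom_sq (haut_r fg)) ?dg_sq; last exact: herm_dg.
rewrite -[RHS](hautK fg hA) fA; congr (g (dg _)); apply/funext => i.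
by rewrite sqr_sqrtr// ltW.
Qed.

Section sandwich_pd.
Variables (S : M).
Hypothesis pS : pd S.

Lemma pd_diagonalise : exists f g d, [/\ haut f g, S = g (dg d) & forall i, 0 < d i].
Proof.
have [f [g [d [fg fS]]]] := diagonalise pS.1; exists f, g, d; split => //.
  by rewrite -fS (hautK fg)//; exact: pS.1.
by apply/pd_dg; rewrite -fS; exact: pd_haut fg pS.
Qed.

Lemma sandwich_diag f g d Y : haut f g -> S = g (dg d) -> herm Y ->
  sandwich S Y = g (sandwich (dg d) (f Y)).
Proof.
move=> fg -> hY; have hfY := hhom_herm (haut_l fg) hY.
by rewrite -(haut_sandwich (haut_sym fg) (herm_dg d) hfY) (hautK fg).
Qed.

Lemma sandwich_dgK d Y : (forall i, 0 < d i) ->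
  sandwich (dg d) (sandwich (dg (fun i => (d i)^-1)) Y) = Y.
Proof.
move=> d0; apply/matrixP => i j; rewrite !sandwich_dg scalerA -[RHS]scale1r.
by congr (_ *: _); field; rewrite !gt_eqF.
Qed.

Lemma pd_sandwich Y : pd Y -> pd (sandwich S Y).
Proof.
move=> pY; have [f [g [d [fg Sd d0]]]] := pd_diagonalise.
rewrite (sandwich_diag fg Sd pY.1); apply: (pd_haut k3 kp (haut_sym fg)).
by apply: pd_sandwich_dg => //; exact: pd_haut fg pY.
Qed.

Lemma is_hinv_hinv : is_hinv S (hinv S).
Proof.
rewrite /hinv; case: xgetP => [B _ //|no]; exfalso.
have [f [g [d [fg Sd d0]]]] := pd_diagonalise; have gf := haut_sym fg.
apply: (no (g (dg (fun i => (d i)^-1)))); rewrite Sd.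
have [h0 h1 h2] := (hinv_dg (dg (fun i => (d i)^-1)) d0).2 erefl.
have hd := herm_dg d; split; first exact: (hhom_herm (haut_r fg)).
  by rewrite (haut_jordan gf)// h1 (haut_nid gf).
by rewrite !(haut_jordan gf)// ?h2//; exact: herm_jordan.
Qed.

Lemma hinv_diag f g d : haut f g -> S = g (dg d) -> (forall i, 0 < d i) ->
  hinv S = g (dg (fun i => (d i)^-1)).
Proof.
move=> fg Sd d0; have gf := haut_sym fg; have [h0 h1 h2] := is_hinv_hinv.
have hS := pS.1; have fS : f S = dg d by rewrite Sd (hautK gf)//; exact: herm_dg.
rewrite -[LHS](hautK fg h0); congr g; apply/(hinv_dg _ d0); split.
- exact: (hhom_herm (haut_l fg)).
- by rewrite -fS (haut_jordan fg)// h1 (haut_nid fg).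
- by rewrite -fS !(haut_jordan fg)// ?h2//; exact: herm_jordan.
Qed.

Lemma pd_hinv : pd (hinv S).
Proof.
have [f [g [d [fg Sd d0]]]] := pd_diagonalise; rewrite (hinv_diag fg Sd d0).
by apply: (pd_haut k3 kp (haut_sym fg)); apply/pd_dg => i; rewrite invr_gt0.
Qed.

Lemma sandwich_hinvK Y : herm Y ->
  sandwich S (sandwich (hinv S) Y) = Y /\ sandwich (hinv S) (sandwich S Y) = Y.
Proof.
move=> hY; have [f [g [d [fg Sd d0]]]] := pd_diagonalise; have gf := haut_sym fg.
have hi := hinv_diag fg Sd d0; have di0 i : 0 < (d i)^-1 by rewrite invr_gt0.
have hfY := hhom_herm (haut_l fg) hY.
have e (dd : 'I_p -> R) : sandwich (g (dg dd)) Y = g (sandwich (dg dd) (f Y)).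
  by rewrite -(haut_sandwich gf (herm_dg dd) hfY) (hautK fg).
have hs (dd : 'I_p -> R) : herm (sandwich (dg dd) (f Y)).
  by apply: herm_sandwich => //; exact: herm_dg.
have e2 (d1 d2 : 'I_p -> R) : sandwich (g (dg d1)) (sandwich (g (dg d2)) Y) =
    g (sandwich (dg d1) (sandwich (dg d2) (f Y))).
  by rewrite e (haut_sandwich gf (herm_dg d1) (hs d2)).
rewrite hi Sd !e2 sandwich_dgK// (hautK fg hY); split => //.
have -> : dg d = dg (fun i => ((d i)^-1)^-1).
  by congr dg; apply/funext => i; rewrite invrK.
by rewrite sandwich_dgK// (hautK fg).
Qed.

Lemma tform_sandwich X Y : herm X -> herm Y ->
  tform (sandwich S X) Y = tform X (sandwich S Y).
Proof.
move=> hX hY; have [f [g [d [fg Sd d0]]]] := pd_diagonalise; have gf := haut_sym fg.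
have hs Z : herm Z -> herm (sandwich (dg d) (f Z)).
  move=> hZ; apply: herm_sandwich; first exact: herm_dg.
  exact: (hhom_herm (haut_l fg)).
rewrite (sandwich_diag fg Sd hX) (sandwich_diag fg Sd hY) (haut_adj gf (hs X hX) hY).
by rewrite tform_sandwich_dg (haut_adj fg hX (hs Y hY)).
Qed.

(** The witness is the product of the eigenvalues of [S]. *)
Lemma hdet_sandwich : exists2 c : R, 0 < c &
  hdet (nmulmx S S) = c ^+ 2 /\
  forall Y, herm Y -> hdet (sandwich S Y) = c ^+ 2 * hdet Y.
Proof.
have [f [g [d [fg Sd d0]]]] := pd_diagonalise; have gf := haut_sym fg.
exists (\prod_i d i); first exact: prodr_gt0.
split=> [|Y hY].
  rewrite Sd (hhom_sq (haut_r fg)) ?dg_sq; last exact: herm_dg.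
  by rewrite (hhom_det (haut_r fg)) ?hdet_dg ?prodrXl//; exact: herm_dg.
have hfY := hhom_herm (haut_l fg) hY.
rewrite (sandwich_diag fg Sd)// (hhom_det (haut_r fg)).
  rewrite -(hhom_det (haut_l fg) hY) -hdet_scale; congr hdet.
  by apply/matrixP => i j; rewrite sandwich_dg mxE.
by apply: herm_sandwich => //; exact: herm_dg.
Qed.
End sandwich_pd.

Lemma hdet_pd_gt0 A : pd A -> 0 < hdet A.
Proof.
move=> pA; have [pS SS] := hsqrtP pA.
by have [c c0 [e _]] := hdet_sandwich pS; rewrite -SS e exprn_gt0.
Qed.
End diagonal.

(** * Lebesgue measure and linear maps *)

Section lebesgue_linear.
Variable R : realType.
Notation RT := (measurableTypeR R).
Local Open Scope ereal_scope.

Lemma measurable_preimageT d1 d2 (T1 : measurableType d1) (T2 : measurableType d2)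
    (f : T1 -> T2) A : measurable_fun setT f -> measurable A -> measurable (f @^-1` A).
Proof. by move=> mf mA; rewrite -[X in measurable X]setTI; exact: mf. Qed.

Definition tadd n (x y : n.-tuple RT) : n.-tuple RT :=
  [tuple (tnth x i + tnth y i)%R | i < n].

Definition topp n (x : n.-tuple RT) : n.-tuple RT := [tuple (- tnth x i)%R | i < n].

Lemma tnth_tadd n (x y : n.-tuple RT) i : tnth (tadd x y) i = (tnth x i + tnth y i)%R.
Proof. exact: tnth_mktuple. Qed.

Lemma tnth_topp n (x : n.-tuple RT) i : tnth (topp x) i = (- tnth x i)%R.
Proof. exact: tnth_mktuple. Qed.

Lemma taddC n (x y : n.-tuple RT) : tadd x y = tadd y x.
Proof. by apply: eq_from_tnth => i; rewrite !tnth_tadd addrC. Qed.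

Lemma taddK n (x y : n.-tuple RT) : tadd (tadd x y) (topp y) = x.
Proof. by apply: eq_from_tnth => i; rewrite !tnth_tadd tnth_topp addrK. Qed.

Lemma measurable_tadd d (T : measurableType d) n (f g : T -> n.-tuple RT) :
  measurable_fun setT f -> measurable_fun setT g ->
  measurable_fun setT (fun t => tadd (f t) (g t)).
Proof.
move=> /measurable_fun_tnthP mf /measurable_fun_tnthP mg; apply/measurable_fun_tnthP => i.
rewrite (_ : _ \o _ = (fun t => tnth (f t) i + tnth (g t) i)%R); last first.
  by apply/funext => t /=; rewrite tnth_tadd.
by apply: measurable_funD; [exact: mf|exact: mg].
Qed.

Lemma measurable_topp d (T : measurableType d) n (f : T -> n.-tuple RT) :
  measurable_fun setT f -> measurable_fun setT (fun t => topp (f t)).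
Proof.
move=> /measurable_fun_tnthP mf; apply/measurable_fun_tnthP => i.
rewrite (_ : _ \o _ = (fun t => - tnth (f t) i)%R); last first.
  by apply/funext => t /=; rewrite tnth_topp.
by apply: measurableT_comp => //; exact: mf.
Qed.

Lemma lebesgue_translate (c : R) (A : set RT) : measurable A ->
  lebesgue_measure ((fun x : RT => (x + c)%R : RT) @^-1` A) = lebesgue_measure A.
Proof.
have mf : measurable_fun setT (fun x : RT => (x + c)%R : RT) by exact: measurable_funD.
move=> mA; apply/esym.
pose mu := measure_function_pushforward__canonical__measure_function_Measure
  (@lebesgue_measure R) mf.
apply: (lebesgue_measure_unique (mu := mu)) => //.
move=> X [[a b] /= _ <-]; rewrite /pushforward.
rewrite (_ : _ @^-1` _ = `](a - c)%R, (b - c)%R]%classic); last first.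
  by apply/seteqP; split => x /=; rewrite !in_itv /= ltrBlDr lerBrDr.
rewrite !lebesgue_measure_itv /= !lte_fin ltrD2r; case: ifP => // _.
by rewrite -!EFinB; congr (_%:E); ring.
Qed.

Lemma leb_translate n (c : n.-tuple RT) A : measurable A ->
  leb R n ((fun x => tadd x c) @^-1` A) = leb R n A.
Proof.
elim: n c A => [|n IH] c A mA.
  congr (leb R 0 _); apply/seteqP; split => x /=; by rewrite (tuple0 (tadd x c)) (tuple0 x).
rewrite /= /leb_step /pushforward.
pose c' : n.-tuple RT := [tuple of behead c]; pose c0 := thead c.
pose h (z : RT * n.-tuple RT) : RT * n.-tuple RT := ((z.1 + c0)%R, tadd z.2 c').
have mh : measurable_fun setT h.
  apply/measurable_fun_pairP; split => /=; first exact: measurable_funD.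
  exact: measurable_tadd.
have tc z : tadd (tcons z) c = tcons (h z).
  apply: eq_from_tnth => i; rewrite tnth_tadd.
  case: (unliftP ord0 i) => [j ->|->]; last by rewrite /tcons !tnth0 /h /c0 /thead.
  by rewrite /tcons !tnthS tnth_tadd; congr (_ + _)%R; rewrite [in LHS](tuple_eta c) tnthS.
set B := @tcons R n @^-1` A; have mB : measurable B.
  by apply: measurable_preimageT => //; exact: measurable_tcons.
rewrite (_ : _ @^-1` _ = h @^-1` B); last first.
  by apply/seteqP; split => z; rewrite /B /= tc.
pose mu := measure_function_pushforward__canonical__measure_function_Measure
  (lebesgue_measure \x leb R n) mh.
apply/esym; apply: (product_measure_unique (m' := mu)) => //.
move=> X Y mX mY; rewrite /= /pushforward.
rewrite (_ : _ @^-1` _ =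
  ((fun x : RT => (x + c0)%R : RT) @^-1` X) `*` ((fun x => tadd x c') @^-1` Y)) //.
rewrite product_measure1E.
- by congr (_ * _); [exact: lebesgue_translate|exact: IH].
- apply: (measurable_preimageT (f := fun x : RT => (x + c0)%R : RT)) => //.
  exact: measurable_funD.
- by apply: (measurable_preimageT (f := fun x => tadd x c')) => //; exact: measurable_tadd.
Qed.

Section additive_bijection.
Variables (n : nat) (L L' : n.-tuple RT -> n.-tuple RT).
Hypotheses (mL : measurable_fun setT L) (mL' : measurable_fun setT L').
Hypotheses (LD : forall x y, L (tadd x y) = tadd (L x) (L y)).
Hypothesis LN : forall x, L (topp x) = topp (L x).
Hypothesis L'K : cancel L' L.
Local Notation m := (leb R n).

(* The measures [A |-> m (L^-1 A)] and [m] are translation invariant, hence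
   proportional: write both sides as the measure of
   [{(y, x) | y \in B, L x + y \in A}] and translate each section. *)
Lemma leb_additive A B : measurable A -> measurable B ->
  m B * m (L @^-1` A) = m A * m ((fun x => topp (L x)) @^-1` B).
Proof.
move=> mA mB.
have mLA : measurable (L @^-1` A) by exact: measurable_preimageT.
have mNL : measurable_fun setT (fun x => topp (L x)) by exact: measurable_topp.
have mLB : measurable ((fun x => topp (L x)) @^-1` B) by exact: measurable_preimageT.
pose E := fst @^-1` B `&` (fun z : n.-tuple RT * n.-tuple RT => tadd (L z.2) z.1) @^-1` A.
pose E' := fst @^-1` A `&`
  (fun z : n.-tuple RT * n.-tuple RT => tadd (topp (L z.2)) z.1) @^-1` B.
have mLs : measurable_fun setT (fun z : n.-tuple RT * n.-tuple RT => L z.2).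
  exact: measurableT_comp.
have mE : measurable E.
  by apply: measurableI; apply: measurable_preimageT => //; exact: measurable_tadd.
have mE' : measurable E'.
  apply: measurableI; apply: measurable_preimageT => //; apply: measurable_tadd => //.
  exact: measurable_topp.
(* Tonelli for sets: the measure may be computed by sections in either variable. *)
have swap X : measurable X -> (m \x m) X = (m \x^ m) X.
  by apply: product_measure_unique => *; exact: product_measure2E.
have -> : m B * m (L @^-1` A) = (m \x m) E.
  rewrite -product_measure1E //; apply: eq_integral => y _ /=.
  have [yB|yB] := pselect (B y).
    rewrite in_xsectionX ?inE// -(leb_translate (L' y) mLA); congr (m _).
    by apply/seteqP; split => x; rewrite /xsection /= inE /E /= LD L'K => // -[].
  rewrite notin_xsectionX ?notin_setE// measure0.
  rewrite (_ : xsection _ _ = set0) ?measure0//.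
  by apply/seteqP; split => x //; rewrite /xsection /= inE /E => -[].
have -> : m A * m ((fun x => topp (L x)) @^-1` B) = (m \x m) E'.
  rewrite -product_measure1E //; apply: eq_integral => y _ /=.
  have [yA|yA] := pselect (A y).
    rewrite in_xsectionX ?inE// -(leb_translate (topp (L' y)) mLB); congr (m _).
    have e x : topp (L (tadd x (topp (L' y)))) = tadd (topp (L x)) y.
      rewrite LD LN L'K; apply: eq_from_tnth => i.
      by rewrite !(tnth_tadd, tnth_topp) opprD opprK.
    by apply/seteqP; split => x; rewrite /xsection /= inE /E' /= e => // -[].
  rewrite notin_xsectionX ?notin_setE// measure0.
  rewrite (_ : xsection _ _ = set0) ?measure0//.
  by apply/seteqP; split => x //; rewrite /xsection /= inE /E' => -[].
rewrite !swap//; apply: eq_integral => x _ /=.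
have mS : measurable (ysection E' x) by exact: measurable_ysection.
rewrite -(leb_translate (L x) mS); congr (m _).
apply/seteqP; split => y; rewrite /ysection /= !inE /E /E' /=.
  by rewrite [tadd (topp _) _]taddC taddK [tadd y _]taddC => -[].
by rewrite [tadd (topp _) _]taddC taddK [tadd y _]taddC => -[].
Qed.
End additive_bijection.
End lebesgue_linear.

(** * Lebesgue measure on the space of Hermitian matrices *)

Section coordinates.
Variables (R : realType) (k p : nat).
Hypothesis k3 : (k <= 3)%N.
Hypothesis kp : wassoc k p.
Notation F := (nda R k).
Notation M := ('M[F]_p).
Notation RT := (measurableTypeR R).
Notation N := #|hidx k p|.
Notation V := (N.-tuple RT).
Notation m := (leb R N).
Implicit Types (A B X Y S : M) (d : 'I_p -> R) (u v w : V).

Lemma hcoordD A B : hcoord (A + B) = tadd (hcoord A) (hcoord B).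
Proof.
apply: eq_from_tnth => r; rewrite tnth_tadd !tnth_mktuple.
by case: (enum_val r) => [i|[ij c]]; rewrite mxE ?nreD ?ncompD.
Qed.

Lemma tnth_hcoordZ a A r : tnth (hcoord (hscale a A)) r = a * tnth (hcoord A) r.
Proof.
rewrite !tnth_mktuple.
by case: (enum_val r) => [i|[ij c]]; rewrite mxE ?nreZ ?ncompZ.
Qed.

Lemma hmxD u v : hmx (tadd u v) = hmx u + hmx v :> M.
Proof.
rewrite -[RHS]hcoordK; last by apply: hermD; exact: herm_hmx.
by rewrite hcoordD !hmxK.
Qed.

Lemma hmxN u : hmx (topp u) = - hmx u :> M.
Proof.
rewrite -[RHS]hcoordK; last by apply: hermN; exact: herm_hmx.
congr hmx; apply: eq_from_tnth => r.
by rewrite tnth_topp -hscaleN1 tnth_hcoordZ hmxK mulN1r.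
Qed.

Record hlinear (f : M -> M) : Prop := HLinear {
  hlin_herm : forall X, herm X -> herm (f X);
  hlinD : forall X Y, herm X -> herm Y -> f (X + Y) = f X + f Y;
  hlinZ : forall a X, herm X -> f (hscale a X) = hscale a (f X)
}.

Lemma hhom_hlinear f : hhom f -> hlinear f.
Proof. by move=> hf; split; [exact: hhom_herm|exact: hhomD|exact: hhomZ]. Qed.

Lemma sandwich_hlinear S : herm S -> hlinear (sandwich S).
Proof.
move=> hS; split=> [X hX|X Y _ _|a X _]; first exact: herm_sandwich.
  exact: sandwichDr.
exact: sandwichZr.
Qed.

Lemma hlinN f X : hlinear f -> herm X -> f (- X) = - f X.
Proof. by move=> hf hX; rewrite -hscaleN1 (hlinZ hf)// hscaleN1. Qed.

Definition vact (f : M -> M) v : V := hcoord (f (hmx v)).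

Lemma vactD f u v : hlinear f -> vact f (tadd u v) = tadd (vact f u) (vact f v).
Proof. by move=> hf; rewrite /vact hmxD (hlinD hf) ?hcoordD//; exact: herm_hmx. Qed.

Lemma vactN f u : hlinear f -> vact f (topp u) = topp (vact f u).
Proof.
move=> hf; rewrite /vact hmxN (hlinN hf); last exact: herm_hmx.
by apply: eq_from_tnth => r; rewrite tnth_topp -hscaleN1 tnth_hcoordZ mulN1r.
Qed.

Definition vbasis (r : 'I_N) : V := [tuple (r == s)%:R | s < N].

Lemma hmx_sum v : hmx v = \sum_r hscale (tnth v r) (hmx (vbasis r)) :> M.
Proof.
have hs (s : seq 'I_N) : herm (\sum_(r <- s) hscale (tnth v r) (hmx (vbasis r)) : M).
  elim: s => [|r s IH]; first by rewrite big_nil; apply/hermE => i j; rewrite !mxE nconj0.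
  by rewrite big_cons; apply: hermD => //; apply: hermZ; exact: herm_hmx.
rewrite -[RHS]hcoordK//; congr hmx; apply: eq_from_tnth => t.
have e (s : seq 'I_N) : tnth (hcoord (\sum_(r <- s) hscale (tnth v r) (hmx (vbasis r)) : M)) t
    = \sum_(r <- s) tnth v r * (r == t)%:R.
  elim: s => [|r s IH].
    rewrite !big_nil -[0 in LHS](subrr (0 : M)) -hscaleN1 hcoordD tnth_tadd tnth_hcoordZ.
    by rewrite mulN1r subrr.
  by rewrite !big_cons hcoordD tnth_tadd IH tnth_hcoordZ hmxK tnth_mktuple.
rewrite e (bigD1 t)//= eqxx mulr1 big1 ?addr0// => r /negPf ->.
by rewrite mulr0.
Qed.

Lemma vact_sum f v t : hlinear f ->
  tnth (vact f v) t = \sum_r tnth v r * tnth (vact f (vbasis r)) t.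
Proof.
move=> hf; rewrite /vact hmx_sum.
suff: forall s : seq 'I_N, let S := \sum_(r <- s) hscale (tnth v r) (hmx (vbasis r)) : M in
  herm S /\ tnth (hcoord (f S)) t = \sum_(r <- s) tnth v r * tnth (vact f (vbasis r)) t.
  by move=> /(_ (index_enum _))[].
elim=> [|r s [hS IH]].
  rewrite /= !big_nil; have h0 : herm (0 : M) by apply/hermE => i j; rewrite !mxE nconj0.
  split=> //; have -> : (0 : M) = hscale 0 0 by apply/matrixP => i j; rewrite !mxE scale0r.
  by rewrite (hlinZ hf)// tnth_hcoordZ mul0r.
rewrite /= !big_cons; have hr : herm (hmx (vbasis r) : M) by exact: herm_hmx.
split; first by apply: hermD => //; exact: hermZ.
rewrite (hlinD hf)//; last exact: hermZ.
by rewrite (hlinZ hf)// hcoordD tnth_tadd tnth_hcoordZ IH.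
Qed.

Lemma measurable_vact f : hlinear f -> measurable_fun setT (vact f).
Proof.
move=> hf; apply/measurable_fun_tnthP => t.
rewrite (_ : _ \o _ = fun v => \sum_r tnth v r * tnth (vact f (vbasis r)) t); last first.
  by apply/funext => v /=; rewrite vact_sum.
apply: (@poly_sum R V (fun h => measurable_fun setT (h : V -> RT))).
- by move=> c; exact: measurable_cst.
- by move=> h h' mh mh'; exact: measurable_funD.
move=> r; apply: measurable_funM; first exact: measurable_tnth.
exact: measurable_cst.
Qed.

Lemma leb_vact f g (A B : set V) : hlinear f -> hlinear g -> (forall X, herm X -> f (g X) = X) ->
  measurable A -> measurable B ->
  (m B * m (vact f @^-1` A) = m A * m ((fun v => topp (vact f v)) @^-1` B))%E.
Proof.
move=> hf hg fg mA mB; apply: (@leb_additive R N (vact f) (vact g)) => //.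
- exact: measurable_vact hf.
- by move=> x y; exact: vactD.
- by move=> x; exact: vactN.
- move=> v; rewrite /vact hcoordK; last by apply: (hlin_herm hg); exact: herm_hmx.
  by rewrite fg ?hmxK//; exact: herm_hmx.
Qed.

Definition qball (c : R) : set V := [set v | tform (hmx v : M) (hmx v) <= c].

Lemma measurable_qball c : measurable (qball c).
Proof.
pose Q (h : V -> RT) := measurable_fun setT h.
have mq : measurable_fun setT (fun v : V => tform (hmx v : M) (hmx v) : RT).
  have Qc a : Q (fun=> a) by exact: measurable_cst.
  have QD h h' : Q h -> Q h' -> Q (fun v => h v + h' v) by move=> *; exact: measurable_funD.
  have QM h h' : Q h -> Q h' -> Q (fun v => h v * h' v) by move=> *; exact: measurable_funM.
  have mh : @mpoly R V Q k p (fun v => hmx v).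
    by apply: mpoly_hmx => // r; exact: measurable_tnth.
  by apply: (@poly_retr R V Q) => //; exact: mpoly_mul.
rewrite (_ : qball c = (fun v : V => tform (hmx v : M) (hmx v) : RT) @^-1` `]-oo, c]%classic).
  exact: measurable_preimageT.
by apply/seteqP; split => v; rewrite /qball /= in_itv.
Qed.

Lemma leb_qball_fin c : (m (qball c) < +oo)%E.
Proof.
pose b := Num.sqrt c.
pose C : set V := [set v | forall r, `[- b, b]%classic (tnth v r)].
have mC : measurable C.
  rewrite (_ : C = \bigcap_(r : 'I_N) ((fun v : V => tnth v r) @^-1` `[- b, b]%classic)).
    apply: fin_bigcap_measurable => [|r _]; first exact: finite_finset.
    by apply: measurable_preimageT => //; exact: measurable_tnth.
  by apply/seteqP; split => v h r; [move=> _; exact: h|exact: h].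
apply: (@le_lt_trans _ _ (m C)).
  apply: le_measure; rewrite ?inE //; first exact: measurable_qball.
  move=> v qv r; rewrite /= in_itv /= -ler_norml -sqrtr_sqr ler_wsqrtr//.
  rewrite -[v]hmxK -[hmx v]/(hmx v : M).
  by apply: le_trans (tnth_hcoord_le r (herm_hmx _)) _; exact: qv.
rewrite (leb_box (A := fun=> `[- b, b]%classic)) //.
rewrite (eq_bigr (fun=> ((if - b < b then b - - b else 0)%R)%:E)) => [|i _].
  by rewrite prodEFin ltry.
by rewrite lebesgue_measure_itv /= lte_fin; case: ifP => // _; rewrite -EFinB.
Qed.

(** The balls exhaust the space, which contains a unit cube of measure one, so they cannot all be
    null. *)
Lemma leb_qball_gt0 : exists c, (0 < m (qball c))%E.
Proof.
apply/not_existsP => h.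
have h0 c : m (qball c) = 0%E.
  by apply/eqP; rewrite eq_le measure_ge0 andbT leNgt; apply/negP; exact: h.
have : m.-negligible [set: V].
  rewrite (_ : setT = \bigcup_i qball i%:R).
    apply: negligible_bigcup => i; exists (qball i%:R).
    by split; [exact: measurable_qball|exact: h0|].
  apply/seteqP; split=> // v _.
  have [i hi] : exists i : nat, tform (hmx v : M) (hmx v) <= i%:R.
    exists (Num.truncn (tform (hmx v : M) (hmx v))).+1; apply: ltW; exact: truncnS_gt.
  by exists i.
move=> /negligibleP -/(_ measurableT) m0.
have := @leb_box R N (fun=> `[0, 1]%classic) (fun=> measurable_itv _).
rewrite (eq_bigr (fun=> 1%E)) => [|i _]; last first.
  by rewrite lebesgue_measure_itv /= lte_fin ltr01 -EFinB subr0.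
rewrite big1_eq => e1; suff : (1 <= 0 :> \bar R)%E by rewrite lee_fin ler10.
rewrite -m0 -e1; apply: le_measure; rewrite ?inE//.
rewrite (_ : mkset _ = \bigcap_(r : 'I_N) ((fun v : V => tnth v r) @^-1` `[0, 1]%classic)).
  apply: fin_bigcap_measurable => [|r _]; first exact: finite_finset.
  by apply: measurable_preimageT => //; exact: measurable_tnth.
by apply/seteqP; split => v h' r; [move=> _; exact: h'|exact: h'].
Qed.

Lemma mule_cancel (b c : R) (x y : \bar R) : 0 < b ->
  (b%:E * x = y * c%:E -> x = (c / b)%:E * y)%E.
Proof.
move=> b0 e; rewrite mulrC EFinM -muleA [(c%:E * y)%E]muleC -e muleA -EFinM.
by rewrite mulVf ?gt_eqF// mul1e.
Qed.

Lemma tformNN X Y : tform (- X) (- Y) = tform X Y.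
Proof. by rewrite -!hscaleN1 tformZl tformZr mulrA mulrNN !mul1r. Qed.

(* [leb_vact] computes the scaling factor from one set: here a ball of the invariant
   form [tform]; for diagonal matrices, a cube. *)
Lemma leb_haut f g (A : set V) : haut f g -> measurable A -> m (vact f @^-1` A) = m A.
Proof.
move=> fg mA; have [c c0] := leb_qball_gt0; have cf := leb_qball_fin c.
have := @leb_vact f g A (qball c) (hhom_hlinear (haut_l fg)) (hhom_hlinear (haut_r fg))
  (fun X hX => hautK (haut_sym fg) hX) mA (measurable_qball c).
rewrite (_ : _ @^-1` qball c = qball c); last first.
  apply/seteqP; split => v; rewrite /qball /= /vact hmxN.
    rewrite hcoordK; last by apply: (hhom_herm (haut_l fg)); exact: herm_hmx.
    by rewrite tformNN (haut_tform fg)//; exact: herm_hmx.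
  rewrite hcoordK; last by apply: (hhom_herm (haut_l fg)); exact: herm_hmx.
  by rewrite tformNN (haut_tform fg)//; exact: herm_hmx.
have : m (qball c) \is a fin_num by rewrite ge0_fin_numE.
move: c0 => /[swap] /fineK <-; set b := fine _; rewrite lte_fin => b0 e.
by rewrite (mule_cancel b0 e) divff ?gt_eqF// mul1e.
Qed.

Definition hscaling d (x : hidx k p) : R :=
  match x with inl i => d i * d i | inr (ij, _) => d (val ij).1 * d (val ij).2 end.

Lemma tnth_vact_dg d v r :
  tnth (vact (sandwich (dg k d)) v) r = hscaling d (enum_val r) * tnth v r.
Proof.
rewrite -[v in RHS]hmxK !tnth_mktuple /hscaling.
by case: (enum_val r) => [i|[ij c]]; rewrite sandwich_dg ?nreZ ?ncompZ.
Qed.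

(** Each index counts twice in its diagonal coordinate and once in each of the p - 1 off-diagonal
    positions containing it, which carry 2^k real coordinates each. *)
Lemma prod_hscaling d : \prod_(r < N) hscaling d (enum_val r) =
  (\prod_i d i) ^+ (2 + p.-1 * 2 ^ k).
Proof.
rewrite -(big_enum_val (fun x : hidx k p => hscaling d x)) /=.
rewrite (eq_bigl (fun=> true)) //.
rewrite big_sumType /= exprD; congr (_ * _); first by rewrite big_split /= expr2.
rewrite (eq_bigr (fun x : {ij : 'I_p * 'I_p | (ij.1 < ij.2)%N} * cidx k =>
  d (val x.1).1 * d (val x.1).2)) => [|[]//].
rewrite -(pair_bigA _ (fun (ij : {ij : 'I_p * 'I_p | (ij.1 < ij.2)%N}) (c : cidx k) =>
  d (val ij).1 * d (val ij).2)) /=.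
under eq_bigr do rewrite big_const iter_mulr_1 card_cidx.
rewrite prodrXl exprM; congr (_ ^+ _).
transitivity (\prod_(ij : 'I_p * 'I_p | (ij.1 < ij.2)%N) (d ij.1 * d ij.2)).
  by rewrite (big_sub (fun ij : 'I_p * 'I_p => (ij.1 < ij.2)%N) (fun ij => d ij.1 * d ij.2)).
rewrite big_split /=.
rewrite -(pair_big_dep xpredT (fun i j : 'I_p => (i < j)%N) (fun i j => d i)) /=.
rewrite [X in _ * X](reindex_inj (inv_inj (@swap_pairK _ _))) /=.
rewrite -(pair_big_dep xpredT (fun i j : 'I_p => (j < i)%N) (fun i j => d i)) /=.
rewrite -big_split -prodrXl; apply: eq_bigr => i _ /=.
have -> : p.-1 = #|predC1 i| by rewrite cardC1 card_ord.
rewrite -(prodr_const (predC1 i)) [RHS](bigID (fun j : 'I_p => (i < j)%N)) /=.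
congr (_ * _); apply: eq_bigl => j; rewrite inE.
  by case: eqVneq => [->|]; rewrite ?ltnn.
by rewrite -leqNgt ltn_neqAle andbC.
Qed.

Lemma leb_dg d (A : set V) : (forall i, 0 < d i) -> measurable A ->
  (m (vact (sandwich (dg k d)) @^-1` A) =
   (((\prod_i d i) ^+ (2 + p.-1 * 2 ^ k))^-1)%:E * m A)%E.
Proof.
move=> d0 mA; pose l (r : 'I_N) := hscaling d (enum_val r).
have l0 r : 0 < l r by rewrite /l; case: (enum_val r) => [i|[ij c]]; rewrite mulr_gt0.
pose C : set V := [set v | forall r, `[- 1, 1]%classic (tnth v r)].
have mC : measurable C.
  rewrite (_ : C = \bigcap_(r : 'I_N) ((fun v : V => tnth v r) @^-1` `[- 1, 1]%classic)).
    apply: fin_bigcap_measurable => [|r _]; first exact: finite_finset.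
    by apply: measurable_preimageT => //; exact: measurable_tnth.
  by apply/seteqP; split => v h r; [move=> _; exact: h|exact: h].
have mCE : m C = (2 ^+ N)%:E.
  rewrite /C (leb_box (A := fun=> `[- 1, 1]%classic)) //.
  rewrite (eq_bigr (fun=> (2 : R)%:E)) => [|i _].
    by rewrite prodEFin prodr_const card_ord.
  by rewrite lebesgue_measure_itv /= lte_fin gtrN// -EFinB opprK.
have di0 i : 0 < (d i)^-1 by rewrite invr_gt0.
have := @leb_vact _ (sandwich (dg k (fun i => (d i)^-1))) A C
   (sandwich_hlinear (herm_dg k d)) (sandwich_hlinear (herm_dg k _))
   (fun X _ => sandwich_dgK X d0) mA mC.
rewrite mCE (_ : _ @^-1` C =
  [set v | forall r, `[- (l r)^-1, (l r)^-1]%classic (tnth v r)]); last first.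
  apply/seteqP; split => v h r; have := h r; rewrite /= !in_itv /= tnth_topp tnth_vact_dg;
    rewrite -/(l r) -!ler_norml normrN normrM (gtr0_norm (l0 r)) => {}h.
    by rewrite -[leRHS]mulr1 ler_pdivlMl.
  by rewrite -ler_pdivlMl// mulr1.
rewrite (leb_box (A := fun r => `[- (l r)^-1, (l r)^-1]%classic)) //.
rewrite (eq_bigr (fun r => (2 / l r)%:E)) => [|r _]; last first.
  rewrite lebesgue_measure_itv /= lte_fin gtrN ?invr_gt0// -EFinB opprK.
  by congr (_%:E); rewrite mulrDl mul1r.
rewrite prodEFin big_split /= prodr_const card_ord => e.
have b0 : (0 < 2 ^+ N :> R) by rewrite exprn_gt0.
rewrite (mule_cancel b0 e) mulrAC divff ?gt_eqF// mul1r.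
by rewrite prodfV prod_hscaling.
Qed.

Lemma leb_sandwich S (c : R) (A : set V) : pd S -> 0 < c -> hdet (nmulmx S S) = c ^+ 2 ->
  measurable A ->
  (m (vact (sandwich S) @^-1` A) = ((c ^+ (2 + p.-1 * 2 ^ k))^-1)%:E * m A)%E.
Proof.
move=> pS c0 Sc mA; have [f [g [d [fg Sd d0]]]] := pd_diagonalise k3 kp pS.
have gf := haut_sym fg; have hf := hhom_hlinear (haut_l fg).
have hg := hhom_hlinear (haut_r fg); have hd := sandwich_hlinear (herm_dg k d).
(* [c] is given through its square only; positivity identifies it. *)
have cd : c = \prod_i d i.
  have pd0 : 0 <= \prod_i d i by apply: prodr_ge0 => i _; exact: ltW.
  apply/eqP; rewrite -(eqrXn2 (n := 2))// ?(ltW c0)// -Sc Sd.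
  rewrite (hhom_sq (haut_r fg)) ?dg_sq; last exact: herm_dg.
  by rewrite (hhom_det (haut_r fg)) ?hdet_dg ?prodrXl//; exact: herm_dg.
have e v : vact (sandwich S) v = vact g (vact (sandwich (dg k d)) (vact f v)).
  have h := herm_hmx v; have hfv := hlin_herm hf h; have hdv := hlin_herm hd hfv.
  by rewrite /vact !hcoordK ?(sandwich_diag fg Sd).
rewrite (_ : _ @^-1` A = vact f @^-1` (vact (sandwich (dg k d)) @^-1` (vact g @^-1` A))).
  rewrite (leb_haut fg).
    rewrite leb_dg// -?cd ?(leb_haut gf)//.
    exact: measurable_preimageT (measurable_vact hg) mA.
  apply: measurable_preimageT (measurable_vact hd) _.
  exact: measurable_preimageT (measurable_vact hg) mA.
by apply/seteqP; split => v /=; rewrite e.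
Qed.
End coordinates.

(** * Transfer of densities *)

Section affine.
Variables (R : realType) (k p : nat).
Hypothesis k3 : (k <= 3)%N.
Hypothesis kp : wassoc k p.
Notation F := (nda R k).
Notation M := ('M[F]_p).
Notation RT := (measurableTypeR R).
Notation N := #|hidx k p|.
Notation V := (N.-tuple RT).
Notation m := (leb R N).
Notation hm := (@hmx R k p).
Variables S Psi : M.
Hypotheses (pS : pd S) (hPsi : herm Psi).

Definition aff (v : V) : V := tadd (vact (sandwich S) v) (hcoord Psi).
Definition affi (w : V) : V := vact (sandwich (hinv S)) (tadd w (topp (hcoord Psi))).

Lemma hmx_aff v : hmx (aff v) = sandwich S (hmx v) + Psi.
Proof.
have h := herm_hmx v; have h' := herm_sandwich pS.1 h.
by rewrite /aff hmxD /vact !hcoordK.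
Qed.

Lemma hmx_affi w : hmx (affi w) = sandwich (hinv S) (hmx w - Psi).
Proof.
rewrite /affi /vact hmxD hmxN (hcoordK hPsi) hcoordK//.
by apply: herm_sandwich; [exact: (pd_hinv k3 kp pS).1|exact/hermB/hPsi/herm_hmx].
Qed.

Lemma hmx_affiK w : sandwich S (hmx (affi w)) + Psi = hmx w.
Proof.
rewrite hmx_affi (sandwich_hinvK k3 kp pS _).1 ?subrK//.
by apply: hermB => //; exact: herm_hmx.
Qed.

Lemma measurable_aff : measurable_fun setT aff.
Proof.
apply: measurable_tadd; last exact: measurable_cst.
exact: measurable_vact (sandwich_hlinear pS.1).
Qed.

Lemma measurable_affi : measurable_fun setT affi.
Proof.
apply: measurableT_comp.
  exact: measurable_vact (sandwich_hlinear (pd_hinv k3 kp pS).1).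
by apply: measurable_tadd => //; exact: measurable_cst.
Qed.

Variable c : R.
Hypotheses (c0 : 0 < c) (Sc : hdet (nmulmx S S) = c ^+ 2).
Let J := c ^+ (2 + p.-1 * 2 ^ k).

Let J0 : 0 < J. Proof. exact: exprn_gt0. Qed.

Lemma leb_aff A : measurable A -> (m (aff @^-1` A) = (J^-1)%:E * m A)%E.
Proof.
move=> mA; rewrite -(leb_translate (hcoord Psi) mA) -(leb_sandwich k3 kp pS c0 Sc)//.
by apply: measurable_preimageT => //; apply: measurable_tadd => //; exact: measurable_cst.
Qed.

Lemma integral_aff (D : set V) (f : V -> \bar R) : measurable D ->
  measurable_fun D f -> (forall v, D v -> (0 <= f v)%E) ->
  ((J^-1)%:E * \int[m]_(w in D) f w = \int[m]_(v in aff @^-1` D) f (aff v))%E.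
Proof.
move=> mD mf f0.
rewrite -(ge0_integral_pushforward measurable_aff m mD mf); last first.
  by move=> v; rewrite inE; exact: f0.
have Jn : 0 <= J^-1 by rewrite invr_ge0 ltW.
rewrite -(ge0_integral_mscale m mD (NngNum Jn) mf f0).
apply: eq_measure_integral => [|maff A mA _]; first exact: measurable_aff.
exact/esym/leb_aff.
Qed.

Lemma has_density_aff d (T : measurableType d) (P : probability T R)
    (U : T -> M) (D0 D : set M) (f0 f : M -> R) :
  has_density P U D0 f0 ->
  (forall Y, D Y -> herm Y) ->
  (forall Y, herm Y -> D (sandwich S Y + Psi) <-> D0 Y) ->
  (forall Y, herm Y -> D0 Y -> f (sandwich S Y + Psi) = J^-1 * f0 Y) ->
  has_density P (fun w => sandwich S (U w) + Psi) D f.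
Proof.
move=> [[hU mU] mD0 mf0 f0_ge0 PU] hD DD0 ff0.
have eD : hm @^-1` D = affi @^-1` (hm @^-1` D0).
  by apply/seteqP; split => w /=; rewrite -[in D _](hmx_affiK w) => /DD0; apply; exact: herm_hmx.
have eX : @hcoord R k p \o (fun w => sandwich S (U w) + Psi) = aff \o (@hcoord R k p \o U).
  by apply/funext => w; rewrite /= /aff /vact hcoordK// hcoordD.
have mD : measurable (hm @^-1` D).
  by rewrite eD; apply: measurable_preimageT => //; exact: measurable_affi.
have ef w : (hm @^-1` D) w -> f (hmx w) = J^-1 * f0 (hmx (affi w)).
  rewrite eD /= => Dw; rewrite -[in LHS](hmx_affiK w) ff0//; exact: herm_hmx.
(* Coordinates see Hermitian matrices only; [hD] ensures that [A] is recovered from its own. *)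
have f_ge0 A : D A -> 0 <= f A.
  move=> DA; have := DA; rewrite -[A in D A](hcoordK (hD _ DA)) => DA'.
  rewrite -(hcoordK (hD _ DA)) ef// mulr_ge0 ?invr_ge0 ?(ltW J0)//.
  by apply: f0_ge0; move: DA'; rewrite -[D _]/((hm @^-1` D) _) eD.
have mf : measurable_fun (hm @^-1` D) (f \o hm).
  apply: (eq_measurable_fun (fun w => J^-1 * (f0 \o hm) (affi w))) => [w|].
    by rewrite inE /= => Dw; rewrite ef.
  apply: measurable_funM; first exact: measurable_cst.
  apply: (measurable_comp mD0 _ mf0); last exact: measurable_funTS measurable_affi.
  by move=> _ [w + <-]; rewrite eD.
split => //.
- split=> [w|]; first by apply: hermD => //; apply: herm_sandwich => //; exact: pS.1.
  by rewrite eX; exact: measurableT_comp measurable_aff mU.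
move=> B mB; rewrite eX comp_preimage PU; last exact: measurable_preimageT measurable_aff mB.
have eB : aff @^-1` (B `&` hm @^-1` D) = aff @^-1` B `&` hm @^-1` D0.
  apply/seteqP; split => v /= [Bv]; rewrite hmx_aff => /DD0 Dv; split => //;
    by apply: Dv; exact: herm_hmx.
have mBD : measurable (B `&` hm @^-1` D) by exact: measurableI.
have mBD0 : measurable (aff @^-1` B `&` hm @^-1` D0).
  by apply: measurableI => //; exact: measurable_preimageT measurable_aff mB.
have := @integral_aff _ (fun w => (f (hmx w))%:E) mBD.
rewrite eB => /(_ _ _)/esym.
rewrite (eq_integral (fun v => (J^-1)%:E * (f0 (hmx v))%:E)%E); last first.
  by move=> v; rewrite inE => -[_ Dv]; rewrite hmx_aff ff0//; exact: herm_hmx.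
rewrite ge0_integralZl//; first last.
- by rewrite lee_fin invr_ge0 ltW.
- by move=> v [_ Dv]; rewrite lee_fin f0_ge0.
- apply: measurableT_comp => //; apply: measurable_funS mf0 => //; exact: subIsetr.
(* The Jacobian is finite and positive, so it cancels even when an integral is infinite. *)
move=> e; have : (forall x y : \bar R, (J^-1)%:E * x = (J^-1)%:E * y -> x = y)%E.
  move=> x y /(congr1 (fun z => J%:E * z)%E); rewrite !muleA -EFinM mulfV ?gt_eqF//.
  by rewrite !mul1e.
apply; apply: e.
  apply/measurable_EFinP; apply: measurable_funS mf => //; exact: subIsetr.
by move=> v [_ Dv]; rewrite lee_fin f_ge0.
Qed.
End affine.

(** * The density of the transformed matrix *)

Theorem lemma2p1 (R : realType) (k p : nat)
  (k_le3 : (k <= 3)%N) (p_ge1 : (1 <= p)%N)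
  (octonion_le3 : k = 3%N -> (p <= 3)%N)
  (a1 a2 : R)
  (a1_gt : (p%:R - 1) * beta R k / 2 < a1)
  (a2_gt : (p%:R - 1) * beta R k / 2 < a2)
  (Sigma : 'M[nda R k]_p) (Sigma_pd : pd Sigma)
  (d : measure_display) (T : measurableType d) (P : probability T R)
  (U : T -> 'M[nda R k]_p) (U_KB1 : KB1 P U a1 a2 Sigma)
  (Psi Omega : 'M[nda R k]_p)
  (Psi_herm : herm Psi) (Omega_pd : pd Omega) (OmegaPsi_pd : pd (Omega - Psi)) :
  let S := hsqrt (Omega - Psi) in
  let Theta := sandwich (hinv S) Sigma in
  let X := fun w : T => sandwich S (U w) + Psi in
  has_density P X [set Y | hlt Psi Y /\ hlt Y Omega]
    (fun Y => C1 a1 a2 Theta Omega Psi * etr (- nmulmx Theta Y)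
      * hdet (Y - Psi) `^ (a1 - (p%:R - 1) * beta R k / 2 - 1)
      * hdet (Omega - Y) `^ (a2 - (p%:R - 1) * beta R k / 2 - 1)).
Proof.
move=> S Theta X.
have kp : wassoc k p.
  rewrite /wassoc; move: k_le3 octonion_le3; rewrite leq_eqVlt ltnS.
  by move=> /orP[/eqP -> /(_ erefl) ->|->]; rewrite ?orbT.
have [pS SS] : pd S /\ nmulmx S S = Omega - Psi := hsqrtP k_le3 kp OmegaPsi_pd.
have [c c0 [Sc detS]] := hdet_sandwich k_le3 kp pS.
have hSigma := Sigma_pd.1; have hS := pS.1.
have pSi : pd (hinv S) := pd_hinv k_le3 kp pS; have hSi := pSi.1.
have hTheta : herm Theta by exact: herm_sandwich.
have STheta : sandwich S Theta = Sigma := (sandwich_hinvK k_le3 kp pS hSigma).1.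
(* Since S I S = S^2 = Omega - Psi, the upper constraint is the image of Y < I. *)
have eOmega Y : Omega - (sandwich S Y + Psi) = sandwich S (nid R k p - Y).
  by rewrite sandwichBr sandwich1 SS opprD addrA addrAC.
have ePsi Y : sandwich S Y + Psi - Psi = sandwich S Y by rewrite addrK.
have pdS Y : herm Y -> pd (sandwich S Y) <-> pd Y.
  move=> hY; split => h; last exact: pd_sandwich.
  by rewrite -(sandwich_hinvK k_le3 kp pS hY).2; exact: pd_sandwich.
have hnid := herm_nid R k p.
apply: (has_density_aff k_le3 kp pS Psi_herm c0 Sc U_KB1).
- by move=> Y [[hY _] _]; rewrite -(subrK Psi Y); exact: hermD.
- move=> Y hY; rewrite /= /hlt eOmega ePsi subr0.
  have h1 := pdS Y hY; have h2 := pdS _ (hermB hnid hY).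
  by split=> -[? ?]; split; [apply/h1|apply/h2|apply/h1|apply/h2].
move=> Y hY [Y0 Y1]; rewrite eOmega ePsi !detS//; last exact: hermB.
have etrE (A B : 'M[nda R k]_p) : etr (- nmulmx A B) = expR (- tform A B).
  by rewrite /etr -hscaleN1 nretrZ mulN1r.
(* Self-adjointness of Y to S Y S moves [S] onto [Theta] and yields [Sigma]; the factor etr(Theta
   Psi) in [C1] cancels the contribution of the shift. *)
have etr1 : etr (nmulmx Theta Psi) * etr (- nmulmx Theta (sandwich S Y + Psi)) =
    etr (- nmulmx Sigma Y).
  rewrite !etrE -expRD tformDr -(tform_sandwich k_le3 kp pS hTheta hY) STheta.
  by congr expR; rewrite /tform; ring.
have c2 : 0 < c ^+ 2 by rewrite exprn_gt0.
have hY0 : 0 < hdet Y by apply: (hdet_pd_gt0 k_le3 kp); rewrite -[Y]subr0.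
have hY1 : 0 < hdet (nid R k p - Y) by apply: (hdet_pd_gt0 k_le3 kp).
(* The exponents add up to -((p - 1) beta / 2 + 1), half the Jacobian exponent because the base is
   c^2: the power in [C1] is what the two determinants leave over after division by the Jacobian. *)
have cn : (c ^+ 2) `^ (- (a1 + a2) + hexp R k p + 1) * (c ^+ 2) `^ (a1 - hexp R k p - 1)
    * (c ^+ 2) `^ (a2 - hexp R k p - 1) = c ^- (2 + p.-1 * 2 ^ k).
  rewrite -!powRD ?(gt_eqF c2) ?implybT//.
  rewrite (_ : _ + (a2 - _ - 1) = - ((2 + p.-1 * 2 ^ k)%:R / 2)); last first.
    rewrite /hexp /beta natrD natrM natrX -subn1 natrB//; field; done.
  rewrite powRN -(powR_mulrn 2 (ltW c0)) -powRrM mulrCA divff// mulr1.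
  by rewrite powR_mulrn// ltW.
rewrite /C1 -/S STheta -etr1 -SS Sc -cn -/(hexp R k p).
move: (c ^+ 2) c2 => q q0; rewrite !powRM ?(ltW q0) ?(ltW hY0) ?(ltW hY1)//.
ring.
Qed.
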